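(* Let $R$ be any commutative Artin ring and let $R=\prod_{i=1}^nR_i$ be its unique decomposition into Artin local rings, with $\operatorname{Spec}(R)=\{p_1,\dots,p_n\}$, $p_i$ corresponding to the unique prime ideal of $R_i$. For every subset $S$ of $\operatorname{Spec}(R)$ and every subgroup $H$ of $\bigoplus_{p_i\in S}\mathbb{Z}$, define $$\mathcal{T}(S,H):=\Big\{X\in\mathcal{T}_S:\Big(\bigoplus_{p_i\in S}\Lambda_{p_i}\Big)(X)\in H\Big\}.$$ This is a complete list of triangulated subcategories of $D^b(\operatorname{proj} R)$. Further, every dense triangulated subcategory of $\mathcal{T}_S$ is a triangulated ideal if and only if $S$ is a one-point space.
   Context: All subcategories are full (and closed under isomorphism). $D^b(\operatorname{proj} R)$ is the chain homotopy category of perfect complexes, i.e. bounded complexes of finitely generated projective $R$-modules, a tensor triangulated category under $\otimes_R$. $\operatorname{Supp}(X)=\{\mathfrak{p}\in\operatorname{Spec}(R):X\otimes R_{\mathfrak{p}}\ne0\}$ (non-zero in the derived category) and $\mathcal{T}_S=\{X\in D^b(\operatorname{proj} R):\operatorname{Supp}(X)\subseteq S\}$. Writing $p_i$ also for the maximal ideal of $R_i$, $\Lambda_{p_i}(X)=\sum_{t}(-1)^t\dim_{R_i/p_i}H_t(X\otimes R_i/p_i)$ (tensor over $R$, with $R$ acting on $R_i/p_i$ via the projection $R\to R_i$). A triangulated subcategory $\mathcal{C}\subseteq\mathcal{T}$ is dense in $\mathcal{T}$ if every object of $\mathcal{T}$ is a direct summand of an object of $\mathcal{C}$. A triangulated ideal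 is a triangulated subcategory $\mathcal{C}$ of $D^b(\operatorname{proj} R)$ such that $X\otimes Y\in\mathcal{C}$ for all $X\in\mathcal{C}$ and all $Y\in D^b(\operatorname{proj} R)$.
   Formalization: In the final equivalence S is assumed non-empty, because for empty S the category T_S is zero, its only dense triangulated subcategory is an ideal, and yet S is not a one-point space. *)

(* Defs.v *)
From HB Require Import structures.
From mathcomp Require Import all_boot all_algebra ring.
From mathcomp Require Import boolp classical_sets fsbigop.

Set Implicit Arguments.
Unset Strict Implicit.
Unset Printing Implicit Defensive.

Import GRing.Theory.
Local Open Scope classical_set_scope.
Local Open Scope ring_scope.
Local Open Scope quotient_scope.

Definition mklinear (R : pzRingType) (U V : lmodType R) (f : U -> V)
  (lf : linear f) : {linear U -> V} :=
  HB.pack f (GRing.isLinear.Build R U V *:%R f lf).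

Section Ideals.
Variable R : comPzRingType.

Definition is_ideal (I : set R) : Prop :=
  [/\ I 0, forall x y, I x -> I y -> I (x + y) & forall r x, I x -> I (r * x)].

Record Spec := PrimeIdeal {
  prime_set :> R -> Prop;
  prime_ideal : is_ideal prime_set;
  prime_proper : ~ prime_set 1;
  primeM : forall x y, prime_set (x * y) -> prime_set x \/ prime_set y
}.

Definition is_maximal (m : set R) : Prop :=
  [/\ is_ideal m, ~ m 1 &
      forall J, is_ideal J -> ~ J 1 -> m `<=` J -> J = m].

Definition artinian : Prop :=
  forall I : nat -> set R, (forall k, is_ideal (I k)) ->
    (forall k, I k.+1 `<=` I k) ->
    exists N, forall k, (N <= k)%N -> I k = I N.

Definition local_with (m : set R) : Prop :=
  is_maximal m /\ forall m', is_maximal m' -> m' = m.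

End Ideals.

Section Preimage.
Variables (R A : comPzRingType) (f : {rmorphism R -> A}) (p : Spec A).

Let pre : set R := [set x | p (f x)].

Fact preimage_ideal : is_ideal pre.
Proof.
case: (prime_ideal p) => p0 pD pM; split.
- by rewrite /pre /= rmorph0.
- by move=> x y; rewrite /pre /= rmorphD; exact: pD.
- by move=> r x; rewrite /pre /= rmorphM; exact: pM.
Qed.

Fact preimage_proper : ~ pre 1.
Proof. by rewrite /pre /= rmorph1; exact: prime_proper. Qed.

Fact preimageM x y : pre (x * y) -> pre x \/ pre y.
Proof. by rewrite /pre /= rmorphM; exact: primeM. Qed.

Definition spec_preimage : Spec R :=
  PrimeIdeal preimage_ideal preimage_proper preimageM.

End Preimage.

Section Residue.
Variables (A : comNzRingType) (p : Spec A).

Definition prime_pred : {pred A} := fun x => `[< p x >].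

Fact prime_pred_closed : idealr_closed prime_pred.
Proof.
case: (prime_ideal p) => p0 pD pM; split; rewrite ?unfold_in.
- exact/asboolP.
- exact/asboolPn/prime_proper.
- move=> a u v; rewrite !unfold_in => /asboolP pu /asboolP pv.
  by apply/asboolP/pD => //; exact: pM.
Qed.

HB.instance Definition _ := isIdealr.Build A prime_pred prime_pred_closed.

Definition residue_ring : comNzRingType := {ideal_quot prime_pred}.

Definition residue_proj : {rmorphism A -> residue_ring} :=
  \pi_{ideal_quot prime_pred}.

End Residue.

(* A set with operations that satisfy the axioms of a module up to the
   congruence [pm_eq]; tensor products, localizations and homology are all
   built as the quotient of such a structure. *)
Record premodule (A : pzRingType) := PreModule {
  pm_sort :> Type;
  pm_eq : pm_sort -> pm_sort -> Prop;
  pm_zero : pm_sort;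
  pm_opp : pm_sort -> pm_sort;
  pm_add : pm_sort -> pm_sort -> pm_sort;
  pm_scale : A -> pm_sort -> pm_sort;
  pm_refl : forall x, pm_eq x x;
  pm_sym : forall x y, pm_eq x y -> pm_eq y x;
  pm_trans : forall x y z, pm_eq x y -> pm_eq y z -> pm_eq x z;
  pm_oppE : forall x y, pm_eq x y -> pm_eq (pm_opp x) (pm_opp y);
  pm_addE : forall x x' y y', pm_eq x x' -> pm_eq y y' ->
    pm_eq (pm_add x y) (pm_add x' y');
  pm_scaleE : forall a x y, pm_eq x y -> pm_eq (pm_scale a x) (pm_scale a y);
  pm_addA : forall x y z,
    pm_eq (pm_add x (pm_add y z)) (pm_add (pm_add x y) z);
  pm_addC : forall x y, pm_eq (pm_add x y) (pm_add y x);
  pm_add0 : forall x, pm_eq (pm_add pm_zero x) x;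
  pm_addN : forall x, pm_eq (pm_add (pm_opp x) x) pm_zero;
  pm_scaleA : forall a b x,
    pm_eq (pm_scale a (pm_scale b x)) (pm_scale (a * b) x);
  pm_scale1 : forall x, pm_eq (pm_scale 1 x) x;
  pm_scaleDr : forall a x y,
    pm_eq (pm_scale a (pm_add x y)) (pm_add (pm_scale a x) (pm_scale a y));
  pm_scaleDl : forall x a b,
    pm_eq (pm_scale (a + b) x) (pm_add (pm_scale a x) (pm_scale b x))
}.

Section ModuleQuotient.
Variables (A : pzRingType) (P : premodule A).

Definition pm_rel : rel {classic P} := fun x y => `[< pm_eq (x : P) (y : P) >].

Fact pm_rel_equiv : equiv_class_of pm_rel.
Proof.
split.
- by move=> x; apply/asboolP; exact: pm_refl.
- by move=> x y; apply/asboolP/asboolP; exact: pm_sym.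
- move=> y x z /asboolP xy /asboolP yz; apply/asboolP.
  exact: pm_trans xy yz.
Qed.
Canonical pm_rel_equivRel := EquivRelPack pm_rel_equiv.
Canonical pm_rel_encModRel := defaultEncModRel pm_rel.

Definition mquot := {eq_quot pm_rel}.
HB.instance Definition _ := Choice.on mquot.
HB.instance Definition _ := EqQuotient.on mquot.

Definition cls (x : P) : mquot := \pi_mquot (x : {classic P}).
Definition rep (q : mquot) : P := repr q.

Lemma clsP x y : cls x = cls y <-> pm_eq x y.
Proof.
split; first by move/eqP; rewrite /cls piE => /asboolP.
by move=> xy; apply/eqP; rewrite /cls piE; apply/asboolP.
Qed.

Lemma repK q : cls (rep q) = q. Proof. exact: reprK. Qed.

Lemma rep_cls x : pm_eq (rep (cls x)) x.
Proof. by apply/clsP; rewrite repK. Qed.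

Definition mq_zero : mquot := cls (pm_zero P).
Definition mq_opp (x : mquot) := cls (pm_opp (rep x)).
Definition mq_add (x y : mquot) := cls (pm_add (rep x) (rep y)).
Definition mq_scale (a : A) (x : mquot) := cls (pm_scale a (rep x)).

Lemma mq_oppE x : mq_opp (cls x) = cls (pm_opp x).
Proof. by apply/clsP/pm_oppE/rep_cls. Qed.
Lemma mq_addE x y : mq_add (cls x) (cls y) = cls (pm_add x y).
Proof. by apply/clsP/pm_addE; exact: rep_cls. Qed.
Lemma mq_scaleE a x : mq_scale a (cls x) = cls (pm_scale a x).
Proof. by apply/clsP/pm_scaleE/rep_cls. Qed.

Fact mq_addA : associative mq_add.
Proof.
move=> x y z; rewrite -[x]repK -[y]repK -[z]repK !mq_addE.
exact/clsP/pm_addA.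
Qed.
Fact mq_addC : commutative mq_add.
Proof.
by move=> x y; rewrite -[x]repK -[y]repK !mq_addE; exact/clsP/pm_addC.
Qed.
Fact mq_add0 : left_id mq_zero mq_add.
Proof. by move=> x; rewrite -[x]repK mq_addE; exact/clsP/pm_add0. Qed.
Fact mq_addN : left_inverse mq_zero mq_opp mq_add.
Proof. by move=> x; rewrite -[x]repK mq_oppE mq_addE; exact/clsP/pm_addN. Qed.
HB.instance Definition _ :=
  GRing.isZmodule.Build mquot mq_addA mq_addC mq_add0 mq_addN.

Fact mq_scaleA a b x : mq_scale a (mq_scale b x) = mq_scale (a * b) x.
Proof. by rewrite -[x]repK !mq_scaleE; exact/clsP/pm_scaleA. Qed.
Fact mq_scale1 : left_id 1 mq_scale.
Proof. by move=> x; rewrite -[x]repK mq_scaleE; exact/clsP/pm_scale1. Qed.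
Fact mq_scaleDr : right_distributive mq_scale +%R.
Proof.
move=> a x y; rewrite -[x]repK -[y]repK.
rewrite -[LHS]/(mq_scale a (mq_add _ _)) -[RHS]/(mq_add _ _).
by rewrite !(mq_addE, mq_scaleE); exact/clsP/pm_scaleDr.
Qed.
Fact mq_scaleDl x : {morph mq_scale^~ x : a b / a + b}.
Proof.
move=> a b; rewrite -[x]repK -[RHS]/(mq_add _ _).
by rewrite !(mq_addE, mq_scaleE); exact/clsP/pm_scaleDl.
Qed.
HB.instance Definition _ := GRing.Zmodule_isLmodule.Build A mquot
  mq_scaleA mq_scale1 mq_scaleDr mq_scaleDl.

Lemma clsD x y : cls (pm_add x y) = cls x + cls y.
Proof. by rewrite -mq_addE. Qed.
Lemma clsN x : cls (pm_opp x) = - cls x.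
Proof. by rewrite -mq_oppE. Qed.
Lemma clsZ a x : cls (pm_scale a x) = a *: cls x.
Proof. by rewrite -mq_scaleE. Qed.

End ModuleQuotient.

Section QuotientMap.
Variables (A : pzRingType) (P Q : premodule A) (f : P -> Q).
Hypothesis f_eq : forall x y, pm_eq x y -> pm_eq (f x) (f y).
Hypothesis f_add : forall x y, pm_eq (f (pm_add x y)) (pm_add (f x) (f y)).
Hypothesis f_scale : forall a x, pm_eq (f (pm_scale a x)) (pm_scale a (f x)).

Definition mq_map_fun (x : mquot P) : mquot Q := cls (f (rep x)).

Lemma mq_map_funE x : mq_map_fun (cls x) = cls (f x).
Proof. by apply/clsP/f_eq/rep_cls. Qed.

Fact mq_map_linear : linear mq_map_fun.
Proof.
move=> a x y; rewrite -[x]repK -[y]repK -clsZ -clsD !mq_map_funE -clsZ -clsD.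
apply/clsP; apply: pm_trans (f_add _ _) _.
by apply: pm_addE; [exact: f_scale|exact: pm_refl].
Qed.

Definition mq_map : {linear mquot P -> mquot Q} := mklinear mq_map_linear.

End QuotientMap.

Section Localization.
Variables (R : comPzRingType) (p : Spec R).

Definition denom : Type := {s : R | ~ p s}.
Definition frac : Type := (R * denom)%type.
Definition dval (s : denom) : R := sval s.

Fact denom_mul (s t : denom) : ~ p (dval s * dval t).
Proof. by case: s t => [s ns] [t nt] /= /primeM []. Qed.

Definition denom_prod (s t : denom) : denom := exist (fun s => ~ p s) _ (@denom_mul s t).
Definition denom1 : denom := exist (fun s => ~ p s) 1 (@prime_proper _ p).

Definition frac_eq (x y : frac) : Prop :=
  exists u : denom,
    dval u * (x.1 * dval y.2) = dval u * (y.1 * dval x.2).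

Lemma frac_eq1 (x y : frac) : x.1 * dval y.2 = y.1 * dval x.2 -> frac_eq x y.
Proof. by move=> e; exists denom1; rewrite e. Qed.

Definition loc_premodule : premodule R.
Proof.
refine (@PreModule R frac frac_eq (0, denom1) (fun x => (- x.1, x.2))
  (fun x y => (x.1 * dval y.2 + y.1 * dval x.2, denom_prod x.2 y.2))
  (fun r x => (r * x.1, x.2)) _ _ _ _ _ _ _ _ _ _ _ _ _ _).
- by move=> x; exact: frac_eq1.
- by move=> x y [u e]; exists u.
- move=> [a s] [b t] [c w] [u /= e] [v /= e'].
  exists (denom_prod (denom_prod u v) t) => /=; rewrite /dval /= -/(dval _) -/(dval _).
  transitivity (dval v * dval w * (dval u * (a * dval t))).
    by rewrite /dval /=; ring.
  rewrite e; transitivity (dval u * dval s * (dval v * (b * dval w))).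
    by rewrite /dval /=; ring.
  by rewrite e' /dval /=; ring.
- by move=> x y [u e]; exists u; rewrite /= !mulNr !mulrN e.
- move=> [a s] [a' s'] [b t] [b' t'] [u /= e] [v /= e'].
  exists (denom_prod u v) => /=; rewrite /dval /=.
  transitivity (dval v * dval t * dval t' * (dval u * (a * dval s')) +
    dval u * dval s * dval s' * (dval v * (b * dval t'))).
    by rewrite /dval /=; ring.
  by rewrite e e' /dval /=; ring.
- move=> r [a s] [b t] [u /= e]; exists u => /=.
  transitivity (r * (dval u * (a * dval t))); first by ring.
  by rewrite e; ring.
- by move=> x y z; apply: frac_eq1; rewrite /denom_prod /denom1 /dval /=; ring.
- by move=> x y; apply: frac_eq1; rewrite /denom_prod /denom1 /dval /=; ring.
- by move=> x; apply: frac_eq1; rewrite /denom_prod /denom1 /dval /=; ring.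
- by move=> x; apply: frac_eq1; rewrite /denom_prod /denom1 /dval /=; ring.
- by move=> r r' x; apply: frac_eq1; rewrite /denom_prod /denom1 /dval /=; ring.
- by move=> x; apply: frac_eq1; rewrite /denom_prod /denom1 /dval /=; ring.
- by move=> r x y; apply: frac_eq1; rewrite /denom_prod /denom1 /dval /=; ring.
- by move=> x r r'; apply: frac_eq1; rewrite /denom_prod /denom1 /dval /=; ring.
Defined.

(* R localized at p, as an R-module: this is enough to test acyclicity. *)
Definition localization : lmodType R := mquot loc_premodule.

End Localization.

(* For a ring morphism [phi : R -> A], R-modules [U i] and A-modules [V i],
   [tensor phi U V D] is the A-module given by the direct sum over the indices
   i such that [D i] of the tensor products of [U i] and [V i] over R (A acts on
   the right factors).  Its elements are formal sums of terms u (x) v; two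
   formal sums are equal when every family of R-balanced biadditive maps to an
   abelian group takes the same value on them. *)
Section Tensor.
Variables (R A : comPzRingType) (phi : {rmorphism R -> A}).
Variables (I : Type) (U : I -> lmodType R) (V : I -> lmodType A) (D : pred I).

Record balanced (P : zmodType) := Balanced {
  bal :> forall i, U i -> V i -> P;
  balDl : forall i u u' v, bal (i := i) (u + u') v = bal u v + bal u' v;
  balDr : forall i u v v', bal (i := i) u (v + v') = bal u v + bal u v';
  balZ : forall i r u v, bal (i := i) (r *: u) v = bal u (phi r *: v)
}.

Definition tensor_term : Type := {i : I & (U i * V i)%type}.
Definition pure i (u : U i) (v : V i) : tensor_term := Tagged _ (u, v).

Definition tensor_eval (P : zmodType) (g : balanced P) (s : seq tensor_term)
  : P := \sum_(t <- s | D (tag t)) g (tag t) (tagged t).1 (tagged t).2.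

Definition tensor_eq (s t : seq tensor_term) : Prop :=
  forall (P : zmodType) (g : balanced P), tensor_eval g s = tensor_eval g t.

Definition term_opp (t : tensor_term) : tensor_term :=
  pure (- (tagged t).1) (tagged t).2.
Definition term_scale (a : A) (t : tensor_term) : tensor_term :=
  pure (tagged t).1 (a *: (tagged t).2).

Section Eval.
Variables (P : zmodType) (g : balanced P).

Lemma bal0l i v : g i 0 v = 0.
Proof. by apply/(@addrI _ (g i 0 v)); rewrite -balDl !addr0. Qed.

Lemma bal0r i u : g i u 0 = 0.
Proof. by apply/(@addrI _ (g i u 0)); rewrite -balDr !addr0. Qed.

Lemma tensor_eval_cat s t :
  tensor_eval g (s ++ t) = tensor_eval g s + tensor_eval g t.
Proof. exact: big_cat. Qed.

Lemma tensor_eval_opp s :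
  tensor_eval g [seq term_opp t | t <- s] = - tensor_eval g s.
Proof.
rewrite /tensor_eval big_map -sumrN; apply: eq_bigr => -[i [u v]] _ /=.
apply/eqP; rewrite -subr_eq0 opprK -balDl addNr.
by rewrite bal0l.
Qed.

Fact scale_balanced_axioms (a : A) (h := fun i u v => g i u (a *: v)) :
  [/\ forall i u u' v, h i (u + u') v = h i u v + h i u' v,
      forall i u v v', h i u (v + v') = h i u v + h i u v' &
      forall i r u v, h i (r *: u) v = h i u (phi r *: v)].
Proof.
split=> *; rewrite /h; first by rewrite balDl.
- by rewrite scalerDr balDr.
- by rewrite balZ !scalerA mulrC.
Qed.

Definition scale_balanced (a : A) : balanced P :=
  let: And3 h1 h2 h3 := scale_balanced_axioms a in Balanced h1 h2 h3.

Lemma tensor_eval_scale a s :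
  tensor_eval g [seq term_scale a t | t <- s] =
  tensor_eval (scale_balanced a) s.
Proof.
rewrite /tensor_eval big_map; apply: eq_bigr => -[i [u v]] _ /=.
by rewrite /scale_balanced; case: scale_balanced_axioms.
Qed.

End Eval.

Definition tensor_premodule : premodule A.
Proof.
refine (@PreModule A (seq tensor_term) tensor_eq [::]
  (map term_opp) cat (fun a => map (term_scale a)) _ _ _ _ _ _ _ _ _ _ _ _ _ _).
- by move=> s P g.
- by move=> s t e P g; rewrite e.
- by move=> s t w e e' P g; rewrite e e'.
- by move=> s t e P g; rewrite !tensor_eval_opp e.
- by move=> s s' t t' e e' P g; rewrite !tensor_eval_cat e e'.
- by move=> a s t e P g; rewrite !tensor_eval_scale e.
- by move=> s t w P g; rewrite catA.
- by move=> s t P g; rewrite !tensor_eval_cat addrC.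
- by move=> s P g.
- move=> s P g; rewrite tensor_eval_cat tensor_eval_opp addNr.
  by rewrite /tensor_eval big_nil.
- move=> a b s P g; rewrite -map_comp; congr tensor_eval.
  by apply: eq_map => -[i [u v]]; rewrite /term_scale /= scalerA.
- move=> s P g; congr tensor_eval; rewrite -[RHS]map_id.
  by apply: eq_map => -[i [u v]]; rewrite /term_scale /= scale1r.
- by move=> a s t P g; rewrite map_cat.
- move=> s a b P g; rewrite tensor_eval_cat /tensor_eval !big_map -big_split.
  by apply: eq_bigr => -[i [u v]] _; rewrite /= scalerDl balDr.
Defined.

Definition tensor : lmodType A := mquot tensor_premodule.

End Tensor.

Record complex (R : comPzRingType) := Complex {
  cobj :> int -> lmodType R;
  cdiff : forall i, {linear cobj i -> cobj (i - 1)};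
  cdiffK : forall i x, cdiff (i - 1) (cdiff i x) = 0
}.

Section Complexes.
Variable R : comPzRingType.
Implicit Types X Y Z : complex R.

Record chain_map X Y := ChainMap {
  cmap :> forall i, {linear X i -> Y i};
  cmap_diff : forall i x, cdiff Y i (cmap i x) = cmap (i - 1) (cdiff X i x)
}.

Definition chain_id X : chain_map X X :=
  @ChainMap X X (fun i => idfun) (fun i x => erefl).

Fact chain_comp_diff X Y Z (g : chain_map Y Z) (f : chain_map X Y) i x :
  cdiff Z i ((g i \o f i) x) = (g (i - 1) \o f (i - 1)) (cdiff X i x).
Proof. by rewrite /= !cmap_diff. Qed.

Definition chain_comp X Y Z (g : chain_map Y Z) (f : chain_map X Y) :
  chain_map X Z := @ChainMap X Z (fun i => g i \o f i) (chain_comp_diff g f).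

(* The homotopy identity f - g = d h + h d is stated in degree i - 1, so that
   both sides have the same type. *)
Definition homotopic X Y (f g : chain_map X Y) : Prop :=
  exists h : forall i, {linear X (i - 1) -> Y i},
    forall i x, f (i - 1) x - g (i - 1) x =
                cdiff Y i (h i x) + h (i - 1) (cdiff X (i - 1) x).

Definition homotopy_equiv X Y : Prop :=
  exists (f : chain_map X Y) (g : chain_map Y X),
    homotopic (chain_comp g f) (chain_id X) /\
    homotopic (chain_comp f g) (chain_id Y).

Fact shift_diffK X i (x : X (i - 1)) :
  (\- cdiff X (i - 1 - 1)) ((\- cdiff X (i - 1)) x) = 0.
Proof. by rewrite /= linearN cdiffK !oppr0. Qed.

Definition shift X : complex R :=
  @Complex R (fun i => X (i - 1)) (fun i => \- cdiff X (i - 1))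
    (@shift_diffK X).

Section Cone.
Variables (X Y : complex R) (f : chain_map X Y).

Definition cone_obj (i : int) : lmodType R := (X (i - 1) * Y i)%type.

Definition cone_fun i (z : cone_obj i) : cone_obj (i - 1) :=
  (- cdiff X (i - 1) z.1, f (i - 1) z.1 + cdiff Y i z.2).

Fact cone_linear i : linear (@cone_fun i).
Proof.
move=> a [x y] [x' y']; congr (_, _) => /=.
  by rewrite linearP opprD scalerN.
by rewrite !linearP addrACA scalerDr.
Qed.

Fact cone_diffK i z : mklinear (@cone_linear (i - 1))
  (mklinear (@cone_linear i) z) = 0.
Proof.
congr (_, _) => /=; first by rewrite linearN cdiffK !oppr0.
by rewrite linearN linearD cmap_diff cdiffK addr0 addNr.
Qed.

Definition cone : complex R :=
  @Complex R cone_obj (fun i => mklinear (@cone_linear i)) cone_diffK.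

End Cone.

Section DirectSum.
Variables X Y : complex R.

Definition dsum_obj (i : int) : lmodType R := (X i * Y i)%type.

Definition dsum_fun i (z : dsum_obj i) : dsum_obj (i - 1) :=
  (cdiff X i z.1, cdiff Y i z.2).

Fact dsum_linear i : linear (@dsum_fun i).
Proof. by move=> a [x y] [x' y']; congr (_, _); rewrite /= linearP. Qed.

Fact dsum_diffK i z : mklinear (@dsum_linear (i - 1))
  (mklinear (@dsum_linear i) z) = 0.
Proof. by congr (_, _); rewrite /= cdiffK. Qed.

Definition dsum : complex R :=
  @Complex R dsum_obj (fun i => mklinear (@dsum_linear i)) dsum_diffK.

End DirectSum.

Definition in_degree0 (M : lmodType R) : complex R :=
  @Complex R (fun i => if i == 0 then M else 'rV[R]_0)
    (fun i => \0) (fun i x => erefl).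

Definition acyclic X : Prop :=
  forall i (x : X (i - 1)), cdiff X (i - 1) x = 0 ->
    exists y : X i, cdiff X i y = x.

End Complexes.

Lemma sign_pred (R : pzRingType) (i : int) :
  (-1) ^+ `|(i - 1)%R|%N = - (-1) ^+ `|i|%N :> R.
Proof.
case: i => [[|k]|k].
- by rewrite expr0 expr1.
- have -> : Posz k.+1 - 1 = k by rewrite -addn1 PoszD addrK.
  by rewrite !absz_nat exprS mulN1r opprK.
- have -> : Negz k - 1 = Negz k.+1 by rewrite !NegzE -opprD -PoszD addn1.
  by rewrite exprS mulN1r.
Qed.

(* The total tensor product of a complex of R-modules and a complex of A-modules
   over R: in degree n, the direct sum over i + j = n of the modules
   X i (x) Y j, with d (x (x) y) = d x (x) y + (-1)^i x (x) d y. *)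
Section TensorComplex.
Variables (R A : comPzRingType) (phi : {rmorphism R -> A}).
Variables (X : complex R) (Y : complex A).

Let U (ij : int * int) : lmodType R := X ij.1.
Let V (ij : int * int) : lmodType A := Y ij.2.
Let D (n : int) : pred (int * int) := fun ij => ij.1 + ij.2 == n.
Let pr (i j : int) (x : X i) (y : Y j) : tensor_term U V :=
  @pure R A _ U V (i, j) x y.

Definition tensor_pre (n : int) : premodule A := tensor_premodule phi U V (D n).

Definition term_diff (t : tensor_term U V) : seq (tensor_term U V) :=
  let: existT (i, j) (x, y) := t in
  [:: pr (cdiff X i x) y; pr x ((-1) ^+ `|i|%N *: cdiff Y j y)].

Definition tdiff n (s : tensor_pre n) : tensor_pre (n - 1) := flatten (map term_diff s).

Definition dbal (P : zmodType) (g : balanced phi U V P) (ij : int * int) :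
    U ij -> V ij -> P := fun x y =>
  g (ij.1 - 1, ij.2) (cdiff X ij.1 x) y +
  g (ij.1, ij.2 - 1) x ((-1) ^+ `|ij.1|%N *: cdiff Y ij.2 y).

Fact diff_balanced_axioms (P : zmodType) (g : balanced phi U V P)
    (h := @dbal P g) :
  [/\ forall i u u' v, h i (u + u') v = h i u v + h i u' v,
      forall i u v v', h i u (v + v') = h i u v + h i u v' &
      forall i r u v, h i (r *: u) v = h i u (phi r *: v)].
Proof.
rewrite /h /dbal; split=> [[i j] u u' v|[i j] u v v'|[i j] r u v] /=.
- by rewrite linearD !balDl addrACA.
- by rewrite linearD scalerDr !balDr addrACA.
- by rewrite !linearZ /= !balZ !scalerA mulrC.
Qed.

Definition diff_balanced (P : zmodType) (g : balanced phi U V P) :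
    balanced phi U V P :=
  let: And3 h1 h2 h3 := diff_balanced_axioms g in Balanced h1 h2 h3.

Lemma diff_balancedE (P : zmodType) (g : balanced phi U V P) ij u v :
  diff_balanced g ij u v = dbal g u v.
Proof. by rewrite /diff_balanced; case: diff_balanced_axioms. Qed.

Lemma tensor_eval_diff n (P : zmodType) (g : balanced phi U V P) s :
  tensor_eval (D (n - 1)) g (flatten (map term_diff s)) =
  tensor_eval (D n) (diff_balanced g) s.
Proof.
elim: s => [|[[i j] [x y]] s IHs]; first by rewrite /tensor_eval !big_nil.
rewrite /tensor_eval /= !big_cons -!/(tensor_eval _ _ _) IHs diff_balancedE /=.
have -> : D (n - 1) (i - 1, j) = D n (i, j).
  by rewrite /D /= addrAC (inj_eq (addIr _)).
have -> : D (n - 1) (i, j - 1) = D n (i, j).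
  by rewrite /D /= addrA (inj_eq (addIr _)).
by case: (D n (i, j)); rewrite // addrA.
Qed.

Fact tdiff_eq n (s t : tensor_pre n) :
  pm_eq s t -> pm_eq (tdiff s) (tdiff t).
Proof. by move=> e P g; rewrite !tensor_eval_diff e. Qed.

Fact tdiff_add n (s t : tensor_pre n) :
  pm_eq (tdiff (pm_add s t)) (pm_add (tdiff s) (tdiff t)).
Proof. by move=> P g; rewrite /tdiff /= map_cat flatten_cat. Qed.

Fact tdiff_scale n a (s : tensor_pre n) :
  pm_eq (tdiff (pm_scale a s)) (pm_scale a (tdiff s)).
Proof.
move=> P g; congr tensor_eval; rewrite /tdiff /= map_flatten -!map_comp.
congr flatten; apply: eq_map => -[[i j] [x y]] /=.
by rewrite /term_scale /= linearZ /= !scalerA mulrC.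
Qed.

Fact tensor_diffK n (q : tensor phi U V (D n)) :
  mq_map (@tdiff_eq (n - 1)) (@tdiff_add (n - 1)) (@tdiff_scale (n - 1))
    (mq_map (@tdiff_eq n) (@tdiff_add n) (@tdiff_scale n) q) = 0.
Proof.
rewrite -[q]repK /= !(mq_map_funE (@tdiff_eq _)).
rewrite -[RHS]/(cls (pm_zero (tensor_pre (n - 1 - 1)))); apply/clsP => P g.
rewrite /tdiff !tensor_eval_diff [RHS]big_nil.
apply: big1 => -[[i j] [x y]] _; rewrite diff_balancedE /dbal !diff_balancedE.
rewrite /dbal /= linearZ /= !cdiffK scaler0 bal0l scaler0 bal0r.
by rewrite addr0 add0r -balDr sign_pred scaleNr addNr bal0r.
Qed.

Definition tensor_complex : complex A :=
  @Complex A (fun n => tensor phi U V (D n))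
    (fun n => mq_map (@tdiff_eq n) (@tdiff_add n) (@tdiff_scale n))
    tensor_diffK.

End TensorComplex.

Section Homology.
Variables (R : comPzRingType) (X : complex R) (t : int).

Definition cast_obj (i j : int) (e : i = j) (x : X i) : X j :=
  ecast k (X k) e x.

Definition incoming (x : X (t + 1)) : X t :=
  cast_obj (addrK 1 t) (cdiff X (t + 1) x).

Definition cycle : Type := {x : X t | cdiff X t x = 0}.

Definition homologous (x y : cycle) : Prop :=
  exists z, sval x - sval y = incoming z.

Fact cast_obj_linear i j (e : i = j) : linear (@cast_obj i j e).
Proof. by case: j / e. Qed.

Fact incoming_linear : linear incoming.
Proof. by move=> a x y; rewrite /incoming linearP cast_obj_linear. Qed.

Fact cycle0 : cdiff X t 0 = 0. Proof. exact: linear0. Qed.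
Fact cycleN (x : cycle) : cdiff X t (- sval x) = 0.
Proof. by rewrite linearN (svalP x) oppr0. Qed.
Fact cycleD (x y : cycle) : cdiff X t (sval x + sval y) = 0.
Proof. by rewrite linearD (svalP x) (svalP y) addr0. Qed.
Fact cycleZ a (x : cycle) : cdiff X t (a *: sval x) = 0.
Proof. by rewrite linearZ /= (svalP x) scaler0. Qed.

Fact homologous_eq (x y : cycle) : sval x = sval y -> homologous x y.
Proof.
move=> e; exists 0; rewrite e subrr.
by rewrite -[RHS]/(mklinear incoming_linear 0) linear0.
Qed.

Fact homologous_linear a (x y x' y' : cycle) (u v : cycle) :
  homologous x y -> homologous x' y' ->
  sval u = a *: sval x + sval x' -> sval v = a *: sval y + sval y' ->
  homologous u v.
Proof.
move=> [z e] [z' e'] eu ev; exists (a *: z + z').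
by rewrite eu ev incoming_linear -e -e' scalerBr opprD addrACA.
Qed.

Definition Cycle x (e : cdiff X t x = 0) : cycle :=
  exist (fun x => cdiff X t x = 0) x e.

Definition homology_premodule : premodule R.
Proof.
refine (@PreModule R cycle homologous (Cycle cycle0)
  (fun x => Cycle (cycleN x)) (fun x y => Cycle (cycleD x y))
  (fun a x => Cycle (cycleZ a x)) _ _ _ _ _ _ _ _ _ _ _ _ _ _).
- by move=> x; exact: homologous_eq.
- move=> x y [z e]; exists (-1 *: z + 0).
  rewrite incoming_linear -e scaleN1r opprB.
  by rewrite -[incoming 0]/(mklinear incoming_linear 0) linear0 addr0.
- move=> x y w [z e] [z' e']; exists (1 *: z + z').
  by rewrite incoming_linear scale1r -e -e' addrA subrK.
- move=> x y h; apply: (homologous_linear (a := -1) h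
    (homologous_eq (erefl (sval (Cycle cycle0))))).
    by rewrite /= scaleN1r addr0.
  by rewrite /= scaleN1r addr0.
- move=> x x' y y' h h'.
  by apply: (homologous_linear (a := 1) h h'); rewrite /= scale1r.
- move=> a x y h; apply: (homologous_linear (a := a) h
    (homologous_eq (erefl (sval (Cycle cycle0))))).
    by rewrite /= addr0.
  by rewrite /= addr0.
- by move=> x y z; apply: homologous_eq; rewrite /= addrA.
- by move=> x y; apply: homologous_eq; rewrite /= addrC.
- by move=> x; apply: homologous_eq; rewrite /= add0r.
- by move=> x; apply: homologous_eq; rewrite /= addNr.
- by move=> a b x; apply: homologous_eq; rewrite /= scalerA.
- by move=> x; apply: homologous_eq; rewrite /= scale1r.
- by move=> a x y; apply: homologous_eq; rewrite /= scalerDr.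
- by move=> x a b; apply: homologous_eq; rewrite /= scalerDl.
Defined.

Definition homology : lmodType R := mquot homology_premodule.

End Homology.

Definition has_basis (A : pzRingType) (V : lmodType A) (d : nat) : Prop :=
  exists b : 'I_d -> V,
    forall v, exists! c : {ffun 'I_d -> A}, v = \sum_k c k *: b k.

(* 0 if V has no finite basis. *)
Definition dimension (A : pzRingType) (V : lmodType A) : nat :=
  xget 0%N [set d | has_basis V d].

Definition euler_char (K : comPzRingType) (X : complex K) : int :=
  \sum_(t \in [set: int]) (-1) ^+ `|t|%N * (dimension (homology X t))%:Z.

Definition finitely_generated (R : pzRingType) (M : lmodType R) : Prop :=
  exists (d : nat) (g : 'I_d -> M),
    forall x, exists c : 'I_d -> R, x = \sum_k c k *: g k.

Definition projective (R : pzRingType) (M : lmodType R) : Prop :=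
  forall (P Q : lmodType R) (g : {linear P -> Q}) (f : {linear M -> Q}),
    (forall y, exists x, g x = y) ->
    exists h : {linear M -> P}, forall x, g (h x) = f x.

Section Subcategories.
Variable R : comPzRingType.
Implicit Types (X Y Z : complex R) (C T : complex R -> Prop).

(* The objects of D^b(proj R). *)
Definition perfect X : Prop :=
  (exists b : nat, forall i, (b < `|i|)%N -> forall x : X i, x = 0) /\
  (forall i, finitely_generated (X i) /\ projective (X i)).

Definition tens X Y : complex R :=
  tensor_complex (idfun : {rmorphism R -> R}) X Y.

Definition localize X (p : Spec R) : complex R :=
  tens X (in_degree0 (localization p)).

(* A complex is zero in the derived category iff it is acyclic. *)
Definition Supp X : set (Spec R) := [set p | ~ acyclic (localize X p)].

Definition supported (S : set (Spec R)) X : Prop :=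
  perfect X /\ Supp X `<=` S.

(* Full subcategories of D^b(proj R) closed under isomorphism are given by
   predicates on perfect complexes closed under homotopy equivalence.  The
   equivalence [tr_shift] gives closure under both shift functors [1], [-1]. *)
Record triangulated C : Prop := Triangulated {
  tr_perfect : forall X, C X -> perfect X;
  tr_nonempty : exists X, C X;
  tr_iso : forall X Y, C X -> perfect Y -> homotopy_equiv X Y -> C Y;
  tr_shift : forall X, C X <-> C (shift X);
  tr_cone : forall X Y (f : chain_map X Y), C X -> C Y -> C (cone f)
}.

Definition triangulated_ideal C : Prop :=
  triangulated C /\ forall X Y, C X -> perfect Y -> C (tens X Y).

Definition dense C T : Prop :=
  (forall X, C X -> T X) /\
  forall X, T X -> exists Y Z, [/\ T Y, C Z & homotopy_equiv Z (dsum X Y)].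

End Subcategories.

Definition subgroup (V : zmodType) (H : set V) : Prop :=
  H 0 /\ forall x y, H x -> H y -> H (x - y).

Section Artin.
Variables (R : comPzRingType) (n : nat) (R_ : 'I_n -> comNzRingType).
Variables (proj : forall i, {rmorphism R -> R_ i}) (m : forall i, Spec (R_ i)).

Definition is_product : Prop :=
  forall y : (forall i, R_ i), exists! r, forall i, proj i r = y i.

Definition point (i : 'I_n) : Spec R := spec_preimage (proj i) (m i).

Definition residue_map (i : 'I_n) : {rmorphism R -> residue_ring (m i)} :=
  residue_proj (m i) \o proj i.

Definition Lambda (i : 'I_n) (X : complex R) : int :=
  euler_char (tensor_complex (residue_map i) X
                (in_degree0 (residue_ring (m i))^o)).

(* The direct sum of copies of Z indexed by the p_i in S. *)
Definition Zsum (S : set (Spec R)) : zmodType :=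
  {ffun {i : 'I_n | point i \in S} -> int}.

Definition LambdaS (S : set (Spec R)) (X : complex R) : Zsum S :=
  [ffun i => Lambda (sval i) X].

Definition TSH (S : set (Spec R)) (H : set (Zsum S)) (X : complex R) : Prop :=
  supported S X /\ H (LambdaS S X).

End Artin.

(* Main.v *)
From HB Require Import structures.
Require Import Defs.
From mathcomp Require Import all_boot all_order all_algebra ring zify.
From mathcomp Require Import boolp classical_sets fsbigop.

(* Since R is a product of Artinian local rings R_i, the perfect complexes are
   generated by the localizations N_i = R_i, placed in degree 0, under shifts,
   cones and homotopy equivalences.  For a triangulated subcategory C let S be
   the set of points at which some object of C is not acyclic.

   Thick closure of C (local nilpotence, after Hopkins and Neeman).  If X in C
   is not acyclic at i, then, by Nakayama's lemma, a shift of X has a cycle u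
   in degree 0 and a functional eps with eps u = e_i that maps boundaries into the
   maximal ideal J.  Replacing X by iterated homotopy fibres of
   X + Q -> X (x) Q (Mayer-Vietoris) improves J to any power J^k; once J^k
   vanishes at i, (u, eps) splits off N_i.  So the thick closure of C is the
   category of the complexes supported in S.

   Passing back to C (Thomason).  Modulo the dense subcategory C, perfect
   complexes form a group under direct sum; a complex X supported in S is then
   the combination of the N_i whose coefficients are the Lambda_i X, since
   Lambda is additive on short exact sequences (Euler-Poincare), so that C is
   determined by the subgroup of the values of Lambda on C.

   If S has two points i and j, then v_i = v_j defines a dense subcategory that
   contains N_i + N_j but not (N_i + N_j) (x) N_i. *)

Set Implicit Arguments.
Unset Strict Implicit.
Unset Printing Implicit Defensive.

Import Order.TTheory GRing.Theory Num.Theory.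
Local Open Scope ring_scope.

(** * Finitely generated projective modules *)

(** The homotopy category is never formed. Degreewise split short exact sequences play the role of
    triangles, and a subcategory enters only through two-out-of-three for them and through its
    contractible complexes. Classes of this kind pull back along tensor products, so a statement
    about all perfect complexes reduces to the cells N_i. Localization is replaced by multiplication
    with the idempotents e_i: acyclic at p_i means that e_i kills the homology. The obstacle in the
    local step is that a class that survives modulo J need not split off, since the functional that
    detects it sends boundaries into J and not to 0. Raising J to a power that vanishes on the
    factor R_i removes this obstruction, and it is there that R_i being Artinian is decisive.
    Integers suffice as invariants because R_i is local: bounded complexes are built from cells by
    pivoting in a dual basis, so the group in Thomason's argument is generated by the classes of the
    N_i with p_i in S. *)

Section FinProj.
Variable R : comPzRingType.

Definition linC (U V W : lmodType R) (g : {linear V -> W}) (f : {linear U -> V}) :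
  {linear U -> W} := g \o f.

Definition dual_basis (M : lmodType R) (s : seq ({linear M -> R^o} * M)) :=
  forall x, x = \sum_(q <- s) q.1 x *: q.2.

(** The dual basis form of being finitely generated and projective: retracts, products and tensor
    products inherit such a family by explicit formulas. *)
Definition fproj (M : lmodType R) : Prop := exists s, @dual_basis M s.

Lemma fproj_spec (M : lmodType R) :
  finitely_generated M -> projective M -> fproj M.
Proof.
move=> [d [g gP]] prM.
have lf : linear (fun c : 'rV[R]_d => \sum_k c 0 k *: g k).
  move=> a c c'; rewrite scaler_sumr -big_split /=; apply: eq_bigr => k _.
  by rewrite !mxE scalerDl scalerA.
have [h hP] := prM _ _ (mklinear lf) idfun (fun y =>
   let: ex_intro c e := gP y in
   ex_intro _ (\row_k c k) (etrans (eq_bigr _ (fun k _ => congr1 (fun t => t *: g k) (mxE _ _ _ _))) (esym e))).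
have lc k : linear (fun x => h x 0 k : R^o).
  by move=> a x y; rewrite linearP !mxE.
exists [seq (mklinear (lc k), g k) | k <- index_enum 'I_d] => x.
by rewrite big_map -[LHS](hP x).
Qed.

Lemma fproj_fg (M : lmodType R) : fproj M -> finitely_generated M.
Proof.
move=> [s sP]; pose z := ((\0 : {linear M -> R^o}), 0 : M).
exists (size s), (fun k => (nth z s k).2) => x.
exists (fun k => (nth z s k).1 x).
by rewrite {1}[x]sP (big_nth z) big_mkord.
Qed.

Lemma fproj_projective (M : lmodType R) : fproj M -> projective M.
Proof.
move=> [s sP] P Q g f gsurj.
have [l lP] := choice gsurj.
have lh : linear (fun x : M => \sum_(q <- s) q.1 x *: l (f q.2)).
  move=> a x y; rewrite scaler_sumr -big_split /=; apply: eq_bigr => q _.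
  by rewrite linearP scalerDl scalerA.
exists (mklinear lh) => x /=.
rewrite linear_sum [in RHS](sP x) linear_sum; apply: eq_bigr => q _.
by rewrite !linearZ /= lP.
Qed.

Lemma fproj_retract (M N : lmodType R) (i : {linear M -> N})
  (p : {linear N -> M}) : (forall x, p (i x) = x) -> fproj N -> fproj M.
Proof.
move=> pi [s sP]; exists [seq (linC (q : {linear N -> R^o} * N).1 i, p q.2) | q <- s].
move=> x; rewrite big_map /= -{1}[x]pi {1}[i x]sP linear_sum.
by apply: eq_bigr => q _; rewrite linearZ.
Qed.

Lemma fproj_prod (M N : lmodType R) : fproj M -> fproj N -> fproj (M * N)%type.
Proof.
move=> [s sP] [t tP].
have l1 : linear (fst : M * N -> M) by [].
have l2 : linear (snd : M * N -> N) by [].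
exists ([seq (linC (q : {linear M -> R^o} * M).1 (mklinear l1), (q.2, 0)) | q <- s] ++
  [seq (linC (q : {linear N -> R^o} * N).1 (mklinear l2), (0, q.2)) | q <- t]).
move=> [x y]; rewrite big_cat !big_map /=.
have -> : (x, y) = (x, 0) + (0, y) by congr (_, _); rewrite /= ?addr0 ?add0r.
congr (_ + _).
- rewrite {1}[x]sP; elim: s {sP} => [|q s IHs]; first by rewrite !big_nil.
  by rewrite !big_cons -IHs; congr (_, _); rewrite /= scaler0 addr0.
- rewrite {1}[y]tP; elim: t {tP} => [|q t IHt]; first by rewrite !big_nil.
  by rewrite !big_cons -IHt; congr (_, _); rewrite /= scaler0 addr0.
Qed.

(** The lift is assembled from preimages of the values of [f] on the dual basis, so [g] need only
    cover the range of [f]. *)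
Lemma lift_range (M P Q : lmodType R) (f : {linear M -> Q}) (g : {linear P -> Q}) :
  fproj M -> (forall x, exists y, g y = f x) ->
  exists h : {linear M -> P}, forall x, g (h x) = f x.
Proof.
move=> [s sP] fg; have [l lP] := choice fg.
have lh : linear (fun x : M => \sum_(q <- s) q.1 x *: l q.2).
  move=> a x y; rewrite scaler_sumr -big_split /=; apply: eq_bigr => q _.
  by rewrite linearP scalerDl scalerA.
exists (mklinear lh) => x /=.
rewrite linear_sum [in RHS](sP x) linear_sum; apply: eq_bigr => q _.
by rewrite !linearZ /= lP.
Qed.

End FinProj.

(** * Short exact sequences and triangulated subcategories *)

Section AbelianIdentities.
Variable V : zmodType.
Implicit Types a b c d x y : V.

Lemma addNKC a x : - a + (x + a) = x.
Proof. by rewrite addrC addrK. Qed.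

Lemma subKN x a : x - a - x = - a.
Proof. by rewrite addrC addKr. Qed.

Lemma addDNB x a b : (x + a) + (b - a) = x + b.
Proof. by rewrite addrACA subrr addr0. Qed.

Lemma addN_eq a b c : b = a + c -> - a + b = c.
Proof. by move=> ->; exact: addKr. Qed.

Lemma subN_eq a b y : a + b = y -> b - y = - a.
Proof. by move=> <-; rewrite opprD addrCA subrr addr0. Qed.

Lemma cone_identity1 b c x y : c = b + y -> - y - x = b - (x + c).
Proof.
by move=> ->; rewrite [x + _]addrCA opprD addrA subrr add0r opprD addrC.
Qed.

Lemma cone_identity2 a b y c : c = a + y -> - a - b = - c + (y - b).
Proof. by move=> ->; rewrite [in RHS]opprD addrA addrNK. Qed.

Lemma addN_shift x a : - (x + a) + a = - x.
Proof. by rewrite opprD addrNK. Qed.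

Lemma subr_eq_addr x a b : a - x = b -> a = x + b.
Proof. by move=> <-; rewrite addrC subrK. Qed.

Lemma cone_identity3 a b y : a + b - (b - (y - a)) = y.
Proof. by rewrite opprD addrA opprK addrK addrC subrK. Qed.

Lemma cone_identity4 a b c d x y :
  a + b = x -> y = c + d -> a + c - x = y + (- b - d).
Proof.
by move=> <- ->; rewrite !opprD addrACA subrr add0r [RHS]addrACA subrr addr0.
Qed.

End AbelianIdentities.

Section Closure.
Variable R : comPzRingType.
Implicit Types (X Y Z A B D : complex R) (C : complex R -> Prop).

Definition bounded X : Prop :=
  exists b : nat, forall i : int, (b < `|i|)%N -> forall x : X i, x = 0.

Lemma perfectE X : perfect X <-> bounded X /\ forall i, fproj (X i).
Proof.
split=> -[bX pX]; split=> // i; first by case: (pX i); exact: fproj_spec.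
by split; [exact: fproj_fg|exact: fproj_projective].
Qed.

Definition contractible Z : Prop :=
  exists h : forall i, {linear Z (i - 1) -> Z i},
    forall i x, cdiff Z i (h i x) + h (i - 1) (cdiff Z (i - 1) x) = x.

Lemma contractible_acyclic Z : contractible Z -> acyclic Z.
Proof.
by move=> [h hP] i x dx; exists (h i x); rewrite -[RHS]hP dx linear0 addr0.
Qed.

(** [r] and [s] need not commute with the differentials. These sequences give all the triangles that
    are used, and tensor products preserve them; [p (i x) = 0] follows from the three identities. *)
Definition ses A B D : Prop :=
  exists (i : chain_map A B) (p : chain_map B D)
    (r : forall n, {linear B n -> A n}) (s : forall n, {linear D n -> B n}),
  [/\ forall n x, r n (i n x) = x, forall n y, p n (s n y) = y &
      forall n z, i n (r n z) + s n (p n z) = z].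

Definition chain_zero X Y : chain_map X Y :=
  @ChainMap R X Y (fun i => \0) (fun i x => linear0 (cdiff Y i)).

Lemma contractible_equiv X Y : contractible X -> contractible Y ->
  homotopy_equiv X Y.
Proof.
move=> [h hP] [k kP]; exists (chain_zero X Y), (chain_zero Y X); split.
  exists (fun i => \- h i) => i x /=.
  by rewrite add0r linearN -opprD hP.
exists (fun i => \- k i) => i x /=.
by rewrite add0r linearN -opprD kP.
Qed.

Lemma cone_id_contractible X : contractible (cone (chain_id X)).
Proof.
have l i : linear (fun z : cone (chain_id X) (i - 1) =>
    (z.2, 0) : cone (chain_id X) i).
  by move=> a [x y] [x' y']; congr (_, _); rewrite /= ?scaler0 ?addr0.
exists (fun i => mklinear (l i)) => i [x y] /=; congr (_, _) => /=.
  exact: addNKC.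
by rewrite linear0 !addr0.
Qed.

Lemma ses_perfect_mid A B D : ses A B D -> perfect A -> perfect D -> perfect B.
Proof.
move=> [i [p [r [s [ri ps e]]]]] /perfectE [[a bA] pA] /perfectE [[d bD] pD].
apply/perfectE; split.
  exists (maxn a d) => n an z; rewrite -[z]e.
  rewrite (bA _ (leq_ltn_trans (leq_maxl _ _) an) (r n z)).
  by rewrite (bD _ (leq_ltn_trans (leq_maxr _ _) an) (p n z)) !linear0 addr0.
move=> n.
have l1 : linear (fun z : B n => (r n z, p n z) : A n * D n).
  by move=> c x y; rewrite !linearP.
have l2 : linear (fun z : A n * D n => i n z.1 + s n z.2).
  by move=> c x y; rewrite !linearP /= scalerDr addrACA.
exact: (fproj_retract (i := mklinear l1) (p := mklinear l2) (e n)
  (fproj_prod (pA n) (pD n))).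
Qed.

Lemma retract_perfect A B (i : forall n, {linear A n -> B n})
   (r : forall n, {linear B n -> A n}) :
  (forall n x, r n (i n x) = x) -> perfect B -> perfect A.
Proof.
move=> ri /perfectE [[b bB] pB]; apply/perfectE; split.
  by exists b => n bn x; rewrite -[x]ri (bB n bn (i n x)) linear0.
by move=> n; exact: fproj_retract (ri n) (pB n).
Qed.

Lemma ses_perfect_sub A B D : ses A B D -> perfect B -> perfect A.
Proof. by move=> [i [p [r [s [ri ps e]]]]]; exact: retract_perfect. Qed.

Lemma ses_perfect_quo A B D : ses A B D -> perfect B -> perfect D.
Proof. by move=> [i [p [r [s [ri ps e]]]]]; exact: retract_perfect. Qed.

Lemma perfect_shift X : perfect X -> perfect (shift X).
Proof.
move=> /perfectE [[b bX] pX]; apply/perfectE; split => [|i]; last exact: pX.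
exists b.+1 => i bi x; apply: bX; lia.
Qed.

Lemma ses_cone X Y (f : chain_map X Y) : ses Y (cone f) (shift X).
Proof.
have l1 i : linear (fun y : Y i => (0, y) : cone f i).
  by move=> a x y; congr (_, _); rewrite /= scaler0 addr0.
have l2 i : linear (fun z : cone f i => z.1 : shift X i) by [].
have l3 i : linear (fun z : cone f i => z.2 : Y i) by [].
have l4 i : linear (fun x : shift X i => (x, 0) : cone f i).
  by move=> a x y; congr (_, _); rewrite /= scaler0 addr0.
have c1 i y : cdiff (cone f) i (mklinear (l1 i) y) =
    mklinear (l1 (i - 1)) (cdiff Y i y).
  by congr (_, _); rewrite /= linear0 ?oppr0 ?add0r.
have c2 i z : cdiff (shift X) i (mklinear (l2 i) z) =
    mklinear (l2 (i - 1)) (cdiff (cone f) i z) by [].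
exists (ChainMap c1), (ChainMap c2), (fun i => mklinear (l3 i)),
  (fun i => mklinear (l4 i)); split=> // i [x y] /=.
by congr (_, _); rewrite /= ?add0r ?addr0.
Qed.

Lemma perfect_cone X Y (f : chain_map X Y) :
  perfect X -> perfect Y -> perfect (cone f).
Proof.
by move=> pX pY; apply: ses_perfect_mid (ses_cone f) pY (perfect_shift pX).
Qed.

Lemma ses_dsum X Y : ses X (dsum X Y) Y.
Proof.
have l1 i : linear (fun x : X i => (x, 0) : dsum X Y i).
  by move=> a x y; congr (_, _); rewrite /= scaler0 addr0.
have l2 i : linear (fun z : dsum X Y i => z.1 : X i) by [].
have l3 i : linear (fun z : dsum X Y i => z.2 : Y i) by [].
have l4 i : linear (fun y : Y i => (0, y) : dsum X Y i).
  by move=> a x y; congr (_, _); rewrite /= scaler0 addr0.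
have c1 i y : cdiff (dsum X Y) i (mklinear (l1 i) y) =
    mklinear (l1 (i - 1)) (cdiff X i y) by congr (_, _); rewrite /= linear0.
have c2 i z : cdiff Y i (mklinear (l3 i) z) =
    mklinear (l3 (i - 1)) (cdiff (dsum X Y) i z) by [].
exists (ChainMap c1), (ChainMap c2), (fun i => mklinear (l2 i)),
  (fun i => mklinear (l4 i)); split=> // i [x y] /=.
by congr (_, _); rewrite /= ?add0r ?addr0.
Qed.

Lemma perfect_dsum X Y : perfect X -> perfect Y -> perfect (dsum X Y).
Proof. exact: ses_perfect_mid (ses_dsum X Y). Qed.

(** The cone of [i] maps to [D] by [p], and [shift A] maps to the cone of [p] by [i]; the homotopy
    inverses are [s] and [r], corrected by the connecting map [r d s]. *)
Lemma ses_cone_equiv A B D : ses A B D ->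
  (exists f : chain_map A B, homotopy_equiv (cone f) D) /\
  (exists f : chain_map B D, homotopy_equiv (cone f) (shift A)).
Proof.
move=> [i [p [r [s [ri ps e]]]]].
have pi n x : p n (i n x) = 0.
  have := congr1 (p n) (e n (i n x)).
  by rewrite linearD ri ps => /(canRL (addrK _)); rewrite subrr => <-.
have rs n x : r n (s n x) = 0.
  have := congr1 (r n) (e n (s n x)).
  by rewrite linearD ri ps => /(canRL (addrK _)); rewrite subrr => ->.
have dsE n y : cdiff B n (s n y) =
    i (n - 1) (r (n - 1) (cdiff B n (s n y))) + s (n - 1) (cdiff D n y).
  by rewrite -[LHS]e -cmap_diff ps.
have drE n z : r (n - 1) (cdiff B n z) =
    cdiff A n (r n z) + r (n - 1) (cdiff B n (s n (p n z))).
  by rewrite -{1}[z]e !linearD /= !cmap_diff ri.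
(* The connecting map anticommutes with the differentials, that is, it is a chain map from [D] to
   [shift A]. *)
have rdd n y : r (n - 1 - 1) (cdiff B (n - 1) (s (n - 1) (cdiff D n y))) =
    - cdiff A (n - 1) (r (n - 1) (cdiff B n (s n y))).
  have := drE (n - 1) (cdiff B n (s n y)).
  by rewrite cdiffK linear0 -[p _ _]cmap_diff ps => /esym/addr0_eq <-.
split.
- have l1 n : linear (fun z : cone i n => p n z.2 : D n).
    by move=> a [x y] [x' y']; rewrite /= linearP.
  have c1 n z : cdiff D n (mklinear (l1 n) z) =
      mklinear (l1 (n - 1)) (cdiff (cone i) n z).
    by rewrite /= cmap_diff linearD pi add0r.
  have l2 n : linear (fun y : D n =>
      (- r (n - 1) (cdiff B n (s n y)), s n y) : cone i n).
    by move=> a x y; congr (_, _); rewrite /= !linearP ?scalerN.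
  have c2 n y : cdiff (cone i) n (mklinear (l2 n) y) =
      mklinear (l2 (n - 1)) (cdiff D n y).
    congr (_, _) => /=; first by rewrite linearN opprK rdd opprK.
    by rewrite linearN; exact: addN_eq (dsE n y).
  exists i, (ChainMap c1), (ChainMap c2); split.
    have lh n : linear (fun z : cone i (n - 1) => (- r (n - 1) z.2, 0) : cone i n).
      move=> a [x y] [x' y']; congr (_, _); last by rewrite /= scaler0 addr0.
      by rewrite /= linearP opprD scalerN.
    exists (fun n => mklinear (lh n)) => n [x y]; congr (_, _) => /=.
      rewrite linearN opprK linearD ri; exact: cone_identity1 (drE _ y).
    by rewrite !linear0 !addr0 linearN; exact: subN_eq (e _ y).
  exists (fun n => \0) => n y /=.
  by rewrite ps subrr linear0 addr0.
- have l1 n : linear (fun z : cone p n =>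
      r (n - 1) z.1 + r (n - 1) (cdiff B n (s n z.2)) : shift A n).
    by move=> a [x y] [x' y']; rewrite /= !linearP /= scalerDr addrACA.
  have c1 n z : cdiff (shift A) n (mklinear (l1 n) z) =
      mklinear (l1 (n - 1)) (cdiff (cone p) n z).
    case: z => x y /=; rewrite !linearD /= rdd linearN.
    exact: cone_identity2 (drE _ x).
  have l2 n : linear (fun x : shift A n => (i (n - 1) x, 0) : cone p n).
    by move=> a x y; congr (_, _); rewrite /= ?linearP ?scaler0 ?addr0.
  have c2 n x : cdiff (cone p) n (mklinear (l2 n) x) =
      mklinear (l2 (n - 1)) (cdiff (shift A) n x).
    congr (_, _) => /=; first by rewrite linearN cmap_diff.
    by rewrite pi linear0 addr0.
  exists p, (ChainMap c1), (ChainMap c2); split.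
    have lh n : linear (fun z : cone p (n - 1) => (- s (n - 1) z.2, 0) : cone p n).
      move=> a [x y] [x' y']; congr (_, _); last by rewrite /= scaler0 addr0.
      by rewrite /= linearP opprD scalerN.
    exists (fun n => mklinear (lh n)) => n [x y]; congr (_, _) => /=.
      by rewrite linearN opprK !linearD /=; exact: cone_identity4 (e _ x) (dsE _ y).
    by rewrite linear0 !addr0 linearN ps sub0r.
  exists (fun n => \0) => n x /=.
  by rewrite !linear0 addr0 ri addr0 subrr.
Qed.

(** This form of being triangulated passes to preimages under tensor functors, which preserve [ses]
    and contractibility; cones and shifts of tensor products need not be computed. *)
Record closed23 C : Prop := Closed23 {
  c_perfect : forall X, C X -> perfect X;
  c_contr : forall X, perfect X -> contractible X -> C X;
  c_sub : forall A B D, ses A B D -> C B -> C D -> C A;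
  c_mid : forall A B D, ses A B D -> C A -> C D -> C B;
  c_quo : forall A B D, ses A B D -> C A -> C B -> C D
}.

Lemma triangulated_closed23 C : triangulated C -> closed23 C.
Proof.
move=> [pC [X0 CX0] isoC shC coneC].
have quoC A B D : ses A B D -> C A -> C B -> C D.
  move=> S CA CB; have [[f fD] _] := ses_cone_equiv S.
  by apply: isoC fD; [apply: coneC|exact: ses_perfect_quo S (pC _ CB)].
have subC A B D : ses A B D -> C B -> C D -> C A.
  move=> S CB CD; have [_ [f fD]] := ses_cone_equiv S; apply/shC.
  apply: isoC fD; first by apply: coneC.
  exact: perfect_shift (ses_perfect_sub S (pC _ CB)).
split=> //.
- move=> X pX cX; apply: (isoC _ _ (coneC _ _ (chain_id X0) CX0 CX0) pX).
  exact: contractible_equiv (cone_id_contractible X0) cX.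
(* [cone f] is equivalent to [D], and [B] is the kernel of [cone f -> shift A]. *)
- move=> A B D S CA CD; have [[f fD] _] := ses_cone_equiv S.
  have CK : C (cone f).
    have [g [h [gh hg]]] := fD; apply: (isoC _ _ CD); last by exists h, g.
    exact: perfect_cone (pC _ CA) (ses_perfect_mid S (pC _ CA) (pC _ CD)).
  exact: (subC _ _ _ (ses_cone f) CK ((shC A).1 CA)).
Qed.

End Closure.

(** * Quotient complexes and contractions *)

Section Transport.
Variables (A : pzRingType) (F : int -> lmodType A).

(** Extended by 0 to unequal degrees, transport is linear for all [i] and [j], carries no proof of
    equality, and doubles as the projection to a graded component. *)
Definition tr_fun i j (x : F i) : F j :=
  if i =P j is ReflectT e then ecast k (F k) e x else 0.

Lemma tr_linear i j : linear (@tr_fun i j).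
Proof.
rewrite /tr_fun => a x y; case: eqP => [e|_]; first by case: j / e.
by rewrite scaler0 addr0.
Qed.

Fact tr_exists : {f : forall i j, {linear F i -> F j} |
  (forall i x, f i i x = x) /\ (forall i j x, i <> j -> f i j x = 0)}.
Proof.
exists (fun i j => mklinear (@tr_linear i j)); rewrite /= /tr_fun; split.
  by move=> i x; case: eqP => // e; rewrite eq_axiomK.
by move=> i j x; case: eqP.
Qed.

(* The proof of [tr_exists] is opaque so that [tr] never unfolds. *)
Definition tr := sval tr_exists.

Lemma trii i x : tr i i x = x.
Proof. exact: (svalP tr_exists).1. Qed.

Lemma tr_neq i j x : i <> j -> tr i j x = 0.
Proof. exact: (svalP tr_exists).2. Qed.

Lemma tr_comp i j k x : i = j -> tr j k (tr i j x) = tr i k x.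
Proof. by move=> e; case: j / e; rewrite trii. Qed.

End Transport.

Section Submodule.
Variables (R : comPzRingType) (M : lmodType R).

Record submod := SubMod {
  sm :> M -> Prop;
  sm0 : sm 0;
  smP : forall a x y, sm x -> sm y -> sm (a *: x + y)
}.

Lemma smD (W : submod) x y : W x -> W y -> W (x + y).
Proof. by move=> Wx Wy; rewrite -[x]scale1r; exact: smP. Qed.
Lemma smZ (W : submod) a x : W x -> W (a *: x).
Proof. by move=> Wx; rewrite -[_ *: _]addr0; apply: smP => //; exact: sm0. Qed.
Lemma smN (W : submod) x : W x -> W (- x).
Proof. by rewrite -scaleN1r; exact: smZ. Qed.
Lemma smB (W : submod) x y : W x -> W y -> W (x - y).
Proof. by move=> Wx /smN; exact: smD. Qed.
Variable W : submod.

Definition quot_premodule : premodule R.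
Proof.
refine (@PreModule R M (fun x y => W (x - y)) 0 -%R +%R *:%R
  _ _ _ _ _ _ _ _ _ _ _ _ _ _).
- by move=> x; rewrite /= subrr; exact: sm0.
- by move=> x y Wxy; rewrite /= -opprB; exact: smN.
- by move=> x y z Wxy Wyz; rewrite /= -[x](subrK y) -addrA; exact: smD.
- by move=> x y Wxy; rewrite /= -opprD; exact: smN.
- by move=> x x' y y' Wx Wy; rewrite /= opprD addrACA; exact: smD.
- by move=> a x y Wxy; rewrite /= -scalerBr; exact: smZ.
- by move=> x y z; rewrite /= addrA subrr; exact: sm0.
- by move=> x y; rewrite /= [x + y]addrC subrr; exact: sm0.
- by move=> x; rewrite /= add0r subrr; exact: sm0.
- by move=> x; rewrite /= addNr subrr; exact: sm0.
- by move=> a b x; rewrite /= scalerA subrr; exact: sm0.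
- by move=> x; rewrite /= scale1r subrr; exact: sm0.
- by move=> a x y; rewrite /= scalerDr subrr; exact: sm0.
- by move=> x a b; rewrite /= scalerDl subrr; exact: sm0.
Defined.

Definition quot : lmodType R := mquot quot_premodule.

Fact qproj_linear : linear (fun x : M => cls (x : quot_premodule) : quot).
Proof. by move=> a x y; rewrite -clsZ -clsD. Qed.
Definition qproj : {linear M -> quot} := mklinear qproj_linear.

Lemma qprojP x y : qproj x = qproj y <-> W (x - y).
Proof. exact: clsP. Qed.

Lemma qproj_eq0 x : qproj x = 0 <-> W x.
Proof. by rewrite -[0](linear0 qproj) qprojP subr0. Qed.

Lemma qproj_surj q : exists x, qproj x = q.
Proof. by exists (rep q); exact: repK. Qed.

Variables (N : lmodType R) (f : {linear M -> N}).
Hypothesis Wf : forall x, W x -> f x = 0.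

Lemma qlift_fact x : f (rep (qproj x)) = f x.
Proof.
apply/eqP; rewrite -subr_eq0 -linearB; apply/eqP/Wf.
exact: (rep_cls (x : quot_premodule)).
Qed.

Fact qlift_linear : linear (fun q : quot => f (rep q)).
Proof.
move=> a x y; have [x' <-] := qproj_surj x; have [y' <-] := qproj_surj y.
by rewrite -linearP !qlift_fact linearP.
Qed.

Definition qlift : {linear quot -> N} := mklinear qlift_linear.

Lemma qliftE x : qlift (qproj x) = f x.
Proof. exact: qlift_fact. Qed.

End Submodule.

Section Coker.
Variables (R : comPzRingType) (A B : complex R) (f : chain_map A B).

Fact coker_sub_0 i : exists a : A i, 0 = f i a.
Proof. by exists 0; rewrite linear0. Qed.
Fact coker_sub_P i a x y : (exists u : A i, x = f i u) ->
  (exists u : A i, y = f i u) -> exists u : A i, a *: x + y = f i u.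
Proof. by move=> [u ->] [v ->]; exists (a *: u + v); rewrite linearP. Qed.

Definition coker_sub i : submod (B i) :=
  SubMod (@coker_sub_0 i) (@coker_sub_P i).

Fact coker_diff_wd i x : coker_sub i x ->
  linC (qproj (coker_sub (i - 1))) (cdiff B i) x = 0.
Proof.
by move=> [a ->]; apply/qproj_eq0; exists (cdiff A i a); exact: cmap_diff.
Qed.

Definition coker_diff i : {linear quot (coker_sub i) -> quot (coker_sub (i - 1))} :=
  qlift (@coker_diff_wd i).

Lemma coker_diffE i x : coker_diff i (qproj _ x) = qproj _ (cdiff B i x).
Proof. exact: qliftE. Qed.

Fact coker_diffK i q : coker_diff (i - 1) (coker_diff i q) = 0.
Proof.
have [x <-] := qproj_surj q.
by rewrite !coker_diffE cdiffK linear0.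
Qed.

Definition coker : complex R := Complex coker_diffK.

(** The section of the projection is induced by [z - f n (r n z)], which vanishes on the image of
    [f]. *)
Lemma ses_coker (r : forall n, {linear B n -> A n}) :
  (forall n x, r n (f n x) = x) -> ses A B coker.
Proof.
move=> rf.
have c n x : cdiff coker n (qproj (coker_sub n) x) = qproj _ (cdiff B n x).
  exact: coker_diffE.
have l n : linear (fun z : B n => z - f n (r n z)).
  by move=> a x y; rewrite (linearP (r n)) (linearP (f n)) scalerBr opprD addrACA.
have w n x : coker_sub n x -> mklinear (l n) x = 0.
  by move=> [u ->] /=; rewrite rf subrr.
exists f, (@ChainMap _ B coker (fun n => qproj (coker_sub n)) c), r,
  (fun n => qlift (w n)); split=> // n z.
  have [x <-] := qproj_surj z; rewrite qliftE /=; apply/qprojP.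
  by exists (- r n x); rewrite addrC addKr linearN.
by rewrite qliftE /= addrC subrK.
Qed.

End Coker.

Section Unshift.
Variables (R : comPzRingType).
Implicit Types X Y : complex R.

Lemma tr_diff X i j x : cdiff X j (tr X i j x) = tr X (i - 1) (j - 1) (cdiff X i x).
Proof.
case: (i =P j) => [e|ne]; first by case: j / e; rewrite !trii.
rewrite !tr_neq ?linear0 // => e; apply: ne.
by rewrite -[i](subrK 1) e subrK.
Qed.

Fact unshift_diffK X i (x : X (i + 1)) :
  let d j : {linear X (j + 1) -> X (j - 1 + 1)} :=
    \- linC (tr X (j + 1 - 1) (j - 1 + 1)) (cdiff X (j + 1)) in
  d (i - 1) (d i x) = 0.
Proof. by rewrite /= 2!linearN opprK tr_diff cdiffK !linear0. Qed.

(** The shift is inverted only up to isomorphism, as [i - 1 + 1] is not convertible to [i]; hence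
    the transport in the differential. *)
Definition unshift X : complex R := Complex (@unshift_diffK X).

Lemma unshift_iso X : exists (f : chain_map X (shift (unshift X)))
    (g : forall n, {linear shift (unshift X) n -> X n}),
  (forall n x, g n (f n x) = x) /\ (forall n x, f n (g n x) = x).
Proof.
have c i x : cdiff (shift (unshift X)) i (tr X i (i - 1 + 1) x) =
    tr X (i - 1) (i - 1 - 1 + 1) (cdiff X i x).
  by rewrite /= opprK tr_diff tr_comp ?addrK.
exists (@ChainMap _ X (shift (unshift X)) (fun i => tr X i (i - 1 + 1)) c).
exists (fun i => tr X (i - 1 + 1) i); split=> n x.
  by rewrite [LHS]tr_comp ?trii ?subrK.
by rewrite [LHS]tr_comp ?trii ?subrK.
Qed.

Definition zeroc : complex R :=
  @Complex R (fun=> 'rV[R]_0) (fun=> \0) (fun i x => erefl).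

Lemma rV0 (A : pzRingType) (x : 'rV[A]_0) : x = 0.
Proof. by apply/rowP => -[]. Qed.

Lemma trivial_perfect X : (forall i (x : X i), x = 0) -> perfect X.
Proof.
move=> X0; apply/perfectE; split; first by exists 0%N => i _ x; exact: (X0 i x).
by move=> i; exists [::] => x; rewrite big_nil; exact: (X0 i x).
Qed.

Lemma trivial_contractible X : (forall i (x : X i), x = 0) -> contractible X.
Proof. by move=> X0; exists (fun=> \0) => i x; rewrite [RHS](X0 _ x); exact: (X0 _ _). Qed.

Variables (C : complex R -> Prop).
Hypothesis C23 : closed23 C.

Lemma c_zero X : (forall i (x : X i), x = 0) -> C X.
Proof.
move=> X0; apply: (c_contr C23); first exact: trivial_perfect.
exact: trivial_contractible.
Qed.

Lemma c_iso X Y (f : chain_map X Y) (g : forall n, {linear Y n -> X n}) :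
  (forall n x, g n (f n x) = x) -> (forall n x, f n (g n x) = x) -> C X -> C Y.
Proof.
move=> gf fg CX.
have S : ses X Y zeroc.
  exists f, (chain_zero Y zeroc), g, (fun=> \0); split=> // [n y|n z].
    by rewrite [LHS]rV0 [RHS]rV0.
  by rewrite fg addr0.
apply: (c_mid C23 S CX); apply: c_zero => i x; exact: rV0.
Qed.

Lemma c_cone_id X : perfect X -> C (cone (chain_id X)).
Proof.
move=> pX; apply: (c_contr C23); first exact: perfect_cone.
exact: cone_id_contractible.
Qed.

Lemma c_shift X : C X -> C (shift X).
Proof.
move=> CX; apply: (c_quo C23 (ses_cone (chain_id X)) CX).
exact: c_cone_id (c_perfect C23 CX).
Qed.

Lemma c_dsum X Y : C X -> C Y -> C (dsum X Y).
Proof. exact: (c_mid C23 (ses_dsum X Y)). Qed.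

Lemma c_cone X Y (f : chain_map X Y) : C X -> C Y -> C (cone f).
Proof. by move=> CX CY; exact: (c_mid C23 (ses_cone f) CY (c_shift CX)). Qed.

End Unshift.

Lemma unshift_perfect (R : comPzRingType) (X : complex R) :
  perfect X -> perfect (unshift X).
Proof.
move=> /perfectE [[b bX] pX]; apply/perfectE; split => [|i]; last exact: pX.
exists b.+1 => i bi x; apply: bX; lia.
Qed.

Section UnshiftClosed.
Variables (R : comPzRingType) (C : complex R -> Prop).
Hypothesis C23 : closed23 C.

Lemma c_unshift X : C X -> C (unshift X).
Proof.
move=> CX; have [f [g [gf fg]]] := unshift_iso X.
apply: (c_sub C23 (ses_cone (chain_id (unshift X)))).
  by apply: (c_cone_id C23); exact/unshift_perfect/(c_perfect C23).
exact: c_iso C23 _ _ _ _ gf fg CX.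
Qed.

Lemma c_shiftK X : perfect X -> C (shift X) -> C X.
Proof.
move=> pX CX; apply: (c_sub C23 (ses_cone (chain_id X))) => //.
exact: c_cone_id.
Qed.

End UnshiftClosed.

Section Contraction.
Variables (R : comPzRingType) (X : complex R) (e : R).
Hypotheses (pX : perfect X) (ee : e * e = e).

(** The homology in degree [i - 1] is killed by [e]; for idempotent [e] this is exactness there of
    the summand eX. *)
Definition e_exact (i : int) : Prop :=
  forall z : X (i - 1), cdiff X (i - 1) z = 0 -> exists y : X i, cdiff X i y = e *: z.

(** A contraction of eX, valid on cycles only, is built upwards from the degrees in which X
    vanishes. *)
Lemma e_contraction (b : int) : (forall i, i < b -> e_exact i) ->
  forall i, i < b -> exists k : {linear X (i - 1) -> X i},
    forall z, cdiff X (i - 1) z = 0 -> cdiff X i (k z) = e *: z.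
Proof.
move=> exX; have /perfectE [[B bX] fX] := pX.
suff H (m : nat) : forall i, i <= - B%:Z + m%:Z -> i < b ->
    exists k : {linear X (i - 1) -> X i},
    forall z, cdiff X (i - 1) z = 0 -> cdiff X i (k z) = e *: z.
  by move=> i ib; apply: (H (absz (i + B%:Z)%R)) => //; lia.
elim: m => [|m IHm] i im ib.
  exists \0 => z _; rewrite linear0 (bX _ _ z) ?scaler0 //; lia.
have [k kP] : exists k : {linear X (i - 1 - 1) -> X (i - 1)},
    forall z, cdiff X (i - 1 - 1) z = 0 -> cdiff X (i - 1) (k z) = e *: z.
  by apply: IHm; lia.
(* [e - k d] takes values in the cycles, so [e] times it has preimages under the differential; on a
   cycle it is multiplication by [e * e = e]. *)
pose f : {linear X (i - 1) -> X (i - 1)} :=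
  e \*: (e \*: idfun \- linC k (cdiff X (i - 1))).
have [x|h hP] := lift_range (f := f) (g := cdiff X i) (fX _).
  have /exX [] // : cdiff X (i - 1) (e *: x - k (cdiff X (i - 1) x)) = 0.
    by rewrite linearB linearZ /= kP ?subrr ?cdiffK.
  by move=> y yP; exists y.
by exists h => z dz; rewrite hP /f /= dz linear0 subr0 scalerA ee.
Qed.

End Contraction.

Lemma acyclic_contractible (R : comPzRingType) (X : complex R) :
  perfect X -> acyclic X -> contractible X.
Proof.
move=> pX aX.
have H i : exists k : {linear X (i - 1) -> X i},
    forall z, cdiff X (i - 1) z = 0 -> cdiff X i (k z) = 1 *: z.
  apply: (e_contraction pX (mulr1 1) (b := i + 1)) => [j _ z dz|]; last by lia.
  by rewrite scale1r; exact: aX.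
pose k i := projT1 (cid (H i)).
have kP i z : cdiff X (i - 1) z = 0 -> cdiff X i (k i z) = z.
  by move=> dz; rewrite /k; case: cid => h /= ->; rewrite ?scale1r.
have dkd i x : cdiff X (i - 1) (x - k (i - 1) (cdiff X (i - 1) x)) = 0.
  by rewrite linearB kP ?cdiffK ?subrr.
(* Each [k] inverts the differential on cycles only; composed with the projection [1 - k d] onto the
   cycles it becomes a homotopy. *)
exists (fun i => linC (k i) (idfun \- linC (k (i - 1)) (cdiff X (i - 1)))) => i x /=.
by rewrite kP // cdiffK linear0 subr0 subrK.
Qed.

Lemma not_e_exact_min (R : comPzRingType) (X : complex R) (e : R) i :
  perfect X -> ~ e_exact X e i ->
  exists b, ~ e_exact X e b /\ forall j, j < b -> e_exact X e j.
Proof.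
move=> /perfectE [[B bX] _] ni.
have low j : j <= - B%:Z -> e_exact X e j.
  move=> jB z _; exists 0; rewrite linear0 (bX _ _ z) ?scaler0 //; lia.
have iB : - B%:Z < i by rewrite ltNge; apply/negP => /low.
(* Degrees are offset by the bound [B], so that the least one is found among the natural numbers. *)
pose P m := `[< ~ e_exact X e (m%:Z - B%:Z) >].
have exP : exists m, P m.
  exists (absz (i + B%:Z)%R); apply/asboolP.
  by have -> : (absz (i + B%:Z)%R)%:Z - B%:Z = i by lia.
case: (ex_minnP exP) => m /asboolP nm mP; exists (m%:Z - B%:Z); split=> // j jm.
apply: contrapT => nj; have jB : - B%:Z < j by rewrite ltNge; apply/negP => /low.
have /mP : P (absz (j + B%:Z)%R).
  by apply/asboolP; have -> : (absz (j + B%:Z)%R)%:Z - B%:Z = j by lia.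
lia.
Qed.

(** * Tensor products of complexes *)

Section TensorTheory.
Variables (R A : comPzRingType) (phi : {rmorphism R -> A}).
Variables (I : Type) (U : I -> lmodType R) (V : I -> lmodType A) (D : pred I).

Definition pt i (u : U i) (v : V i) : tensor phi U V D :=
  cls ([:: pure u v] : tensor_premodule phi U V D).

Lemma pt_eq i (u u' : U i) (v v' : V i) :
  (forall (P : zmodType) (g : balanced phi U V P), g i u v = g i u' v') ->
  pt u v = pt u' v'.
Proof.
move=> H; apply/clsP => P g; rewrite /tensor_eval !big_cons !big_nil /=.
by case: (D i); rewrite // H.
Qed.

Lemma ptDl i (u u' : U i) (v : V i) : pt (u + u') v = pt u v + pt u' v.
Proof.
rewrite -clsD; apply/clsP => P g; rewrite /tensor_eval !big_cons !big_nil /=.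
by case: (D i); rewrite ?addr0 // balDl.
Qed.

Lemma ptDr i (u : U i) (v v' : V i) : pt u (v + v') = pt u v + pt u v'.
Proof.
rewrite -clsD; apply/clsP => P g; rewrite /tensor_eval !big_cons !big_nil /=.
by case: (D i); rewrite ?addr0 // balDr.
Qed.

Lemma ptZl i r (u : U i) (v : V i) : pt (r *: u) v = phi r *: pt u v.
Proof. by rewrite -clsZ; apply: pt_eq => P g; exact: balZ. Qed.

Lemma ptZr i a (u : U i) (v : V i) : pt u (a *: v) = a *: pt u v.
Proof. by rewrite -clsZ. Qed.

Lemma pt0l i (v : V i) : pt 0 v = 0.
Proof. by apply/(@addrI _ (pt 0 v)); rewrite -ptDl !addr0. Qed.

Lemma pt0r i (u : U i) : pt u 0 = 0.
Proof. by rewrite -[0](scale0r 0) ptZr scale0r. Qed.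

Lemma pt_out i (u : U i) (v : V i) : ~~ D i -> pt u v = 0.
Proof.
move=> nD; rewrite -[0]/(cls (pm_zero (tensor_premodule phi U V D))).
apply/clsP => P g; rewrite /tensor_eval big_cons !big_nil /=.
by case: (D i) nD.
Qed.

Lemma tensor_ind (P : tensor phi U V D -> Prop) :
  P 0 -> (forall x y, P x -> P y -> P (x + y)) ->
  (forall i u v, D i -> P (@pt i u v)) -> forall q, P q.
Proof.
move=> P0 PD Ppt q; rewrite -[q]repK; elim: (rep q) => [|[i [u v]] s IHs].
  exact: P0.
have -> : cls ((existT _ i (u, v) :: s) : tensor_premodule phi U V D) =
    pt u v + cls (s : tensor_premodule phi U V D) by rewrite -clsD.
apply: PD => //; case: (boolP (D i)) => [Di|/pt_out ->]; last exact: P0.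
exact: Ppt.
Qed.

Lemma tensor_ext (N : lmodType A) (f g : {linear tensor phi U V D -> N}) :
  (forall i u v, D i -> f (@pt i u v) = g (@pt i u v)) -> forall q, f q = g q.
Proof.
move=> fg; apply: tensor_ind => // [|x y fx fy]; first by rewrite !linear0.
by rewrite !linearD fx fy.
Qed.

Section Lift.
Variables (N : lmodType A) (b : forall i, U i -> V i -> N).
Hypothesis bDl : forall i u u' v, b (i := i) (u + u') v = b u v + b u' v.
Hypothesis bPr : forall i u a v v', b (i := i) u (a *: v + v') = a *: b u v + b u v'.
Hypothesis bS : forall i r u v, b (i := i) (r *: u) v = phi r *: b u v.

Fact lift_bDr i u v v' : b (i := i) u (v + v') = b u v + b u v'.
Proof. by rewrite -{1}[v]scale1r bPr scale1r. Qed.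
Fact lift_b0 i u : b (i := i) u 0 = 0.
Proof. by apply/(@addrI _ (b (i := i) u 0)); rewrite -lift_bDr !addr0. Qed.
Fact lift_bZ i r u v : b (i := i) (r *: u) v = b u (phi r *: v).
Proof. by rewrite bS -[phi r *: v]addr0 bPr lift_b0 addr0. Qed.

Definition lift_balanced : balanced phi U V N := Balanced bDl lift_bDr lift_bZ.

Fact tlift_linear : linear (fun q : tensor phi U V D =>
  tensor_eval D lift_balanced (rep q)).
Proof.
have E (s : tensor_premodule phi U V D) :
  tensor_eval D lift_balanced (rep (cls s)) = tensor_eval D lift_balanced s.
  exact: (rep_cls s N lift_balanced).
move=> a x y; rewrite -[x]repK -[y]repK -clsZ -clsD !E tensor_eval_cat.
congr (_ + _); rewrite tensor_eval_scale /tensor_eval scaler_sumr.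
apply: eq_bigr => -[i [u v]] _ /=; rewrite /scale_balanced.
by case: scale_balanced_axioms => h1 h2 h3 /=; rewrite -[a *: v]addr0 bPr lift_b0 addr0.
Qed.

Fact tlift_exists : {f : {linear tensor phi U V D -> N} |
  forall i u v, D i -> f (@pt i u v) = b u v}.
Proof.
exists (mklinear tlift_linear) => i u v Di /=.
transitivity (tensor_eval D lift_balanced [:: pure u v]).
  exact: (rep_cls ([:: pure u v] : tensor_premodule phi U V D) N lift_balanced).
by rewrite /tensor_eval big_cons big_nil /= Di addr0.
Qed.

Definition tlift := sval tlift_exists.
Lemma tliftE i u v : D i -> tlift (@pt i u v) = b u v.
Proof. exact: (svalP tlift_exists). Qed.

End Lift.

End TensorTheory.

Section TensorMap.
Variables (R A : comPzRingType) (phi : {rmorphism R -> A}).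
Variables (I : Type) (D : pred I).

Fact tmap_exists (U U' : I -> lmodType R) (V V' : I -> lmodType A)
   (f : forall i, {linear U i -> U' i}) (g : forall i, {linear V i -> V' i}) :
  {h : {linear tensor phi U V D -> tensor phi U' V' D} |
    forall i u v, h (pt _ _ u v) = pt _ _ (f i u) (g i v)}.
Proof.
have b1 i u u' v : pt phi D (f i (u + u')) (g i v) =
   pt _ _ (f i u) (g i v) + pt _ _ (f i u') (g i v) by rewrite linearD ptDl.
have b2 i u a v v' : pt phi D (f i u) (g i (a *: v + v')) =
   a *: pt _ _ (f i u) (g i v) + pt _ _ (f i u) (g i v').
  by rewrite linearP ptDr ptZr.
have b3 i r u v : pt phi D (f i (r *: u)) (g i v) =
   phi r *: pt _ _ (f i u) (g i v) by rewrite linearZ ptZl.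
exists (tlift (b := fun i u v => pt phi D (f i u) (g i v)) D b1 b2 b3) => i u v.
case: (boolP (D i)) => Di; first by rewrite tliftE.
by rewrite !pt_out ?linear0.
Qed.

Definition tmap (U U' : I -> lmodType R) (V V' : I -> lmodType A) f g := sval (@tmap_exists U U' V V' f g).
Lemma tmapE (U U' : I -> lmodType R) (V V' : I -> lmodType A) f g i u v :
  @tmap U U' V V' f g (pt _ _ u v) = pt _ _ (f i u) (g i v).
Proof. exact: (svalP (tmap_exists f g)). Qed.

Lemma tmap_comp (U U' U'' : I -> lmodType R) (V V' V'' : I -> lmodType A) (f : forall i, {linear U i -> U' i})
  (f' : forall i, {linear U' i -> U'' i}) (f'' : forall i, {linear U i -> U'' i})
  (g : forall i, {linear V i -> V' i})
  (g' : forall i, {linear V' i -> V'' i}) (g'' : forall i, {linear V i -> V'' i}) :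
  (forall i x, f' i (f i x) = f'' i x) -> (forall i x, g' i (g i x) = g'' i x) ->
  forall q, tmap f' g' (tmap f g q) = tmap f'' g'' q.
Proof.
move=> ff gg.
apply: (tensor_ext (f := linC (tmap f' g') (tmap f g)) (g := tmap f'' g'')).
by move=> i u v _ /=; rewrite !tmapE ff gg.
Qed.

Lemma tmap_id (U : I -> lmodType R) (V : I -> lmodType A) q : @tmap U U V V (fun=> idfun) (fun=> idfun) q = q.
Proof.
by move: q; apply: (tensor_ext (g := idfun)) => i u v _; rewrite tmapE.
Qed.

End TensorMap.

Section TensorComplexTheory.
Variables (R A : comPzRingType) (phi : {rmorphism R -> A}).
Implicit Types (X : complex R) (Y : complex A).

(** The three degrees are independent: the term is 0 unless [i + j = n], by [pt_out], and no proof
    of that equation is carried along. *)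
Definition tpt X Y (n i j : int) (x : X i) (y : Y j) : tensor_complex phi X Y n :=
  @pt R A phi (int * int) (fun ij => X ij.1) (fun ij => Y ij.2)
    (fun ij => ij.1 + ij.2 == n) (i, j) x y.

Lemma tpt_diff X Y n i j (x : X i) (y : Y j) :
  cdiff (tensor_complex phi X Y) n (tpt n x y) =
  tpt (n - 1) (cdiff X i x) y + (-1) ^+ `|i|%N *: tpt (n - 1) x (cdiff Y j y).
Proof.
rewrite -ptZr -clsD.
exact: (mq_map_funE (@tdiff_eq R A phi X Y n)).
Qed.

Lemma tpt0l X Y n i j (y : Y j) : tpt n (0 : X i) y = 0.
Proof. exact: (@pt0l _ _ _ _ _ _ _ (i, j)). Qed.
Lemma tpt0r X Y n i j (x : X i) : tpt n x (0 : Y j) = 0.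
Proof. exact: (@pt0r _ _ _ _ _ _ _ (i, j)). Qed.
Lemma tptDl X Y n i j (x x' : X i) (y : Y j) :
  tpt n (x + x') y = tpt n x y + tpt n x' y.
Proof. exact: (@ptDl _ _ _ _ _ _ _ (i, j)). Qed.
Lemma tptDr X Y n i j (x : X i) (y y' : Y j) :
  tpt n x (y + y') = tpt n x y + tpt n x y'.
Proof. exact: (@ptDr _ _ _ _ _ _ _ (i, j)). Qed.
Lemma tptZl X Y n i j a (x : X i) (y : Y j) :
  tpt n (a *: x) y = phi a *: tpt n x y.
Proof. exact: (@ptZl _ _ _ _ _ _ _ (i, j)). Qed.
Lemma tptZr X Y n i j a (x : X i) (y : Y j) : tpt n x (a *: y) = a *: tpt n x y.
Proof. exact: (@ptZr _ _ _ _ _ _ _ (i, j)). Qed.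

Lemma tpt_trl X Y n i i' j (x : X i) (y : Y j) : i = i' ->
  tpt n (tr X i i' x) y = tpt n x y.
Proof. by move=> e; case: i' / e; rewrite trii. Qed.

Lemma tpt_trr X Y n i j j' (x : X i) (y : Y j) : j = j' ->
  tpt n x (tr Y j j' y) = tpt n x y.
Proof. by move=> e; case: j' / e; rewrite trii. Qed.

Lemma tens_ind X Y n (P : tensor_complex phi X Y n -> Prop) :
  P 0 -> (forall x y, P x -> P y -> P (x + y)) ->
  (forall i j (x : X i) (y : Y j), i + j = n -> P (tpt n x y)) -> forall q, P q.
Proof.
move=> P0 PD Pt; apply: tensor_ind => // -[i j] u v /eqP e; exact: Pt.
Qed.

Lemma tens_ext X Y n (N : lmodType A)
    (f g : {linear tensor_complex phi X Y n -> N}) :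
  (forall i j (x : X i) (y : Y j), i + j = n -> f (tpt n x y) = g (tpt n x y)) ->
  forall q, f q = g q.
Proof.
move=> fg; apply: tensor_ext => -[i j] u v /eqP e; exact: fg.
Qed.

Lemma tens_lift X Y n (N : lmodType A) (b : forall i j, X i -> Y j -> N) :
  (forall i j u u' v, b i j (u + u') v = b i j u v + b i j u' v) ->
  (forall i j u a v v', b i j u (a *: v + v') = a *: b i j u v + b i j u v') ->
  (forall i j r u v, b i j (r *: u) v = phi r *: b i j u v) ->
  {f : {linear tensor_complex phi X Y n -> N} |
     forall i j (x : X i) (y : Y j), i + j = n -> f (tpt n x y) = b i j x y}.
Proof.
move=> b1 b2 b3.
exists (@tlift R A phi _ (fun ij => X ij.1) (fun ij => Y ij.2)
  (fun ij => ij.1 + ij.2 == n) N (fun ij => b ij.1 ij.2)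
  (fun ij => b1 ij.1 ij.2) (fun ij => b2 ij.1 ij.2) (fun ij => b3 ij.1 ij.2)).
by move=> i j x y /eqP e; rewrite /tpt tliftE.
Qed.

(** Families of linear maps are allowed because the retractions and sections of a [ses] are not
    chain maps and have to be tensored as well. *)
Definition cmapt X X' Y Y' (f : forall i, {linear X i -> X' i})
    (g : forall i, {linear Y i -> Y' i}) n :
  {linear tensor_complex phi X Y n -> tensor_complex phi X' Y' n} :=
  tmap phi (fun ij : int * int => ij.1 + ij.2 == n)
   (fun ij => f ij.1) (fun ij => g ij.2).

Lemma cmaptE X X' Y Y' (f : forall i, {linear X i -> X' i})
    (g : forall i, {linear Y i -> Y' i}) n i j (x : X i) (y : Y j) :
  cmapt f g n (tpt n x y) = tpt n (f i x) (g j y).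
Proof. exact: (tmapE _ _ (fun ij => f ij.1) (fun ij => g ij.2)). Qed.

Fact cmapt_diff X X' Y Y' (f : chain_map X X') (g : chain_map Y Y') n q :
  cdiff (tensor_complex phi X' Y') n (cmapt f g n q) =
  cmapt f g (n - 1) (cdiff (tensor_complex phi X Y) n q).
Proof.
move: q; apply: tens_ind => [|x y ex ey|i j x y _]; first by rewrite !linear0.
  by rewrite !linearD ex ey.
by rewrite cmaptE !tpt_diff linearD linearZZ !cmaptE !cmap_diff.
Qed.

Definition chain_tens X X' Y Y' (f : chain_map X X') (g : chain_map Y Y') :=
  @ChainMap _ (tensor_complex phi X Y) (tensor_complex phi X' Y') (cmapt f g)
    (cmapt_diff f g).

Lemma cmapt_comp X X' X'' Y Y' Y'' (f : forall i, {linear X i -> X' i})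
    (f' : forall i, {linear X' i -> X'' i}) (f'' : forall i, {linear X i -> X'' i})
    (g : forall i, {linear Y i -> Y' i}) (g' : forall i, {linear Y' i -> Y'' i})
    (g'' : forall i, {linear Y i -> Y'' i}) :
  (forall i x, f' i (f i x) = f'' i x) -> (forall i x, g' i (g i x) = g'' i x) ->
  forall n q, cmapt f' g' n (cmapt f g n q) = cmapt f'' g'' n q.
Proof. by move=> ff gg n q; apply: tmap_comp => -[i j]; [exact: ff|exact: gg]. Qed.

Lemma cmapt_id X Y n q : @cmapt X X Y Y (fun=> idfun) (fun=> idfun) n q = q.
Proof. exact: tmap_id. Qed.

Lemma ses_tens_r X A' B' D' : ses A' B' D' ->
  ses (tensor_complex phi X A') (tensor_complex phi X B') (tensor_complex phi X D').
Proof.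
move=> [i [p [r [s [ri ps e]]]]].
exists (chain_tens (chain_id X) i), (chain_tens (chain_id X) p),
  (cmapt (fun=> idfun) r), (cmapt (fun=> idfun) s).
split=> n q /=.
- by rewrite (cmapt_comp (f'' := fun=> idfun) (g'' := fun=> idfun)) ?cmapt_id.
- by rewrite (cmapt_comp (f'' := fun=> idfun) (g'' := fun=> idfun)) ?cmapt_id.
rewrite (cmapt_comp (f'' := fun=> idfun) (g'' := fun j => linC (i j) (r j))) //.
rewrite (cmapt_comp (f'' := fun=> idfun) (g'' := fun j => linC (s j) (p j))) //.
move: q; apply: (tens_ext (g := idfun) (f := cmapt (fun=> idfun)
  (fun j => linC (i j) (r j)) n \+ cmapt (fun=> idfun) (fun j => linC (s j) (p j)) n)).
by move=> k l x y _ /=; rewrite !cmaptE -tptDr e.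
Qed.

Lemma ses_tens_l Y A' B' D' : ses A' B' D' ->
  ses (tensor_complex phi A' Y) (tensor_complex phi B' Y) (tensor_complex phi D' Y).
Proof.
move=> [i [p [r [s [ri ps e]]]]].
exists (chain_tens i (chain_id Y)), (chain_tens p (chain_id Y)),
  (cmapt r (fun=> idfun)), (cmapt s (fun=> idfun)).
split=> n q /=.
- by rewrite (cmapt_comp (f'' := fun=> idfun) (g'' := fun=> idfun)) ?cmapt_id.
- by rewrite (cmapt_comp (f'' := fun=> idfun) (g'' := fun=> idfun)) ?cmapt_id.
rewrite (cmapt_comp (g'' := fun=> idfun) (f'' := fun j => linC (i j) (r j))) //.
rewrite (cmapt_comp (g'' := fun=> idfun) (f'' := fun j => linC (s j) (p j))) //.
move: q; apply: (tens_ext (g := idfun) (f := cmapt (fun j => linC (i j) (r j))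
  (fun=> idfun) n \+ cmapt (fun j => linC (s j) (p j)) (fun=> idfun) n)).
by move=> k l x y _ /=; rewrite !cmaptE -tptDl e.
Qed.

End TensorComplexTheory.

(** * Perfect tensor products and idempotent modules *)

Section TensorPerfect.
Variables (R A : comPzRingType) (phi : {rmorphism R -> A}).
Variables (X : complex R) (Y : complex A).

Lemma bounded_tens : bounded X -> bounded Y -> bounded (tensor_complex phi X Y).
Proof.
move=> [b bX] [c bY]; exists (b + c)%N => n bn.
apply: tens_ind => [//|x y -> ->|i j x y ijn]; first by rewrite addr0.
have [bi|ci] : (b < `|i|)%N \/ (c < `|j|)%N by lia.
  by rewrite (bX _ bi x) tpt0l.
by rewrite (bY _ ci y) tpt0r.
Qed.

Section Functional.
Variables (n i j : int) (c : {linear X i -> R^o}) (d : {linear Y j -> A^o}).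

Fact functional_exists : {f : {linear tensor_complex phi X Y n -> A^o} |
  forall k l (x : X k) (y : Y l), k + l = n ->
    f (tpt phi n x y) = phi (c (tr X k i x)) * d (tr Y l j y)}.
Proof.
apply: (@tens_lift R A phi X Y n A^o
  (fun k l x y => phi (c (tr X k i x)) * d (tr Y l j y) : A^o)).
- by move=> k l u u' v; rewrite !linearD rmorphD mulrDl.
- move=> k l u a v v'; rewrite !linearP /= mulrDr; congr (_ + _).
  by rewrite /GRing.scale /= mulrCA.
- by move=> k l r u v; rewrite !linearZ /= rmorphM /GRing.scale /= mulrA [phi r * _]mulrC.
Qed.

End Functional.

(** The products of dual bases of [X i] and [Y (n - i)] form a dual basis; boundedness of [X] leaves
    only the degrees [i] in [-b, b]. *)
Lemma fproj_tens n : bounded X -> (forall i, fproj (X i)) ->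
  (forall j, fproj (Y j)) -> fproj (tensor_complex phi X Y n).
Proof.
move=> [b bX] fX fY.
pose s i := projT1 (cid (fX i)); pose t j := projT1 (cid (fY j)).
have sP i x : x = \sum_(p <- s i) p.1 x *: p.2 by rewrite /s; case: cid.
have tP j y : y = \sum_(p <- t j) p.1 y *: p.2 by rewrite /t; case: cid.
pose r := [seq k%:Z - b%:Z | k <- iota 0 (b + b).+1].
pose F i p p' := sval (@functional_exists n i (n - i)
  (p : {linear X i -> R^o} * X i).1
  (p' : {linear Y (n - i) -> A^o} * Y (n - i)).1).
exists (flatten [seq flatten [seq [seq (F i p p', tpt phi n p.2 p'.2)
  | p' <- t (n - i)] | p <- s i] | i <- r]) => q.
transitivity (\sum_(i <- r) \sum_(p <- s i) \sum_(p' <- t (n - i))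
    F i p p' q *: tpt phi n p.2 p'.2); last first.
  rewrite [RHS]big_flatten [RHS]big_map; apply: eq_bigr => i _.
  rewrite [RHS]big_flatten [RHS]big_map; apply: eq_bigr => p _.
  by rewrite big_map.
move: q; apply: tens_ind => [|x y ex ey|k l x y kl].
- rewrite big1 // => i _; rewrite big1 // => p _; rewrite big1 // => p' _.
  by rewrite linear0 scale0r.
- rewrite {1}ex {1}ey -big_split; apply: eq_bigr => i _ /=.
  rewrite -big_split; apply: eq_bigr => p _ /=.
  rewrite -big_split; apply: eq_bigr => p' _ /=.
  by rewrite linearD scalerDl.
(* Summing over the bases in degree [i] recovers the component of the tensor in that degree, which
   is 0 unless [i = k]. *)
have E i : \sum_(p <- s i) \sum_(p' <- t (n - i))
    F i p p' (tpt phi n x y) *: tpt phi n p.2 p'.2 =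
    tpt phi n (tr X k i x) (tr Y l (n - i) y).
  have Dl : {morph (fun u : X i => tpt phi n u (tr Y l (n - i) y)) : u v / u + v}.
    by move=> u v; rewrite /= tptDl.
  rewrite [in RHS](sP i (tr X k i x)) (big_morph _ Dl (tpt0l _ _ _ _ _)).
  apply: eq_bigr => p _; rewrite tptZl [in RHS](tP _ (tr Y l (n - i) y)).
  have Dr : {morph (fun u : Y (n - i) => tpt phi n p.2 u) : u v / u + v}.
    by move=> u v; rewrite /= tptDr.
  rewrite (big_morph _ Dr (tpt0r _ _ _ _ _)) scaler_sumr; apply: eq_bigr => p' _.
  by rewrite tptZr scalerA /F; case: functional_exists => f /= ->.
under eq_bigr do rewrite E.
have ur : uniq r by rewrite map_inj_uniq ?iota_uniq // => u v; lia.
have [kr|kr] := boolP (k \in r).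
  rewrite (bigD1_seq k) //= trii big1 ?addr0 => [|i ik].
    by rewrite tpt_trr //; lia.
  by rewrite tr_neq ?tpt0l //; apply/eqP; rewrite eq_sym.
rewrite big1_seq => [|i /= ir]; last first.
  by rewrite tr_neq ?tpt0l // => ki; rewrite ki ir in kr.
rewrite (bX _ _ x) ?tpt0l // ltnNge; apply/negP => kb; move/negP: kr; apply.
by apply/mapP; exists (absz (k + b%:Z)%R); rewrite ?mem_iota; lia.
Qed.

End TensorPerfect.

Lemma perfect_tens (R : comPzRingType) (X Y : complex R) :
  perfect X -> perfect Y -> perfect (tens X Y).
Proof.
move=> /perfectE [bX fX] /perfectE [bY fY]; apply/perfectE; split.
  exact: bounded_tens.
by move=> n; exact: fproj_tens.
Qed.

Lemma in_degree0_zero (R : comPzRingType) (N : lmodType R) j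
  (y : in_degree0 N j) : j <> 0 -> y = 0.
Proof.
by move: y; rewrite /in_degree0 /=; case: eqP => // _ y _; exact: rV0.
Qed.

Lemma perfect_in_degree0 (R : comPzRingType) (N : lmodType R) :
  fproj N -> perfect (in_degree0 N).
Proof.
move=> fN; apply/perfectE; split.
  by exists 0%N => i i0 x; apply: in_degree0_zero => ei; rewrite ei in i0.
move=> i; rewrite /in_degree0 /=; case: (i == 0) => //.
by exists [::] => x; rewrite big_nil; exact: rV0.
Qed.

Section Insertion.
Variable R : comPzRingType.
Variables X Y : complex R.

Let tp n i j x y := @tpt R R idfun X Y n i j x y.

Section Right.
Variables (r : Y 0) (dr : cdiff Y 0 r = 0).

Fact insr_linear n : linear (fun x : X n => tp n x r : tens X Y n).
Proof. by move=> a x y; rewrite /tp tptDl tptZl. Qed.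
Fact insr_diff n x : cdiff (tens X Y) n (mklinear (@insr_linear n) x) =
  mklinear (@insr_linear (n - 1)) (cdiff X n x).
Proof. by rewrite [LHS]tpt_diff dr tpt0r scaler0 addr0. Qed.
Definition insr : chain_map X (tens X Y) :=
  @ChainMap _ X (tens X Y) (fun n => mklinear (@insr_linear n)) insr_diff.
Lemma insrE n x : insr n x = tp n x r. Proof. by []. Qed.
End Right.

Section Left.
Variables (u : X 0) (du : cdiff X 0 u = 0).

Fact insl_linear n : linear (fun y : Y n => tp n u y : tens X Y n).
Proof. by move=> a x y; rewrite /tp tptDr tptZr. Qed.
Fact insl_diff n x : cdiff (tens X Y) n (mklinear (@insl_linear n) x) =
  mklinear (@insl_linear (n - 1)) (cdiff Y n x).
Proof. by rewrite [LHS]tpt_diff du tpt0l add0r expr0 scale1r. Qed.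
Definition insl : chain_map Y (tens X Y) :=
  @ChainMap _ Y (tens X Y) (fun n => mklinear (@insl_linear n)) insl_diff.
End Left.

End Insertion.

(* [idem_module e N] says that N is the module Re, where e is idempotent: nu is
   the generator e and lambda the inclusion of Re in R. *)
Definition idem_module (R : comPzRingType) (e : R) (N : lmodType R) (nu : N)
  (lambda : {linear N -> R^o}) : Prop :=
  lambda nu = e /\ forall y, lambda y *: nu = y.

Section IdemModule.
Variables (R : comPzRingType) (e : R) (N : lmodType R) (nu : N).
Variables (lambda : {linear N -> R^o}).
Hypothesis idN : idem_module e nu lambda.

Let N0 := in_degree0 N.

Lemma idem_idem : e * e = e.
Proof.
by case: idN => le lK; have := congr1 lambda (lK nu); rewrite linearZ /= le.
Qed.

Lemma idem_nu : e *: nu = nu.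
Proof. by case: idN => <- lK; exact: lK. Qed.

Lemma idem_fproj : fproj N.
Proof.
case: idN => le lK.
by exists [:: (lambda, nu)] => x; rewrite big_cons big_nil addr0 lK.
Qed.

Lemma idem_perfect : perfect N0.
Proof. exact: perfect_in_degree0 idem_fproj. Qed.

Variable X : complex R.

(** With [beta] this identifies [tens X N0] with the summand eX: [beta] is the inclusion and [alpha]
    the projection. *)
Definition alpha : chain_map X (tens X N0) := @insr R X N0 nu erefl.

Fact beta_fun_exists n : {f : {linear tens X N0 n -> X n} |
  forall i j (x : X i) (y : N0 j), i + j = n ->
    f (tpt idfun n x y) = lambda (tr N0 j 0 y) *: tr X i n x}.
Proof.
apply: (@tens_lift R R idfun X N0 n (X n)
  (fun i j x y => lambda (tr N0 j 0 y) *: tr X i n x)).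
- by move=> i j u u' v; rewrite linearD scalerDr.
- by move=> i j u a v v'; rewrite !linearP /= scalerDl scalerA.
- by move=> i j r u v; rewrite linearZ /= !scalerA mulrC.
Qed.

Definition beta_fun n := sval (beta_fun_exists n).

Lemma beta_funE n i j (x : X i) (y : N0 j) : i + j = n ->
  beta_fun n (tpt idfun n x y) = lambda (tr N0 j 0 y) *: tr X i n x.
Proof. exact: (svalP (beta_fun_exists n)). Qed.

Fact beta_diff n q : cdiff X n (beta_fun n q) =
  beta_fun (n - 1) (cdiff (tens X N0) n q).
Proof.
move: q; apply: tens_ind => [|x y ex ey|i j x y ijn]; first by rewrite !linear0.
  by rewrite !linearD ex ey.
rewrite beta_funE // tpt_diff linearD tpt0r scaler0 linear0 addr0.
rewrite beta_funE ?linearZ /= ?tr_diff //.  by rewrite addrAC ijn.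
Qed.

Definition beta : chain_map (tens X N0) X :=
  @ChainMap _ (tens X N0) X beta_fun beta_diff.

Lemma beta_alpha n x : beta n (alpha n x) = e *: x.
Proof.
rewrite [LHS]beta_funE ?addr0 // !trii; by case: idN => ->.
Qed.

Lemma alpha_beta n q : alpha n (beta n q) = q.
Proof.
move: q; apply: tens_ind => [|x y ex ey|i j x y ijn]; first by rewrite !linear0.
  by rewrite !linearD ex ey.
rewrite [beta _ _]beta_funE //.
have [j0|nj] := eqVneq j 0; last first.
  by rewrite (in_degree0_zero y) ?tpt0r ?linear0 ?scale0r ?linear0 //; apply/eqP.
subst j n; case: idN => le lK.
rewrite trii linearZZ [alpha _ _]insrE -tptZr tpt_trl ?addr0 //.
by congr (tpt _ _ _ _); exact: lK.
Qed.

(** Through this equivalence [Supp] is read off from [e_exact], since R localized at p_i is such a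
    module by [localization_idem_exists]. *)
Lemma tens_idem_acyclic : acyclic (tens X N0) <-> forall i, e_exact X e i.
Proof.
split=> [aT i z dz|eX i z dz].
  have [|t dt] := aT i (alpha (i - 1) z).
    by rewrite cmap_diff dz linear0.
  by exists (beta i t); rewrite cmap_diff dt beta_alpha.
have [|y dy] := eX i (beta (i - 1) z); first by rewrite cmap_diff dz linear0.
exists (alpha i y); rewrite cmap_diff dy -beta_alpha.
by rewrite !alpha_beta.
Qed.

Lemma ses_beta : ses (tens X N0) X (coker beta).
Proof. exact: (ses_coker alpha_beta). Qed.

(** The cokernel of the inclusion of eX is (1 - e)X. *)
Lemma coker_beta_acyclic : (forall i, e_exact X (1 - e) i) ->
  acyclic (coker beta).
Proof.
move=> eX i z; have [x <-] := qproj_surj z.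
rewrite [cdiff _ _ _]coker_diffE => /qproj_eq0 [t dt].
(* [x] is a cycle only modulo the image of [beta]; its component [x' = (1 - e) x] is a true
   cycle. *)
pose x' := x - beta (i - 1) (alpha (i - 1) x).
have [|y dy] := eX i x'.
  by rewrite linearB !cmap_diff dt alpha_beta subrr.
exists (qproj _ y); rewrite [LHS]coker_diffE dy; apply/qprojP.
rewrite /x' scalerBl scale1r beta_alpha scalerBr scalerA idem_idem subrr subr0.
by exists (- alpha (i - 1) x); rewrite linearN beta_alpha addrAC subrr add0r.
Qed.

End IdemModule.

Section Cell.
Variables (R : comPzRingType) (e : R) (N : lmodType R) (nu : N).
Variables (lambda : {linear N -> R^o}).
Hypothesis idN : idem_module e nu lambda.
Variables (X : complex R) (u : X 0) (eps : {linear X 0 -> R^o}).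
Hypotheses (du : cdiff X 0 u = 0) (eu : eps u = e).

Let N0 := in_degree0 N.

Fact cell_linear n : linear (fun y : N0 n => lambda (tr N0 n 0 y) *: tr X 0 n u).
Proof. by move=> a x y; rewrite !linearP /= scalerDl scalerA. Qed.

Fact cell_diff n y : cdiff X n (mklinear (@cell_linear n) y) =
  mklinear (@cell_linear (n - 1)) (cdiff N0 n y).
Proof. by rewrite /= linearZ /= tr_diff du !linear0 scale0r. Qed.

(** This sends [nu] to [e *: u]. The retraction [cell_retr] exists in each degree, and it is a chain
    map once [eps] kills boundaries on the factor of [e]. *)
Definition cell : chain_map N0 X :=
  @ChainMap _ N0 X (fun n => mklinear (@cell_linear n)) cell_diff.

Fact cell_retr_linear n : linear (fun x : X n =>
  tr N0 0 n ((eps (tr X n 0 x) : R) *: nu) : N0 n).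
Proof.
move=> a x y; rewrite -linearP; congr (tr _ _ _ _).
by rewrite !linearP /= scalerDl -scalerA.
Qed.

Definition cell_retr n : {linear X n -> N0 n} := mklinear (@cell_retr_linear n).

Lemma cell_retrK n y : cell_retr n (cell n y) = y.
Proof.
rewrite /=; have [n0|nn] := pselect (n = 0); last first.
  by transitivity (0 : N0 n); [|symmetry]; exact: in_degree0_zero.
subst n; rewrite !trii linearZ /= eu.
case: idN => le lK.
by rewrite /GRing.scale /= -[RHS]lK -{2}[nu]lK le scalerA.
Qed.

Lemma cell_retr_diff : (forall x : X 1, (eps (cdiff X 1 x) : R) * e = 0) ->
  forall n x, cdiff N0 n (cell_retr n x) = cell_retr (n - 1) (cdiff X n x).
Proof.
move=> nil n x; rewrite /=; have [n1|nn] := pselect (n = 1).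
  subst n; rewrite [tr X (1 - 1) 0 _]trii.
  have -> : eps (cdiff X 1 x) *: nu = 0 :> N.
    by rewrite -(idem_nu idN) scalerA nil ?scale0r.
  by rewrite linear0.
rewrite [tr X _ _ _]tr_neq ?linear0 ?scale0r ?linear0 // => n0.
by apply: nn; rewrite -[n](subrK 1) n0.
Qed.

End Cell.

(** * Pointed complexes *)

Section IdealPowers.
Variables (R : comPzRingType) (J : R -> Prop).
Hypothesis idealJ : is_ideal J.

(** The powers of [J]. A product of ideals is the least ideal that contains the products of
    elements: membership is used by choosing [K], and finite sums of products are never written
    out. *)
Fixpoint pw (k : nat) (x : R) : Prop :=
  if k is k'.+1 then
    forall K : R -> Prop, is_ideal K ->
      (forall a b, J a -> pw k' b -> K (a * b)) -> K x
  else True.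

Lemma pw_ideal k : is_ideal (pw k).
Proof.
case: k => [|k] //; split.
- by move=> K [K0 _ _] _.
- by move=> x y px py K iK HK; case: (iK) => _ KD _; apply: KD; [exact: px|exact: py].
- by move=> r x px K iK HK; case: (iK) => _ _ KM; apply: KM; exact: px.
Qed.

Lemma pwS k a b : J a -> pw k b -> pw k.+1 (a * b).
Proof. by move=> Ja pb K _; exact. Qed.

Lemma pw1 x : pw 1 x <-> J x.
Proof.
split=> [H|Jx]; last by rewrite -[x]mulr1; exact: pwS.
by apply: H => // a b Ja _; rewrite mulrC; case: idealJ => _ _; exact.
Qed.

Lemma pw0 k : pw k 0. Proof. by case: (pw_ideal k). Qed.
Lemma pwD k x y : pw k x -> pw k y -> pw k (x + y).
Proof. by case: (pw_ideal k) => _ H _; exact: H. Qed.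
Lemma pwM k r x : pw k x -> pw k (r * x).
Proof. by case: (pw_ideal k) => _ _ H; exact: H. Qed.
Lemma pwN k x : pw k x -> pw k (- x).
Proof. by rewrite -mulN1r; exact: pwM. Qed.

End IdealPowers.

Section Generated.
Variables (R : comPzRingType) (M : lmodType R) (G : M -> Prop).

Definition span (x : M) : Prop :=
  forall W : submod M, (forall y, G y -> W y) -> W x.

Fact span0 : span 0. Proof. by move=> W _; exact: sm0. Qed.
Fact spanP a x y : span x -> span y -> span (a *: x + y).
Proof. by move=> sx sy W GW; apply: smP; [exact: sx|exact: sy]. Qed.

Definition spanned : submod M := SubMod span0 spanP.
Lemma spanned_gen x : G x -> spanned x. Proof. by move=> Gx W; exact. Qed.

End Generated.

Section LocalIdempotent.
Variables (R : comPzRingType) (J : R -> Prop) (e : R).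
Hypotheses (idealJ : is_ideal J) (J1 : ~ J 1) (ee : e * e = e) (J1e : J (1 - e)).
Hypothesis unitJ : forall r, ~ J r -> exists w, w * r * e = e.
Hypothesis nilJ : exists m, forall x, pw J m x -> x * e = 0.

Lemma max_inverse r : ~ J r -> exists w, J (w * r - 1).
Proof.
move=> /unitJ [w we]; exists w.
have -> : w * r - 1 = (w * r - 1) * (1 - e) by rewrite mulrBr mulr1 mulrBl we mul1r subrr subr0.
by case: idealJ => _ _; exact.
Qed.

Lemma unit_of_one r : J (r - 1) -> exists w, w * r * e = e.
Proof.
move=> Jr1; apply: unitJ => Jr; apply: J1; case: idealJ => _ JD JM.
have -> : 1 = r + - 1 * (r - 1) by rewrite mulN1r opprB addrC subrK.
exact: JD (JM _ _ _).
Qed.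

Section Functional.
Variables (M : lmodType R) (u : M).

(** Each [g] in turn is added to [W] unless it is a multiple of [u] modulo [W]. At the end the
    listed elements span a line modulo [W], generated by [u]. *)
Lemma max_submod (s : seq M) (W0 : submod M) : ~ W0 u ->
  (forall a x, J a -> W0 (a *: x)) ->
  exists W : submod M, [/\ forall x, W0 x -> W x, ~ W u &
    forall g, List.In g s -> exists c, W (g - c *: u)].
Proof.
move=> nu JW; elim: s => [|g s [W [W0W nW Ws]]]; first by exists W0.
have [[c Wc]|nc] := pselect (exists c, W (g - c *: u)).
  by exists W; split=> // h [<-|/Ws //]; exists c.
pose W' x := exists r, W (x - r *: g).
have W'0 : W' 0 by exists 0; rewrite scale0r subr0; exact: sm0.
have W'P a x y : W' x -> W' y -> W' (a *: x + y).
  move=> [r Wr] [q Wq]; exists (a * r + q).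
  have -> : a *: x + y - (a * r + q) *: g = a *: (x - r *: g) + (y - q *: g).
    by rewrite scalerBr scalerDl scalerA opprD addrACA.
  exact: smP.
exists (SubMod W'0 W'P); split=> /= [x W0x|[r Wr]|h [<-|/Ws [c Wc]]].
- by exists 0; rewrite scale0r subr0; exact: W0W.
(* If [u] is [r *: g] modulo [W] with [r] outside [J], then [g] is a multiple of [u] modulo [W],
   which was excluded. *)
- have [Jr|/max_inverse [w Jw]] := pselect (J r).
    by apply: nW; rewrite -[u](subrK (r *: g)); apply: smD => //; exact/W0W/JW.
  apply: nc; exists w.
  have -> : g - w *: u = - (w *: (u - r *: g)) - (w * r - 1) *: g.
    rewrite scalerBr scalerBl scale1r scalerA !opprB.
    by rewrite [RHS]addrC addrA subrK.
  by apply: smB; [exact/smN/smZ|exact/W0W/JW].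
- by exists 0, 1; rewrite scale0r subr0 scale1r subrr; exact: sm0.
- by exists c, 0; rewrite scale0r subr0.
Qed.

(** For the [W] of [max_submod], M / W is a copy of R / J spanned by [u]; projectivity lifts M -> M
    / W along the map R -> M / W that sends 1 to [u]. *)
Lemma local_functional (W0 : submod M) : fproj M -> ~ W0 u ->
  (forall a x, J a -> W0 (a *: x)) ->
  exists eps : {linear M -> R^o}, J (eps u - 1) /\ forall b, W0 b -> J (eps b).
Proof.
move=> fM nu JW0; have [s sP] := fM.
have [W [W0W nW Ws]] := max_submod (map snd s) nu JW0.
have JW a x : J a -> W (a *: x) by move=> Ja; exact/W0W/JW0.
have Wall x : exists c, W (x - c *: u).
  rewrite {1}[x]sP; have: forall q, List.In q s -> exists c, W (q.2 - c *: u).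
    by move=> q qs; apply: Ws; apply: List.in_map.
  elim: s {sP Ws} => [_|q s IHs H].
    by exists 0; rewrite big_nil scale0r subr0; exact: sm0.
  have [|c Wc] := IHs; first by move=> p ps; apply: H; right.
  have [|d Wd] := H q; first by left.
  exists (q.1 x * d + c); rewrite big_cons scalerDl opprD addrACA -scalerA -scalerBr.
  exact: smP.
have Wu r : W (r *: u) -> J r.
  move=> Wr; apply: contrapT => /max_inverse [w Jw]; apply: nW.
  have -> : u = w *: (r *: u) - (w * r - 1) *: u.
    by rewrite scalerBl scale1r scalerA opprB addrC subrK.
  by apply: smB; [exact: smZ|exact: JW].
have l : linear (fun r : R^o => qproj W (r *: u)).
  by move=> a x y; rewrite scalerDl linearD -scalerA linearZ.
have [x|h hP] := lift_range (f := qproj W) (g := mklinear l) fM.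
  have [c Wc] := Wall x; exists c; apply/qprojP.
  by rewrite -opprB; exact: smN.
exists h; split.
  by apply: Wu; rewrite scalerBl scale1r; apply/qprojP; exact: hP.
move=> b /W0W Wb; apply: Wu; apply/qproj_eq0.
by rewrite [LHS]hP; apply/qproj_eq0.
Qed.

End Functional.

(** The pair (u, eps) splits a copy of Re off X modulo J^k, hence exactly once J^k e = 0. The cycle
    sits in degree [b - 1] because the differential of [X b] ends there without transport. *)
Definition pointed k (X : complex R) (b : int) : Prop :=
  exists (u : X (b - 1)) (eps : {linear X (b - 1) -> R^o}),
    [/\ cdiff X (b - 1) u = 0, eps u = e & forall x, pw J k (eps (cdiff X b x))].

(** Nakayama's lemma: if [e] times the cycles lay in boundaries + J X, it would lie in boundaries +
    J^m X for every m, hence in the boundaries, against the failure of exactness at [b]. *)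
Lemma pointed_start (X : complex R) b : perfect X -> ~ e_exact X e b ->
  (forall j, j < b -> e_exact X e j) -> pointed 1 X b.
Proof.
move=> pX nb low.
have [k kP] : exists k : {linear X (b - 1 - 1) -> X (b - 1)},
  forall z, cdiff X (b - 1 - 1) z = 0 -> cdiff X (b - 1) (k z) = e *: z.
  by apply: (e_contraction pX ee low); lia.
(* Exactness below [b] yields a map into the cycles that is multiplication by [e] on them. *)
have [f [df fz]] : exists f : {linear X (b - 1) -> X (b - 1)},
    (forall x, cdiff X (b - 1) (f x) = 0) /\
    forall z, cdiff X (b - 1) z = 0 -> f z = e *: z.
  exists (e \*: idfun \- linC k (cdiff X (b - 1))); split=> [x|z /= ->].
    by rewrite linearB linearZ /= kP ?subrr ?cdiffK.
  by rewrite linear0 subr0.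
(* The submodule spanned by [G m] is boundaries + J^m X. *)
pose G m x := (exists y, x = cdiff X b y) \/ exists a y, pw J m a /\ x = a *: y.
pose Z := [set z | cdiff X (b - 1) z = 0]%classic.
have [u [du nu]] : exists u, cdiff X (b - 1) u = 0 /\ ~ spanned (G 1%N) (e *: u).
  apply: contrapT => no; apply: nb => z dz.
  have all1 y : cdiff X (b - 1) y = 0 -> spanned (G 1%N) (e *: y).
    by move=> dy; apply: contrapT => ny; apply: no; exists y.
  have step m : forall y, cdiff X (b - 1) y = 0 -> spanned (G m) (e *: y).
    elim: m => [|m IHm] y dy; first by apply: spanned_gen; right; exists 1, (e *: y); rewrite scale1r.
    move=> W GW.
    have W'0 : W (e *: f 0) by rewrite linear0 scaler0; exact: sm0.
    have W'P a p q : W (e *: f p) -> W (e *: f q) -> W (e *: f (a *: p + q)).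
      by move=> Wp Wq; rewrite linearP scalerDr scalerA mulrC -scalerA; exact: smP.
    (* The part [a *: y'] in J X is moved into the cycles by [f]; the induction hypothesis for the
       cycle [f y'] then gains the factor [a] in [J]. *)
    have /= := all1 y dy (@SubMod _ _ (fun x => W (e *: f x)) W'0 W'P).
    rewrite linearZ /= fz // !scalerA !ee; apply => x [[y' ->]|[a [y' [/(pw1 idealJ) Ja ->]]]].
      by rewrite fz ?cdiffK //; apply/smZ/smZ/GW; left; exists y'.
    rewrite linearZ /= scalerA mulrC -scalerA.
    have W20 : W (a *: 0) by rewrite scaler0; exact: sm0.
    have W2P c p q : W (a *: p) -> W (a *: q) -> W (a *: (c *: p + q)).
      by move=> Wp Wq; rewrite scalerDr scalerA mulrC -scalerA; exact: smP.
    have := IHm (f y') (df y') (@SubMod _ _ (fun x => W (a *: x)) W20 W2P).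
    apply=> p [[q ->]|[c [q [pc ->]]]] /=.
      by apply/smZ/GW; left; exists q.
    by apply: GW; right; exists (a * c), q; rewrite scalerA; split=> //; exact: pwS.
  have [m nilm] := nilJ.
  pose W x := exists y, cdiff X b y = e *: x.
  have W0 : W 0 by exists 0; rewrite linear0 scaler0.
  have WP a p q : W p -> W q -> W (a *: p + q).
    move=> [p' Wp] [q' Wq]; exists (a *: p' + q').
    by rewrite linearP Wp Wq scalerDr !scalerA mulrC.
  have := step m z dz (SubMod W0 WP); rewrite /= /W scalerA ee; apply.
  move=> x [[y ->]|[a [y [pa ->]]]].
    by exists (e *: y); rewrite linearZ.
  by exists 0; rewrite linear0 scalerA mulrC nilm // scale0r.
have fX : fproj (X (b - 1)) by have /perfectE [_] := pX; exact.
have [|eps [eps1 epsJ]] := local_functional fX nu.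
  by move=> a x Ja; apply: spanned_gen; right; exists a, x; split=> //; exact/pw1.
(* The value of [eps] is 1 only modulo [J]; rescaling the cycle makes it equal to [e]. *)
have [w we] := unit_of_one eps1.
exists ((w * e) *: (e *: u)), eps; split.
- by rewrite !linearZ /= du !scaler0.
- by rewrite linearZ -[RHS]we /= /GRing.scale /= mulrAC.
- by move=> x; apply/(pw1 idealJ)/epsJ/spanned_gen; left; exists x.
Qed.

Lemma pointed_shift k (X : complex R) b :
  pointed k (shift X) b <-> pointed k X (b - 1).
Proof.
split=> -[u [eps [du eu pe]]].
  exists u, eps; split=> //; first by move/eqP: du; rewrite /= oppr_eq0 => /eqP.
  by move=> x; have /= := pe x; rewrite linearN => /pwN; rewrite opprK.
exists u, eps; split=> //; first by rewrite /= du oppr0.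
by move=> x /=; rewrite linearN; exact: pwN.
Qed.

Lemma pointed_iso k (X Y : complex R) (f : chain_map X Y)
  (g : forall n, {linear Y n -> X n}) b :
  (forall n x, g n (f n x) = x) -> (forall n x, f n (g n x) = x) ->
  pointed k X b -> pointed k Y b.
Proof.
move=> gf fg [u [eps [du eu pe]]]; exists (f _ u), (linC eps (g _)); split.
- by rewrite cmap_diff du linear0.
- by rewrite /= gf.
- by move=> y; rewrite /= -{1}[y]fg cmap_diff gf; exact: pe.
Qed.

Variable D : complex R -> Prop.
Hypothesis D23 : closed23 D.

Lemma pointed_recenter k (X : complex R) b : D X -> pointed k X b ->
  exists X', D X' /\ pointed k X' 1.
Proof.
have up (m : nat) : forall X b, D X -> b + m%:Z = 1 -> pointed k X b ->
    exists X', D X' /\ pointed k X' 1.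
  elim: m => [|m IHm] Y c DY cm pY; first by exists Y; rewrite -cm addr0.
  apply: (IHm (shift Y) (c + 1)); first exact: c_shift.
    by rewrite -cm; lia.
  by apply/pointed_shift; rewrite addrK.
have down (m : nat) : forall X b, D X -> b = 1 + m%:Z -> pointed k X b ->
    exists X', D X' /\ pointed k X' 1.
  elim: m => [|m IHm] Y c DY cm pY; first by exists Y; rewrite cm addr0 in pY *.
  apply: (IHm (unshift Y) (c - 1)); first exact: c_unshift.
    by rewrite cm; lia.
  apply/pointed_shift; have [f [g [gf fg]]] := unshift_iso Y.
  exact: pointed_iso gf fg pY.
move=> DX pX; have [b1|b1] := leP b 1.
  by apply: (up (absz (1 - b)%R) X b) => //; lia.
by apply: (down (absz (b - 1)%R) X b) => //; lia.
Qed.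

End LocalIdempotent.

Section ChainRetracts.
Variable R : comPzRingType.
Implicit Types (A B X Y : complex R) (C D : complex R -> Prop).

(** Summands are taken as strict retracts of complexes; those that occur later, from [alpha] and
    [beta] or from a cell, are of this kind. *)
Definition thick D : Prop := closed23 D /\
  forall A B (i : chain_map A B) (p : chain_map B A),
    (forall n x, p n (i n x) = x) -> D B -> D A.

End ChainRetracts.

Section MayerVietoris.
Variables (R : comPzRingType) (J : R -> Prop) (e : R).
Hypotheses (idealJ : is_ideal J) (ee : e * e = e).

Section Square.
Variables (X Q : complex R) (u : X 0) (r : Q 0).
Hypotheses (du : cdiff X 0 u = 0) (dr : cdiff Q 0 r = 0).

Fact square_linear n : linear (fun z : dsum X Q n =>
  insr X dr n z.1 - insl Q du n z.2 : tens X Q n).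
Proof.
move=> a [x y] [x' y'].
rewrite -[LHS]/(insr X dr n (a *: x + x') - insl Q du n (a *: y + y')).
by rewrite (linearP (insr X dr n)) (linearP (insl Q du n)) scalerBr opprD addrACA.
Qed.

Fact square_diff n z : cdiff (tens X Q) n (mklinear (@square_linear n) z) =
  mklinear (@square_linear (n - 1)) (cdiff (dsum X Q) n z).
Proof. by rewrite linearB !cmap_diff. Qed.

Definition square : chain_map (dsum X Q) (tens X Q) :=
  @ChainMap _ (dsum X Q) (tens X Q) (fun n => mklinear (@square_linear n))
    square_diff.

End Square.

(* The homotopy fibre of X + Q -> X (x) Q, for the pointings u and r, is the
   cofibre of I (x) I' -> R, where I and I' are the fibres of R -> X and
   R -> Q: this is why the powers of J add up. *)
Lemma pointed_mul k (X Q : complex R) : pointed J e 1 X 1 -> pointed J e k Q 1 ->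
  exists (u : X 0) (r : Q 0) (du : cdiff X 0 u = 0) (dr : cdiff Q 0 r = 0),
    pointed J e k.+1 (cone (square du dr)) 2.
Proof.
move=> [u [eps [du eu pe]]] [r [rho [dr er pr]]].
exists u, r, du, dr.
(* [sigma] is [eps] tensored with [rho d]. On the boundary of a pure tensor of x and y it is eps (d
   x) rho (d y), which lies in J J^k. *)
have [sigma sigmaE] : {f : {linear tens X Q 1 -> R^o} |
    forall i j (x : X i) (y : Q j), i + j = 1 -> f (tpt idfun 1 x y) =
      (eps (tr X i 0 x) : R) * rho (cdiff Q 1 (tr Q j 1 y))}.
  apply: (@tens_lift R R idfun X Q 1 R^o
    (fun i j x y => (eps (tr X i 0 x) : R) * rho (cdiff Q 1 (tr Q j 1 y)) : R^o)).
  - by move=> i j v v' w; rewrite !linearD mulrDl.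
  - move=> i j v a w w'; rewrite !linearP /= mulrDr; congr (_ + _).
    by rewrite /GRing.scale /= mulrCA.
  - by move=> i j a v w; rewrite [tr X i 0 _]linearZZ [eps _]linearZZ /GRing.scale /= mulrA.
(* Since [eps u = e], subtracting [sigma] cancels what [rho] contributes on the boundaries that come
   from [Q]. *)
pose rho' (z : cone (square du dr) (2 - 1)) : R^o :=
  e * (rho z.1.2 : R) - sigma z.2.
have l : linear rho'.
  move=> a [[x q] w] [[x' q'] w']; rewrite /rho' /= (linearP rho) (linearP sigma) /=.
  by rewrite mulrDr opprD addrACA scalerBr /GRing.scale /= [e * (a * _)]mulrCA.
exists ((u, r), 0), (mklinear l); split.
- have d0 : cdiff (dsum X Q) 0 (u, r) = 0 by congr (_, _).
  have s0 : square du dr 0 (u, r) = 0 by exact: subrr.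
  congr (_, _); first exact: (etrans (congr1 -%R d0) (oppr0 _)).
  exact: (etrans (congr2 +%R s0 (linear0 (cdiff (tens X Q) 1))) (addr0 _)).
- by rewrite /= /rho' /= er linear0 subr0 ee.
move=> [[x q] w].
suff -> : mklinear l (cdiff (cone (square du dr)) 2 ((x, q), w)) =
    - sigma (cdiff (tens X Q) 2 w).
  refine (pwN _).
  move: w; apply: tens_ind => [|v w ev ew|i j v w ij].
  - rewrite !linear0; exact (pw0 J k.+1).
  - rewrite !linearD; exact (pwD ev ew).
  rewrite tpt_diff linearD linearZZ; refine (pwD _ _).
    rewrite sigmaE; last by rewrite addrAC ij.
    have [i1|ni] := eqVneq i 1; last first.
      rewrite [tr X _ _ _]tr_neq ?linear0 ?mul0r.
        exact (pw0 J k.+1).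
      by move=> i0; move/eqP: ni; apply; rewrite -[i](subrK 1) i0.
    subst i; rewrite trii; exact (pwS ((pw1 idealJ _).1 (pe v)) (pr _)).
  rewrite sigmaE; last by rewrite addrA ij.
  rewrite -[tr Q (j - 1) 1 _](@tr_diff R Q j 2 w) (@cdiffK R Q 2).
  rewrite linear0 mulr0; exact (pwM _ (pw0 J k.+1)).
rewrite -[LHS]/(e * (rho (- cdiff Q 1 q) : R) -
  sigma (tpt idfun 1 x r - tpt idfun 1 u q + cdiff (tens X Q) 2 w)).
rewrite linearD linearB !sigmaE ?trii //.
rewrite [tr Q _ _ r]tr_neq // (linear0 (cdiff Q 1)) (linear0 rho) mulr0 sub0r eu.
by rewrite (linearN rho) mulrN opprD opprK addrA addNr add0r.
Qed.

Variables (D : complex R -> Prop).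
Hypotheses (D23 : closed23 D).
Hypothesis Dtens : forall X Y, D X -> perfect Y -> D (tens X Y).

Lemma pointed_pow (X : complex R) k : D X -> pointed J e 1 X 1 ->
  exists Q, D Q /\ pointed J e k.+1 Q 1.
Proof.
move=> DX pX; elim: k => [|k [Q [DQ pQ]]]; first by exists X.
have [u [r [du [dr pC]]]] := pointed_mul pX pQ.
apply: (pointed_recenter D23) pC; apply: (c_cone D23).
  exact: c_dsum.
by apply: Dtens => //; exact: c_perfect DQ.
Qed.

Variables (N : lmodType R) (nu : N) (lambda : {linear N -> R^o}).
Hypothesis idN : idem_module e nu lambda.
Hypothesis Dthick : thick D.

(** As J^k e = 0, the degreewise retraction of the cell is a chain map. *)
Lemma pointed_retract k (Q : complex R) : (forall x, pw J k x -> x * e = 0) ->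
  D Q -> pointed J e k Q 1 -> D (in_degree0 N).
Proof.
move=> nil DQ [u [eps [du eu pe]]].
have [_ retr] := Dthick.
have ci := cell_retr_diff idN (fun x => nil _ (pe x)).
exact: (retr _ _ (cell lambda du) (ChainMap ci) (cell_retrK idN du eu)) DQ.
Qed.

End MayerVietoris.

(** * Thick closures *)

Section MoreSes.
Variable R : comPzRingType.
Implicit Types (A B D X Y : complex R).

Lemma ses_dsum2 A B D A' B' D' : ses A B D -> ses A' B' D' ->
  ses (dsum A A') (dsum B B') (dsum D D').
Proof.
move=> [i [p [r [s [ri ps e]]]]] [i' [p' [r' [s' [ri' ps' e']]]]].
have l (U V U' V' : lmodType R) (f : {linear U -> V}) (f' : {linear U' -> V'}) :
    linear (fun z : (U * U')%type => (f z.1, f' z.2) : (V * V')%type).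
  by move=> a [x y] [x' y']; rewrite /= !linearP.
have ci n z : cdiff (dsum B B') n (mklinear (l _ _ _ _ (i n) (i' n)) z) =
    mklinear (l _ _ _ _ (i (n - 1)) (i' (n - 1))) (cdiff (dsum A A') n z).
  by congr (_, _); rewrite /= cmap_diff.
have cp n z : cdiff (dsum D D') n (mklinear (l _ _ _ _ (p n) (p' n)) z) =
    mklinear (l _ _ _ _ (p (n - 1)) (p' (n - 1))) (cdiff (dsum B B') n z).
  by congr (_, _); rewrite /= cmap_diff.
exists (@ChainMap _ (dsum A A') (dsum B B') _ ci),
  (@ChainMap _ (dsum B B') (dsum D D') _ cp),
  (fun n => mklinear (l _ _ _ _ (r n) (r' n))),
  (fun n => mklinear (l _ _ _ _ (s n) (s' n))).
split=> n [x y]; congr (_, _); rewrite /= ?ri ?ri' ?ps ?ps' //.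
  exact: e.
exact: e'.
Qed.

Lemma ses_shift A B D : ses A B D -> ses (shift A) (shift B) (shift D).
Proof.
move=> [i [p [r [s [ri ps e]]]]].
have c X Y (f : chain_map X Y) n x : cdiff (shift Y) n (f (n - 1) x) =
    f (n - 1 - 1) (cdiff (shift X) n x).
  by rewrite /= cmap_diff linearN.
exists (@ChainMap _ (shift A) (shift B) (fun n => i (n - 1)) (c _ _ i)),
  (@ChainMap _ (shift B) (shift D) (fun n => p (n - 1)) (c _ _ p)),
  (fun n => r (n - 1)), (fun n => s (n - 1)).
by split=> n x; [exact: ri|exact: ps|exact: e].
Qed.

(** The homotopy sends a pure tensor of x in degree i and z to (-1)^i times that of x and h z; with
    this sign the terms in d x cancel. *)
Lemma tens_contractible X Z : contractible Z -> contractible (tens X Z).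
Proof.
move=> [h hP].
have trh j k k' (w : Z j) : k = k' ->
    tr Z k k' (h k (tr Z j (k - 1) w)) = h k' (tr Z j (k' - 1) w).
  by move=> e; case: k' / e; rewrite trii.
have K n : {f : {linear tens X Z (n - 1) -> tens X Z n} |
    forall i j (x : X i) (z : Z j), i + j = n - 1 ->
    f (tpt idfun (n - 1) x z) =
      (-1) ^+ `|i|%N *: tpt idfun n x (h (j + 1) (tr Z j (j + 1 - 1) z))}.
  apply: (@tens_lift R R idfun X Z (n - 1) (tens X Z n) (fun i j x z =>
    (-1) ^+ `|i|%N *: tpt idfun n x (h (j + 1) (tr Z j (j + 1 - 1) z)))).
  - by move=> i j u u' v; rewrite tptDl scalerDr.
  - by move=> i j u a v v'; rewrite !linearP tptDr tptZr scalerDr !scalerA mulrC.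
  - by move=> i j a u v; rewrite tptZl !scalerA mulrC.
exists (fun n => sval (K n)) => n.
apply: tens_ind => [|x y ex ey|i j x z ij].
- by rewrite !linear0 addr0.
- by rewrite !linearD addrACA ex ey.
have KE m := svalP (K m).
have ij1 : i - 1 + j = n - 1 - 1 by rewrite addrAC ij.
have ij2 : i + (j - 1) = n - 1 - 1 by rewrite addrA ij.
rewrite (KE n _ _ x z ij) tpt_diff [sval (K (n - 1)) _]linearD.
rewrite [sval (K (n - 1)) (_ *: _)]linearZZ.
rewrite (KE (n - 1) _ _ (cdiff X i x) z ij1) (KE (n - 1) _ _ x (cdiff Z j z) ij2).
rewrite [cdiff (tens X Z) n (_ *: _)]linearZZ tpt_diff.
rewrite scalerDr !scalerA -expr2 -exprM mulnC exprM sqrrN expr1n expr1n scale1r.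
have := sign_pred R i => ->.
rewrite scaleNr addrACA subrr add0r.
have -> : tpt idfun (n - 1) x (cdiff Z (j + 1) (h (j + 1) (tr Z j (j + 1 - 1) z))) =
    tpt idfun (n - 1) x (tr Z _ j (cdiff Z (j + 1) (h (j + 1) (tr Z j (j + 1 - 1) z)))).
  by rewrite tpt_trr ?addrK.
have -> : h (j - 1 + 1) (tr Z (j - 1) (j - 1 + 1 - 1) (cdiff Z j z)) =
    tr Z (j + 1 - 1) (j - 1 + 1) (h (j + 1 - 1) (tr Z (j - 1) (j + 1 - 1 - 1) (cdiff Z j z))).
  by rewrite trh //; lia.
rewrite [tpt idfun (n - 1) x (tr Z (j + 1 - 1) (j - 1 + 1) _)]tpt_trr; last by lia.
rewrite -[tpt idfun (n - 1) x (h (j + 1 - 1) _)](tpt_trr _ _ _ _ (j' := j)); last by rewrite addrK.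
by rewrite scale1r -tptDr -linearD -tr_diff hP tr_comp ?trii // addrK.
Qed.

End MoreSes.

Section ThickClosure.
Variables (R : comPzRingType) (C : complex R -> Prop).
Hypothesis C23 : closed23 C.

(** This is equivalent to being a summand of an object of [C] but names the complement;
    [retract_split] is the direction that is not immediate. *)
Definition thick_closure (X : complex R) : Prop := C (dsum X (shift X)).

(** The idempotent [q = 1 - i p] of [U] is 0 on A and the identity on its complement, so its cone is
    A + shift A plus a contractible complex. *)
Lemma retract_split (A U : complex R) (i : chain_map A U) (p : chain_map U A) :
  (forall n x, p n (i n x) = x) -> C U -> thick_closure A.
Proof.
move=> pi CU.
have c n x : cdiff U n ((idfun \- linC (i n) (p n)) x) =
    (idfun \- linC (i (n - 1)) (p (n - 1))) (cdiff U n x).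
  by rewrite /= linearB !cmap_diff.
pose q : chain_map U U := @ChainMap _ U U (fun n => idfun \- linC (i n) (p n)) c.
have qE n x : q n x = x - i n (p n x) by [].
have qi n x : q n (i n x) = 0 by rewrite qE pi subrr.
have qq n x : q n (q n x) = q n x.
  by rewrite -[in RHS](subr0 (q n x)) -(qi n (p n x)) -linearB.
have l n : linear (fun z : dsum A (shift A) n => (i _ z.2, i _ z.1) : cone q n).
  by move=> a [x y] [x' y']; rewrite /= !linearP.
have lr n : linear (fun z : cone q n => (p _ z.2, p _ z.1) : dsum A (shift A) n).
  by move=> a [x y] [x' y']; rewrite /= !linearP.
have cj n z : cdiff (cone q) n (mklinear (l n) z) =
    mklinear (l (n - 1)) (cdiff (dsum A (shift A)) n z).
  case: z => x y; congr (_, _).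
    by rewrite /= cmap_diff linearN.
  rewrite -[LHS]/(q (n - 1) (i (n - 1) y) + cdiff U n (i n x)).
  by rewrite qi add0r cmap_diff.
pose j := @ChainMap _ (dsum A (shift A)) (cone q) _ cj.
have rj n x : mklinear (lr n) (j n x) = x by case: x => x y; congr (_, _); exact: pi.
have S := ses_coker rj.
have CK : C (cone q) by exact: c_cone.
apply: (c_sub C23 S) => //; apply: (c_contr C23).
  exact: ses_perfect_quo S (c_perfect C23 CK).
apply: acyclic_contractible; first exact: ses_perfect_quo S (c_perfect C23 CK).
move=> n z; have [[x y] <-] := qproj_surj z.
rewrite [cdiff _ _ _]coker_diffE => /qproj_eq0 [[a a'] /= [e1 e2]].
(* On the complement [q] is the identity, and this is the usual contraction of the cone of an
   identity. *)
exists (qproj (coker_sub j n) (q _ y, 0)).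
rewrite -[LHS]/(coker_diff j n (qproj _ (q _ y, 0))) coker_diffE; apply/qprojP.
exists (- p _ y, - p _ x); congr (_, _).
  rewrite /= linearN.
  have -> : cdiff U (n - 1) (q (n - 1) y) = - q (n - 1 - 1) x.
    rewrite cmap_diff; apply/eqP; rewrite -addr_eq0; apply/eqP.
    have := congr1 (q (n - 1 - 1)) e2.
    by rewrite qi linearD => <-; rewrite -[q _ x]qq [RHS]addrC.
  by rewrite opprK qE; exact: subKN.
rewrite -[LHS]/(q (n - 1) (q (n - 1) y) + cdiff U n 0 - y).
by rewrite qq linear0 addr0 qE /= linearN; exact: subKN.
Qed.

(** Two-out-of-three holds because passing from A to A + shift A preserves [ses]. A retract of B is
    also a retract of B + shift B, and [retract_split] applies. *)
Lemma thick_closure_thick : thick thick_closure.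
Proof.
have S2 A B D : ses A B D -> ses (dsum A (shift A)) (dsum B (shift B)) (dsum D (shift D)).
  by move=> S; apply: ses_dsum2 => //; exact: ses_shift.
split; first split.
- by move=> X /(c_perfect C23); exact: ses_perfect_sub (ses_dsum _ _).
- move=> X pX cX; have CX := c_contr C23 pX cX.
  by apply: c_dsum => //; exact: c_shift.
- by move=> A B D /S2 S; exact: (c_sub C23 S).
- by move=> A B D /S2 S; exact: (c_mid C23 S).
- by move=> A B D /S2 S; exact: (c_quo C23 S).
move=> A B i p pi CB.
have l1 n : linear (fun x : A n => (i n x, 0) : dsum B (shift B) n).
  by move=> a x y; congr (_, _); rewrite /= ?linearP ?scaler0 ?addr0.
have l2 n : linear (fun z : dsum B (shift B) n => p n z.1 : A n).
  by move=> a [x y] [x' y']; rewrite /= linearP.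
have c1 n x : cdiff (dsum B (shift B)) n (mklinear (l1 n) x) =
    mklinear (l1 (n - 1)) (cdiff A n x).
  by congr (_, _); rewrite /= ?cmap_diff // linear0 oppr0.
have c2 n z : cdiff A n (mklinear (l2 n) z) =
    mklinear (l2 (n - 1)) (cdiff (dsum B (shift B)) n z).
  by rewrite /= cmap_diff.
exact: (retract_split (i := ChainMap c1) (p := ChainMap c2) pi CB).
Qed.

Lemma thick_closure_sub X : C X -> thick_closure X.
Proof. by move=> CX; apply: c_dsum => //; exact: c_shift. Qed.

End ThickClosure.

(** * Generation and thick ideals *)

(** Re is realized as the quotient of R by the annihilator of [e], with multiplication by [e] as its
    inclusion in R. *)
Lemma idem_module_exists (R : comPzRingType) (e : R) : e * e = e ->
  exists (N : lmodType R) (nu : N) (lambda : {linear N -> R^o}),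
    idem_module e nu lambda.
Proof.
move=> ee.
have W0 : e * 0 = 0 by rewrite mulr0.
have WP (a : R) (x y : R^o) : e * (x : R) = 0 -> e * (y : R) = 0 ->
    e * (a *: x + y : R) = 0.
  by move=> ex ey; rewrite /GRing.scale /= mulrDr mulrCA ex mulr0 ey addr0.
pose W : submod R^o := @SubMod _ R^o (fun r => e * (r : R) = 0) W0 WP.
have l : linear (fun r : R^o => e * (r : R) : R^o).
  by move=> a x y; rewrite /GRing.scale /= mulrDr mulrCA.
have wl x : W x -> mklinear l x = 0 by [].
exists (quot W), (qproj W (1 : R)), (qlift wl); split.
  by rewrite qliftE /= mulr1.
move=> y; have [r <-] := qproj_surj y.
rewrite qliftE -linearZ; apply/qprojP.
by rewrite /= /GRing.scale /= mulr1 mulrBr mulrA ee subrr.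
Qed.

(** What the argument needs of the decomposition of R: [J i] will be the preimage of the maximal
    ideal of R_i, [e i] the idempotent of that factor and [N i] the localization. *)
Record local_family (R : comPzRingType) (n : nat) (J : 'I_n -> R -> Prop)
  (e : 'I_n -> R) (N : 'I_n -> lmodType R) (nu : forall i, N i)
  (lambda : forall i, {linear N i -> R^o}) : Prop := LocalFamily {
  lf_ideal : forall i, is_ideal (J i);
  lf_proper : forall i, ~ J i 1;
  lf_orth : forall i j, i != j -> e i * e j = 0;
  lf_sum : \sum_i e i = 1;
  lf_compl : forall i, J i (1 - e i);
  lf_unit : forall i r, ~ J i r -> exists w, w * r * e i = e i;
  lf_nil : forall i, exists m, forall x, pw (J i) m x -> x * e i = 0;
  lf_module : forall i, idem_module (e i) (nu i) (lambda i)
}.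

Section Generation.
Variables (R : comPzRingType) (n : nat) (J : 'I_n -> R -> Prop) (e : 'I_n -> R).
Variables (N : 'I_n -> lmodType R) (nu : forall i, N i).
Variables (lambda : forall i, {linear N i -> R^o}).
Hypothesis LF : local_family J e nu lambda.

Let ee i : e i * e i = e i := idem_idem (lf_module LF i).

Lemma lf_split (M : lmodType R) (x : M) : x = \sum_i e i *: x.
Proof. by rewrite -scaler_suml (lf_sum LF) scale1r. Qed.

Lemma lf_other i j : i != j -> J j (e i).
Proof.
move=> ij; have [_ _ JM] := lf_ideal LF j.
have -> : e i = e i * (1 - e j) by rewrite mulrBr mulr1 (lf_orth LF ij) subr0.
exact: JM (lf_compl LF j).
Qed.

(** Each functional lives on one factor of R, so that a value outside [J i] can be inverted
    there. *)
Definition homogeneous (M : lmodType R) (s : seq ({linear M -> R^o} * M)) :=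
  forall q, List.In q s -> exists i, forall x, e i * (q.1 x : R) = q.1 x.

Lemma homogeneous_basis (M : lmodType R) : fproj M ->
  exists s, @dual_basis R M s /\ homogeneous s.
Proof.
move=> [s sP].
pose c i (q : {linear M -> R^o} * M) : {linear M -> R^o} := e i \*: q.1.
exists (flatten [seq [seq (c i q, q.2) | q <- s] | i <- enum 'I_n]); split.
  move=> x; rewrite big_flatten big_map big_enum {1}[x]lf_split.
  apply: eq_bigr => i _; rewrite big_map {1}[x]sP scaler_sumr.
  by apply: eq_bigr => q _; rewrite /= scalerA.
move=> q; elim: (enum 'I_n) => [|i r IHr] //= qir.
case: (List.in_app_or _ _ _ qir) => [|/IHr //].
elim: s {sP IHr qir} => [|p s IHs] //= [<-|/IHs //]; exists i => x.
by rewrite /= /GRing.scale /= mulrA ee.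
Qed.

(** The hypothesis gives M = J_i M for every i, and J_i is nilpotent on the factor i. Hence a
    nonzero M has an entry [p.1 q.2] that can serve as a pivot. *)
Lemma nil_dual_basis (M : lmodType R) s : @dual_basis R M s ->
  (forall i p q, List.In p s -> List.In q s -> J i (p.1 q.2)) ->
  forall x : M, x = 0.
Proof.
move=> sP sJ x; rewrite [x]lf_split big1 // => i _.
have sum_in (W : submod M) (t : seq ({linear M -> R^o} * M)) (c : {linear M -> R^o} * M -> R) :
    (forall q, List.In q t -> W (c q *: q.2)) -> W (\sum_(q <- t) c q *: q.2).
  elim: t => [_|q t IHt tW]; first by rewrite big_nil; exact: sm0.
  rewrite big_cons; apply: smD; first by apply: tW; left.
  by apply: IHt => p pt; apply: tW; right.
have H m : forall (W : submod M), (forall a y, pw (J i) m a -> W (a *: y)) ->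
    forall y, W y.
  elim: m => [|m IHm] W Wm y; first by rewrite -[y]scale1r; exact: Wm.
  rewrite [y]sP; apply: (sum_in) => q qs; apply: smZ.
  rewrite [q.2]sP; apply: (sum_in) => p ps.
  set r : R := p.1 q.2.
  have W20 : W (r *: 0) by rewrite scaler0; exact: sm0.
  have W2P (c : R) u v : W (r *: u) -> W (r *: v) -> W (r *: (c *: u + v)).
    by move=> Wu Wv; rewrite scalerDr scalerA mulrC -scalerA; exact: smP.
  refine (IHm (@SubMod R M (fun z => W (r *: z)) W20 W2P) _ p.2) => a z pa /=.
  by rewrite scalerA; apply: Wm; apply: pwS => //; exact: sJ.
have [m nilm] := lf_nil LF i.
have W0 : e i *: (0 : M) = 0 by rewrite scaler0.
have WP (a : R) (u v : M) : e i *: u = 0 -> e i *: v = 0 -> e i *: (a *: u + v) = 0.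
  by move=> eu ev; rewrite scalerDr scalerA mulrC -scalerA eu ev scaler0 addr0.
refine (H m (@SubMod _ _ (fun z => e i *: z = 0) W0 WP) _ x) => a y pa /=.
by rewrite scalerA mulrC nilm // scale0r.
Qed.

Variable C : complex R -> Prop.
Hypothesis C23 : closed23 C.
Hypothesis CN : forall i, C (in_degree0 (N i)).

Lemma c_of_unshift (X : complex R) : C (unshift X) -> C X.
Proof.
move=> CU; have [f [g [gf fg]]] := unshift_iso X.
have S : ses X (shift (unshift X)) (zeroc R).
  exists f, (chain_zero _ (zeroc R)), g, (fun=> \0); split=> // [k y|k z].
    by rewrite [LHS]rV0 [RHS]rV0.
  by rewrite fg addr0.
apply: (c_sub C23 S); first exact: c_shift.
by apply: (c_zero C23) => i x; exact: rV0.
Qed.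

(** Induction on the width, then on the size of a homogeneous dual basis of the lowest term [X 0]: a
    pivot splits off a cell, and once [X 0] vanishes the complex is shifted down. *)
Lemma generation_nonneg w : forall X, perfect X ->
  (forall i : int, i < 0 \/ w%:Z <= i -> forall x : X i, x = 0) -> C X.
Proof.
elim: w => [|w IHw] X pX zX.
  by apply: (c_zero C23) => i x; apply: zX; lia.
have /perfectE [_ fX] := pX; have [s [sP hs]] := homogeneous_basis (fX 0).
move: {2}(size s) (leqnn (size s)) => d.
elim: d X pX zX fX s sP hs => [|d IHd] X pX zX fX s sP hs sd.
  apply: c_of_unshift; apply: IHw; first exact: unshift_perfect.
  have X0 (x : X 0) : x = 0 by rewrite [x]sP; case: s sd {sP hs} => //; rewrite big_nil.
  move=> i iw x; have [i1|ni] := pselect (i + 1 = 0); last by apply: zX; lia.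
  by move: x; rewrite /= i1.
have [[[[i p] q] /= [ps qs nJ]]|no] := pselect (exists ipq : 'I_n * _ * _,
    [/\ List.In ipq.1.2 s, List.In ipq.2 s & ~ J ipq.1.1 (ipq.1.2.1 ipq.2.2)]); last first.
  have X0 : forall x : X 0, x = 0.
    apply: (nil_dual_basis sP) => i p q ps qs; apply: contrapT => nJ.
    by apply: no; exists (i, p, q).
  apply: c_of_unshift; apply: IHw; first exact: unshift_perfect.
  move=> i iw x; have [i1|ni] := pselect (i + 1 = 0); last by apply: zX; lia.
  by move: x; rewrite /= i1.
have [c cE] := hs p ps.
have eci : c = i.
  apply: contrapT => /eqP ci; apply: nJ; rewrite -cE mulrC.
  by have [_ _ JM] := lf_ideal LF i; exact: JM (lf_other ci).
subst c; have [w0 wE] := lf_unit LF nJ.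
have [s1 [s2 es']] := List.in_split _ _ ps.
have es : s = (s1 ++ p :: s2)%SEQ := es'.
(* [v] is the multiple of [q.2] obtained by inverting the pivot on the factor [i]. *)
have [v [fv ev]] : exists v : X 0, (p.1 v : R) = e i /\ e i *: v = v.
  exists ((w0 * e i) *: q.2); split.
    rewrite linearZ /= /GRing.scale /= -cE -[RHS]wE.
    by rewrite mulrA -[w0 * e i * e i]mulrA ee mulrAC.
  by rewrite scalerA mulrC -mulrA ee.
have Xneg (x : X (0 - 1)) : x = 0 by apply: zX; left.
have dv : cdiff X 0 v = 0 by exact: Xneg.
pose cl := cell (lambda i) dv.
have S := ses_coker (cell_retrK (lf_module LF i) dv fv).
apply: (c_mid C23 S) => //.
pose K := coker cl.
have pK : perfect K by exact: ses_perfect_quo S pX.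
(* With this correction every functional vanishes on the cell, so the dual basis without [p]
   descends to the cokernel. *)
have kl (c : {linear X 0 -> R^o}) : linear (fun x : X 0 => c x - (p.1 x : R) *: c v).
  move=> a x y; rewrite !linearP /= scalerBr scalerDl opprD addrACA.
  by rewrite -scalerA.
have kw (c : {linear X 0 -> R^o}) x : coker_sub cl 0 x -> mklinear (kl c) x = 0.
  move=> [a ->] /=; rewrite trii; set a' : R := lambda _ _.
  apply/eqP; rewrite subr_eq0 [p.1 _]linearZ [c (_ *: _)]linearZ /= fv.
  by rewrite -[a' *: (e i : R^o)]/(a' * e i : R) -scalerA -[e i *: c v]linearZ ev.
pose s' : seq ({linear K 0 -> R^o} * K 0) :=
  [seq (qlift (kw q'.1), qproj (coker_sub cl 0) q'.2) | q' <- s1 ++ s2].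
apply: (IHd K pK _ _ s').
- move=> j jw z; have [x <-] := qproj_surj z.
  by rewrite (zX j jw x) linear0.
- by have /perfectE [] := pK.
- move=> z; have [x <-] := qproj_surj z.
  (* [y] has the same class as [x] modulo the cell, and the term of [p] drops out of its
     expansion. *)
  rewrite big_map; set y := x - (p.1 x : R) *: v.
  have py : p.1 y = 0.
    rewrite linearB linearZ /= fv /GRing.scale /= -[X in X - _]cE mulrC.
    by rewrite subrr.
  have -> : qproj (coker_sub cl 0) x = qproj (coker_sub cl 0) y.
    apply/qprojP; rewrite opprB addrC subrK.
    exists ((p.1 x : R) *: nu i); rewrite /= !trii.
    have [le _] := lf_module LF i; rewrite [lambda i _]linearZ /= le.
    by rewrite -[_ *: (e i : R^o)]/((p.1 x : R) * e i) -scalerA ev.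
  have yE : y = \sum_(q' <- s1) q'.1 y *: q'.2 + \sum_(q' <- s2) q'.1 y *: q'.2.
    by rewrite {1}[y]sP es big_cat big_cons /= py scale0r add0r.
  have E (t : seq ({linear X 0 -> R^o} * X 0)) : \sum_(q' <- t) qproj (coker_sub cl 0) (q'.1 y *: q'.2) =
      \sum_(q' <- t) qlift (kw q'.1) (qproj (coker_sub cl 0) y) *:
         qproj (coker_sub cl 0) q'.2.
    apply: eq_bigr => q' _; rewrite linearZ qliftE /=; congr (_ *: _).
    by rewrite py scale0r subr0.
  by rewrite {1}yE linearD !linear_sum big_cat !E.
- move=> q' /List.in_map_iff [q0 [<- q0s]].
  have [|j jE] := hs q0.
    by rewrite es; case: (List.in_app_or _ _ _ q0s) => H;
      apply: List.in_or_app; [left|right; right].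
  exists j => z; have [x <-] := qproj_surj z.
  have /= E := qliftE (kw q0.1) x; rewrite /= E.
  rewrite mulrBr jE; congr (_ - _).
  by rewrite /GRing.scale /= mulrCA jE.
rewrite size_map size_cat; move: sd; rewrite es size_cat /=; lia.
Qed.

Lemma generation X : perfect X -> C X.
Proof.
move=> pX; have /perfectE [[b bX] _] := pX.
have H (a : nat) : forall w X, perfect X ->
    (forall i : int, i < - a%:Z \/ w%:Z <= i -> forall x : X i, x = 0) -> C X.
  elim: a => [|a IHa] w Y pY zY; first exact: generation_nonneg zY.
  apply: (c_shiftK C23 pY); apply: (IHa w.+1); first exact: perfect_shift.
  move=> i iw x; apply: zY; lia.
apply: (H b b.+1) => // i ib x; apply: bX; lia.
Qed.

End Generation.

Section ThickIdeals.
Variables (R : comPzRingType) (n : nat) (J : 'I_n -> R -> Prop) (e : 'I_n -> R).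
Variables (N : 'I_n -> lmodType R) (nu : forall i, N i).
Variables (lambda : forall i, {linear N i -> R^o}).
Hypothesis LF : local_family J e nu lambda.

Let N0 i := in_degree0 (N i).

Lemma closed23_tens_r (C : complex R -> Prop) X : closed23 C -> perfect X ->
  closed23 (fun Y => perfect Y /\ C (tens X Y)).
Proof.
move=> C23 pX; split.
- by move=> Y [].
- move=> Z pZ cZ; split=> //; apply: (c_contr C23); first exact: perfect_tens.
  exact: tens_contractible.
- move=> A B D S [pB CB] [pD CD]; split; first exact: ses_perfect_sub S pB.
  exact: (c_sub C23 (ses_tens_r _ X S)).
- move=> A B D S [pA CA] [pD CD]; split; first exact: ses_perfect_mid S pA pD.
  exact: (c_mid C23 (ses_tens_r _ X S)).
- move=> A B D S [pA CA] [pB CB]; split; first exact: ses_perfect_quo S pB.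
  exact: (c_quo C23 (ses_tens_r _ X S)).
Qed.

(** For fixed X the admissible Y satisfy two-out-of-three, and X (x) N_i is the retract e_i X of X;
    so a thick subcategory is an ideal. *)
Lemma thick_tens (D : complex R -> Prop) X Y : thick D -> D X -> perfect Y ->
  D (tens X Y).
Proof.
move=> [D23 retr] DX pY; have pX := c_perfect D23 DX.
suff [] : perfect Y /\ D (tens X Y) by [].
apply: (generation LF (closed23_tens_r D23 pX)) pY => i; split.
  exact: idem_perfect (lf_module LF i).
exact: (retr _ _ _ _ (alpha_beta (lf_module LF i) (X := X))) DX.
Qed.

(* The local step of the Hopkins-Neeman classification of thick subcategories. *)
Lemma thick_cell (D : complex R -> Prop) X i b : thick D -> D X ->
  ~ e_exact X (e i) b -> D (N0 i).
Proof.
move=> tD DX nb; have [D23 _] := tD.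
have iJ := lf_ideal LF i; have ee := idem_idem (lf_module LF i).
have [b' [nb' low]] := not_e_exact_min (c_perfect D23 DX) nb.
have pX := pointed_start iJ (@lf_proper _ _ _ _ _ _ _ LF i) ee (lf_compl LF i)
  (@lf_unit _ _ _ _ _ _ _ LF i) (lf_nil LF i) (c_perfect D23 DX) nb' low.
have [X' [DX' pX']] := pointed_recenter D23 DX pX.
have [k nilk] : exists k, forall x, pw (J i) k.+1 x -> x * e i = 0.
  by case: (lf_nil LF i) => -[|k] nilk; [exists 0%N => x _; exact: nilk|exists k].
have [Q [DQ pQ]] := pointed_pow iJ ee D23 (fun X Y => @thick_tens D X Y tD) k DX' pX'.
exact: (pointed_retract (lf_module LF i) tD nilk DQ pQ).
Qed.

Variables (P : pred 'I_n) (NS : lmodType R) (nuS : NS) (lambdaS : {linear NS -> R^o}).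
Hypothesis idS : idem_module (\sum_(i | P i) e i) nuS lambdaS.

Let NS0 := in_degree0 NS.

Lemma eS_cell i : (\sum_(j | P j) e j) * e i = if P i then e i else 0.
Proof.
rewrite mulr_suml; case: ifP => Pi.
  rewrite (bigD1 i) //= (idem_idem (lf_module LF i)) big1 ?addr0 // => j /andP [_ ji].
  exact: (lf_orth LF ji).
apply: big1 => j Pj; apply: (lf_orth LF); apply/eqP => ji.
by rewrite -ji Pj in Pi.
Qed.

Lemma closed23_tens_idem (C : complex R -> Prop) : closed23 C ->
  closed23 (fun Y => perfect Y /\ C (tens Y NS0)).
Proof.
move=> C23; split.
- by move=> Y [].
- move=> Z pZ cZ; split=> //.
  have pT := perfect_tens pZ (idem_perfect idS).
  apply: (c_contr C23) => //; apply: (acyclic_contractible pT).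
  apply/(tens_idem_acyclic idS) => i z dz.
  have [y dy] := contractible_acyclic cZ dz.
  by exists ((\sum_(j | P j) e j) *: y); rewrite linearZ dy.
- move=> A B D S [pB CB] [pD CD]; split; first exact: ses_perfect_sub S pB.
  exact: (c_sub C23 (ses_tens_l _ NS0 S)).
- move=> A B D S [pA CA] [pD CD]; split; first exact: ses_perfect_mid S pA pD.
  exact: (c_mid C23 (ses_tens_l _ NS0 S)).
- move=> A B D S [pA CA] [pB CB]; split; first exact: ses_perfect_quo S pB.
  exact: (c_quo C23 (ses_tens_l _ NS0 S)).
Qed.

Lemma cell_fixed i k (z : N0 i k) : e i *: z = z.
Proof.
move: z; rewrite /N0 /in_degree0 /=; case: (k == 0) => z; last by rewrite [LHS]rV0 [RHS]rV0.
have [lnu lK] := lf_module LF i.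
by rewrite -[z]lK scalerA mulrC -scalerA (idem_nu (lf_module LF i)).
Qed.

Lemma cell_tens_contractible i : ~~ P i -> contractible (tens (N0 i) NS0).
Proof.
move=> nP; apply: acyclic_contractible.
  exact: perfect_tens (idem_perfect (lf_module LF i)) (idem_perfect idS).
apply/(tens_idem_acyclic idS) => k z _; exists 0.
by rewrite linear0 -[z]cell_fixed scalerA eS_cell (negbTE nP) scale0r.
Qed.

(** 1 - e_S is the sum of the [e i] outside [P], and exactness for each of these adds up. Thus Y
    agrees with its part on [P] up to a contractible complex. *)
Lemma idem_part_equiv Y : perfect Y ->
  (forall i, ~~ P i -> forall b, e_exact Y (e i) b) ->
  contractible (coker (beta lambdaS Y)).
Proof.
move=> pY exY; apply: acyclic_contractible.
  exact: ses_perfect_quo (ses_beta idS Y) pY.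
apply: (coker_beta_acyclic idS) => b z dz.
have -> : 1 - \sum_(i | P i) e i = \sum_(i | ~~ P i) e i.
  by rewrite -(lf_sum LF) (bigID P) /= addrC addrK.
rewrite scaler_suml; apply: (big_ind (fun u => exists y : Y b, cdiff Y b y = u)) => [|u v [y dy] [y' dy']|i nP].
- by exists 0; rewrite linear0.
- by exists (y + y'); rewrite linearD dy dy'.
by have [y dy] := exY i nP b z dz; exists y.
Qed.

Lemma thick_tens_idem (D : complex R -> Prop) Y : thick D ->
  (forall i, P i -> D (N0 i)) -> perfect Y -> D (tens Y NS0).
Proof.
move=> [D23 retr] DN pY.
suff [] : perfect Y /\ D (tens Y NS0) by [].
apply: (generation LF (closed23_tens_idem D23)) pY => i; split.
  exact: idem_perfect (lf_module LF i).
have [Pi|nP] := boolP (P i).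
  exact: (retr _ _ _ _ (alpha_beta idS (X := N0 i))) (DN i Pi).
apply: (c_contr D23); last exact: cell_tens_contractible.
exact: perfect_tens (idem_perfect (lf_module LF i)) (idem_perfect idS).
Qed.

Lemma supported_tens_idem (D : complex R -> Prop) Y : closed23 D ->
  perfect Y -> (forall i, ~~ P i -> forall b, e_exact Y (e i) b) ->
  D (tens Y NS0) -> D Y.
Proof.
move=> D23 pY exY DYS; apply: (c_mid D23 (ses_beta idS Y) DYS).
apply: (c_contr D23); first exact: ses_perfect_quo (ses_beta idS Y) pY.
exact: idem_part_equiv.
Qed.

End ThickIdeals.

(** * Dense triangulated subcategories and additive invariants *)

Section Isomorphisms.
Variable R : comPzRingType.
Implicit Types X Y Z A B D : complex R.

Definition iso X Y : Prop :=
  exists (f : chain_map X Y) (g : forall n, {linear Y n -> X n}),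
    (forall n x, g n (f n x) = x) /\ (forall n y, f n (g n y) = y).

Lemma iso_sym X Y : iso X Y -> iso Y X.
Proof.
move=> [f [g [gf fg]]].
have c n y : cdiff X n (g n y) = g (n - 1) (cdiff Y n y).
  by rewrite -{2}[y]fg cmap_diff gf.
by exists (ChainMap c), f.
Qed.


Lemma iso_dsumACA A B X Y :
  iso (dsum (dsum A B) (dsum X Y)) (dsum (dsum A X) (dsum B Y)).
Proof.
have l A' B' X' Y' n : linear (fun z : dsum (dsum A' B') (dsum X' Y') n =>
    ((z.1.1, z.2.1), (z.1.2, z.2.2)) : dsum (dsum A' X') (dsum B' Y') n).
  by [].
have c n z : cdiff (dsum (dsum A X) (dsum B Y)) n (mklinear (l A B X Y n) z) =
    mklinear (l A B X Y (n - 1)) (cdiff (dsum (dsum A B) (dsum X Y)) n z).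
  by [].
exists (@ChainMap _ (dsum (dsum A B) (dsum X Y)) (dsum (dsum A X) (dsum B Y)) _ c),
  (fun n => mklinear (l A X B Y n)).
by split=> n [[a b] [x y]].
Qed.

Lemma iso_dsumA A B D : iso (dsum A (dsum B D)) (dsum (dsum A B) D).
Proof.
have l n : linear (fun z : dsum A (dsum B D) n =>
    ((z.1, z.2.1), z.2.2) : dsum (dsum A B) D n) by [].
have l' n : linear (fun z : dsum (dsum A B) D n =>
    (z.1.1, (z.1.2, z.2)) : dsum A (dsum B D) n) by [].
have c n z : cdiff (dsum (dsum A B) D) n (mklinear (l n) z) =
    mklinear (l (n - 1)) (cdiff (dsum A (dsum B D)) n z) by [].
exists (@ChainMap _ (dsum A (dsum B D)) (dsum (dsum A B) D) _ c),
  (fun n => mklinear (l' n)).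
by split=> n; [move=> [a [b d]]|move=> [[a b] d]].
Qed.

Lemma iso_dsumC A B : iso (dsum A B) (dsum B A).
Proof.
have l A' B' n : linear (fun z : dsum A' B' n => (z.2, z.1) : dsum B' A' n) by [].
have c n z : cdiff (dsum B A) n (mklinear (l A B n) z) =
    mklinear (l A B (n - 1)) (cdiff (dsum A B) n z) by [].
exists (@ChainMap _ (dsum A B) (dsum B A) _ c), (fun n => mklinear (l B A n)).
by split=> n [a b].
Qed.

End Isomorphisms.

(* Thomason's argument: modulo a dense triangulated subcategory C, direct sum
   turns the objects into a group on which every distinguished triangle is
   additive.  [eqC] is equality in that group. *)
Section Thomason.
Variables (R : comPzRingType) (C : complex R -> Prop).
Hypothesis C23 : closed23 C.
Implicit Types A B D X Y Z : complex R.

Lemma c_iso_iff X Y : iso X Y -> C X <-> C Y.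
Proof.
move=> XY; split; first by have [f [g [gf fg]]] := XY; exact: c_iso C23 _ _ f g gf fg.
by have [f [g [gf fg]]] := iso_sym XY; exact: c_iso C23 _ _ f g gf fg.
Qed.

Lemma c_cancel A B : C B -> C (dsum A B) -> C A.
Proof. by move=> CB CAB; exact: (c_sub C23 (ses_dsum A B)). Qed.

Lemma c_cancel_iff A B : C B -> C (dsum A B) <-> C A.
Proof.
by move=> CB; split=> [|CA]; [exact: c_cancel|exact: c_dsum].
Qed.

Definition eqC A B : Prop :=
  forall Z, perfect Z -> C (dsum Z A) <-> C (dsum Z B).

Lemma eqC_sym A B : eqC A B -> eqC B A.
Proof. by move=> AB Z pZ; split=> /(AB Z pZ). Qed.
Lemma eqC_trans B A D : eqC A B -> eqC B D -> eqC A D.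
Proof. by move=> AB BD Z pZ; rewrite (AB Z pZ); exact: BD. Qed.

Lemma eqC_in A B : C A -> C B -> eqC A B.
Proof. by move=> CA CB Z _; rewrite !c_cancel_iff. Qed.

Lemma c_zeroc : C (zeroc R).
Proof. by apply: (c_zero C23) => i x; exact: rV0. Qed.

Lemma perfect_zeroc : perfect (zeroc R). Proof. exact: (c_perfect C23 c_zeroc). Qed.

Lemma eqC_C A B : eqC A B -> C A <-> C B.
Proof.
move=> AB; have := AB _ perfect_zeroc.
rewrite (c_iso_iff (iso_dsumC _ A)) (c_iso_iff (iso_dsumC _ B)).
by rewrite !(c_cancel_iff _ c_zeroc).
Qed.

Lemma iso_dsum_r Z A B : iso A B -> iso (dsum Z A) (dsum Z B).
Proof.
move=> [f [g [gf fg]]].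
have l (U V : complex R) n (h : {linear U n -> V n}) :
    linear (fun z : dsum Z U n => (z.1, h z.2) : dsum Z V n).
  by move=> a [x y] [x' y']; rewrite /= linearP.
have c n z : cdiff (dsum Z B) n (mklinear (l A B n (f n)) z) =
    mklinear (l A B (n - 1) (f (n - 1))) (cdiff (dsum Z A) n z).
  by congr (_, _); rewrite /= cmap_diff.
exists (@ChainMap _ (dsum Z A) (dsum Z B) _ c), (fun n => mklinear (l B A n (g n))).
by split=> n [x y]; congr (_, _); rewrite /= ?gf ?fg.
Qed.

Lemma eqC_iso A B : iso A B -> eqC A B.
Proof. by move=> AB Z _; apply: c_iso_iff; exact: iso_dsum_r. Qed.

Lemma eqC_dsumr A B D : perfect D -> eqC A B -> eqC (dsum A D) (dsum B D).
Proof.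
move=> pD AB Z pZ.
have E U : C (dsum Z (dsum U D)) <-> C (dsum (dsum Z D) U).
  rewrite (c_iso_iff (iso_dsum_r Z (iso_dsumC U D))).
  exact: c_iso_iff (iso_dsumA Z D U).
by rewrite !E; apply: AB; exact: perfect_dsum.
Qed.

Lemma eqC_dsuml A B D : perfect D -> eqC A B -> eqC (dsum D A) (dsum D B).
Proof.
move=> pD AB; apply: eqC_trans (eqC_iso (iso_dsumC _ _)) _.
by apply: eqC_trans (eqC_dsumr pD AB) _; exact: (eqC_iso (iso_dsumC _ _)).
Qed.

Lemma eqC_dsum A B A' B' : perfect B -> perfect A' ->
  eqC A A' -> eqC B B' -> eqC (dsum A B) (dsum A' B').
Proof.
by move=> pB pA' AA BB; apply: eqC_trans (eqC_dsumr pB AA) (eqC_dsuml pA' BB).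
Qed.

Lemma eqC_drop A B : C A -> eqC (dsum A B) B.
Proof.
move=> CA Z pZ; rewrite (c_iso_iff (iso_dsum_r Z (iso_dsumC A B))).
by rewrite (c_iso_iff (iso_dsumA Z B A)) c_cancel_iff.
Qed.

Let dense_in := thick_closure C.

Lemma dense_perfect A : dense_in A -> perfect A.
Proof. exact: (c_perfect (thick_closure_thick C23).1). Qed.

(** After adding the shift of A + D, both sides lie in [C]: for B this follows from the sequence
    with ends A + shift A and D + shift D. *)
Lemma eqC_ses A B D : ses A B D -> dense_in A -> dense_in D -> eqC B (dsum A D).
Proof.
move=> S dA dD; have [t23 _] := thick_closure_thick C23.
have dAD : C (dsum (dsum A D) (shift (dsum A D))) := c_dsum t23 dA dD.
have CB : C (dsum B (shift (dsum A D))).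
  exact: (c_mid C23 (ses_dsum2 S (ses_shift (ses_dsum A D))) dA dD).
move=> Z pZ; split=> CZ.
  apply: (c_cancel CB); apply/(c_iso_iff (iso_dsumACA Z B _ _)).
  exact: c_dsum.
apply: (c_cancel dAD); apply/(c_iso_iff (iso_dsumACA Z (dsum A D) _ _)).
exact: c_dsum.
Qed.

(** Test the hypothesis on Z + shift X: the summand shift X + X lies in [C] and can be removed. *)
Lemma eqC_cancel A B X : dense_in X -> eqC (dsum A X) (dsum B X) -> eqC A B.
Proof.
move=> dX; have pX := dense_perfect dX.
have CX : C (dsum (shift X) X) by apply/(c_iso_iff (iso_dsumC _ _)).
have H U V : eqC (dsum U X) (dsum V X) -> forall Z, perfect Z ->
    C (dsum Z U) -> C (dsum Z V).
  move=> UV Z pZ CZ; apply: (c_cancel CX).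
  apply/(c_iso_iff (iso_dsumACA Z (shift X) V X)).
  apply/UV; first exact: perfect_dsum pZ (perfect_shift pX).
  by apply/(c_iso_iff (iso_dsumACA Z U (shift X) X)); exact: c_dsum.
by move=> AB Z pZ; split; apply: H => //; exact: eqC_sym.
Qed.

Definition mul (k : nat) A : complex R := iter k (dsum A) (zeroc R).
(** The shift represents the negative, since A + shift A lies in [C] for A in the thick closure. *)
Definition zmul (k : int) A : complex R :=
  match k with Posz k => mul k A | Negz k => mul k.+1 (shift A) end.

Lemma c_mul k A : C A -> C (mul k A).
Proof. by move=> CA; elim: k => [|k IHk]; [exact: c_zeroc|exact: c_dsum]. Qed.

Lemma c_zmul k A : C A -> C (zmul k A).
Proof. by move=> CA; case: k => k; apply: c_mul => //; exact: c_shift. Qed.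

End Thomason.

Section IntegerMultiples.
Variables (R : comPzRingType) (C : complex R -> Prop).
Hypothesis C23 : closed23 C.
Implicit Types A B D X Y Z : complex R.

Let t23 := (thick_closure_thick C23).1.
Let eqC := eqC C.

Section OneObject.
Variable A : complex R.
Hypothesis dA : thick_closure C A.

Let dz k : thick_closure C (zmul k A) := c_zmul t23 k dA.
Let pz k : perfect (zmul k A) := c_perfect t23 (dz k).
Let pA : perfect A := c_perfect t23 dA.

Lemma zmul_succ k : eqC (zmul (k + 1) A) (dsum A (zmul k A)).
Proof.
case: k => [k|[|k]].
- by have -> : Posz k + 1 = Posz k.+1 by lia.
- have -> : Negz 0 + 1 = 0 by [].
  apply: (eqC_in C23); first exact: c_zeroc.
  apply/(c_iso_iff C23 (iso_dsumA _ _ _)); apply: (c_dsum C23) => //.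
  exact: c_zeroc.
have -> : Negz k.+1 + 1 = Negz k by lia.
apply: eqC_sym; apply: eqC_trans (eqC_iso C23 (iso_dsumA _ _ _)) _.
exact: eqC_drop.
Qed.

Lemma eqC_shuffle D X Y : perfect Y ->
  eqC (dsum D (dsum X Y)) (dsum X (dsum D Y)).
Proof.
move=> pY; apply: eqC_trans (eqC_iso C23 (iso_dsumA _ _ _)) _.
apply: eqC_trans (eqC_dsumr C23 pY (eqC_iso C23 (iso_dsumC _ _))) _.
exact: (eqC_iso C23 (iso_sym (iso_dsumA _ _ _))).
Qed.

Lemma eqC_cancell X Y D : thick_closure C D ->
  eqC (dsum D X) (dsum D Y) -> eqC X Y.
Proof.
move=> dD DXY; apply: (eqC_cancel C23 dD).
apply: eqC_trans (eqC_iso C23 (iso_dsumC _ _)) _.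
by apply: eqC_trans DXY _; exact: (eqC_iso C23 (iso_dsumC _ _)).
Qed.

Lemma eqC_dsum0 X : eqC (dsum X (zeroc R)) X.
Proof.
apply: eqC_trans (eqC_iso C23 (iso_dsumC _ _)) _.
exact: (eqC_drop C23 _ (c_zeroc C23)).
Qed.

(** Upwards this iterates [zmul_succ]; downwards one copy of A is cancelled at each step. *)
Lemma zmul_add k l : eqC (zmul (k + l) A) (dsum (zmul k A) (zmul l A)).
Proof.
have up (m : nat) : eqC (zmul (k + m%:Z) A) (dsum (zmul k A) (zmul m%:Z A)).
  elim: m => [|l' IHl]; first by rewrite addr0; apply: eqC_sym; exact: eqC_dsum0.
  have -> : k + l'.+1%:Z = k + l'%:Z + 1 by lia.
  apply: eqC_trans (zmul_succ _) _.
  apply: eqC_trans (eqC_dsuml C23 pA IHl) _.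
  exact: (eqC_shuffle A (zmul k A) (pz _)).
have down (m : nat) : eqC (zmul (k - m%:Z) A) (dsum (zmul k A) (zmul (- m%:Z) A)).
  elim: m => [|l' IHl]; first by rewrite subr0; apply: eqC_sym; exact: eqC_dsum0.
  apply: (eqC_cancell dA).
  apply: eqC_trans (eqC_sym (zmul_succ _)) _.
  have -> : k - l'.+1%:Z + 1 = k - l'%:Z by lia.
  apply: eqC_trans IHl _.
  have -> : - l'%:Z = - l'.+1%:Z + 1 by lia.
  apply: eqC_trans (eqC_dsuml C23 (pz k) (zmul_succ _)) _.
  exact: (eqC_shuffle (zmul k A) A (pz _)).
case: l => l; first exact: up.
by rewrite NegzE; exact: down.
Qed.

End OneObject.

Section Family.
Variables (n : nat) (K : 'I_n -> complex R).
Hypothesis dK : forall i, thick_closure C (K i).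
Implicit Types (v w : 'I_n -> int) (r : seq 'I_n).

Definition combination r v : complex R :=
  foldr (fun i X => dsum (zmul (v i) (K i)) X) (zeroc R) r.

Lemma combination_dense r v : thick_closure C (combination r v).
Proof.
elim: r => [|i r IHr]; first exact: (c_zeroc t23).
by apply: (c_dsum t23) => //; exact: (c_zmul t23).
Qed.

Lemma combination_add r v w : eqC (combination r (fun i => v i + w i))
  (dsum (combination r v) (combination r w)).
Proof.
elim: r => [|i r IHr]; first by apply: eqC_sym; exact: eqC_dsum0.
have pC u := c_perfect t23 (combination_dense r u).
have pZ k : perfect (zmul k (K i)) := c_perfect t23 (c_zmul t23 k (dK i)).
apply: eqC_trans (eqC_dsum C23 (pC _) _ (zmul_add (dK i) (v i) (w i)) IHr) _.
  exact: perfect_dsum.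
exact: (eqC_iso C23 (iso_dsumACA _ _ _ _)).
Qed.

Lemma combination_in r v : (forall i, v i = 0 \/ C (K i)) -> C (combination r v).
Proof.
move=> vK; elim: r => [|i r IHr]; first exact: c_zeroc.
apply: (c_dsum C23) => //; case: (vK i) => [->|CK]; first exact: c_zeroc.
exact: c_zmul.
Qed.

Lemma combination_delta i r : uniq r -> i \in r ->
  eqC (combination r (fun j => (j == i)%:Z)) (K i).
Proof.
have zero r' : i \notin r' -> C (combination r' (fun j => (j == i)%:Z)).
  elim: r' => [_|j r' IHr]; first exact: c_zeroc.
  rewrite in_cons negb_or eq_sym => /andP [/negbTE ji ir] /=.
  by rewrite ji; apply: (c_dsum C23); [exact: c_zeroc|exact: IHr].
elim: r => [//|j r IHr] /= /andP [jr ur]; rewrite in_cons.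
have [ij _|ij /= ir] := eqVneq i j.
  subst j; rewrite ?eqxx /=.
  apply: eqC_trans (eqC_iso C23 (iso_sym (iso_dsumA _ _ _))) _.
  apply: eqC_trans (eqC_iso C23 (iso_dsumC _ _)) _.
  apply: eqC_drop => //; apply: (c_dsum C23); first exact: c_zeroc.
  exact: zero.
rewrite /=.
by apply: eqC_trans (eqC_drop C23 _ (c_zeroc C23)) _; exact: IHr.
Qed.

End Family.

End IntegerMultiples.

(** The properties of the Euler characteristics that the group argument needs; dimensions enter only
    when [Lambda] is shown to have them. *)
Record additive_invariant (R : comPzRingType) (n : nat) (N : 'I_n -> lmodType R)
  (chi : 'I_n -> complex R -> int) : Prop := AdditiveInvariant {
  chi_ses : forall i A B D, ses A B D -> perfect B -> chi i B = chi i A + chi i D;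
  chi_contractible : forall i X, perfect X -> contractible X -> chi i X = 0;
  chi_cell : forall i j, chi i (in_degree0 (N j)) = (i == j)%:Z
}.

Section DenseSubcategories.
Variables (R : comPzRingType) (n : nat) (J : 'I_n -> R -> Prop) (e : 'I_n -> R).
Variables (N : 'I_n -> lmodType R) (nu : forall i, N i).
Variables (lambda : forall i, {linear N i -> R^o}).
Hypothesis LF : local_family J e nu lambda.
Variable chi : 'I_n -> complex R -> int.
Hypothesis chiP : additive_invariant N chi.

Let N0 i := in_degree0 (N i).

Lemma chi_shift i X : perfect X -> chi i (shift X) = - chi i X.
Proof.
move=> pX; have pC := perfect_cone (chain_id X) pX pX.
have := chi_ses chiP i (ses_cone (chain_id X)) pC.
rewrite (chi_contractible chiP i pC (cone_id_contractible X)).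
by move/esym/addr0_eq => <-.
Qed.

Lemma chi_dsum i X Y : perfect X -> perfect Y ->
  chi i (dsum X Y) = chi i X + chi i Y.
Proof.
by move=> pX pY; apply: (chi_ses chiP i (ses_dsum X Y)); exact: perfect_dsum.
Qed.

Variables (C : complex R -> Prop) (P : pred 'I_n).
Hypotheses (C23 : closed23 C) (dN : forall i, P i -> thick_closure C (N0 i)).

(** X (x) R e_S and the combination of the N_i (x) R e_S with coefficients [chi i X] are both
    additive on [ses] and agree on the cells, hence for all perfect X. For Y the combination
    consists of zero multiples and of contractible terms. *)
Lemma chi_zero_in Y : perfect Y ->
  (forall i, ~~ P i -> forall b, e_exact Y (e i) b) ->
  (forall i, P i -> chi i Y = 0) -> C Y.
Proof.
have ort i j := lf_orth LF (i := i) (j := j).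
have eSS : (\sum_(i | P i) e i) * (\sum_(i | P i) e i) = \sum_(i | P i) e i.
  rewrite {2 3}big_mkcond /= mulr_sumr; apply: eq_bigr => i _.
  case: ifP => Pi; last by rewrite mulr0.
  by have := eS_cell LF P i; rewrite Pi.
have [NS [nuS [lambdaS idS]]] := idem_module_exists eSS.
(* Tensoring with R e_S brings every perfect complex into the thick closure of [C], where [eqC] is
   additive and cancellable. *)
pose NS0 := in_degree0 NS; pose K i := tens (N0 i) NS0.
have tT := thick_closure_thick C23; have t23 := tT.1.
have dT X : perfect X -> thick_closure C (tens X NS0).
  by move=> pX; exact: (thick_tens_idem LF idS tT dN pX).
have dK i : thick_closure C (K i).
  by apply: dT; exact: idem_perfect (lf_module LF i).
pose F X := combination K (enum 'I_n) (chi^~ X).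
have dF X : thick_closure C (F X) := combination_dense C23 dK _ _.
have Fses A B D : ses A B D -> perfect B -> eqC C (F B) (dsum (F A) (F D)).
  move=> S pB; rewrite {1}/F.
  have -> : chi^~ B = fun i => chi i A + chi i D.
    by apply/funext => i; exact: (chi_ses chiP i S pB).
  exact: (combination_add C23 dK).
have pT X (pX : perfect X) : perfect (tens X NS0) := c_perfect t23 (dT X pX).
have pF X : perfect (F X) := c_perfect t23 (dF X).
have Tses A B D : ses A B D -> perfect B ->
    eqC C (tens B NS0) (dsum (tens A NS0) (tens D NS0)).
  move=> S pB; apply: (eqC_ses C23 (ses_tens_l _ NS0 S)); apply: dT.
    exact: ses_perfect_sub S pB.
  exact: ses_perfect_quo S pB.
have Q23 : closed23 (fun X => perfect X /\ eqC C (tens X NS0) (F X)).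
  split.
  - by move=> X [].
  - move=> X pX cX; split=> //; apply: (eqC_in C23).
      have := c_contr (closed23_tens_idem idS C23) pX cX; by case.
    apply: (combination_in C23) => i; left; exact: (chi_contractible chiP).
  - move=> A B D S [pB EB] [pD ED]; have pA := ses_perfect_sub S pB; split=> //.
    apply: (eqC_cancel C23 (dT _ pD)).
    apply: eqC_trans (eqC_sym (Tses _ _ _ S pB)) _.
    apply: eqC_trans EB _; apply: eqC_trans (Fses _ _ _ S pB) _.
    by apply: (eqC_dsuml C23) => //; exact: eqC_sym.
  - move=> A B D S [pA EA] [pD ED]; have pB := ses_perfect_mid S pA pD; split=> //.
    apply: eqC_trans (Tses _ _ _ S pB) _.
    apply: eqC_trans (eqC_sym (Fses _ _ _ S pB)).
    by apply: (eqC_dsum C23) => //; exact: pT.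
  - move=> A B D S [pA EA] [pB EB]; have pD := ses_perfect_quo S pB; split=> //.
    apply: (eqC_cancell C23 (dT _ pA)).
    apply: eqC_trans (eqC_sym (Tses _ _ _ S pB)) _.
    apply: eqC_trans EB _; apply: eqC_trans (Fses _ _ _ S pB) _.
    by apply: (eqC_dsumr C23) => //; exact: eqC_sym.
move=> pY exY chiY.
have [_ YF] : perfect Y /\ eqC C (tens Y NS0) (F Y).
  apply: (generation LF Q23) pY => i; split.
    exact: idem_perfect (lf_module LF i).
  apply: eqC_sym; rewrite /F.
  have -> : chi^~ (in_degree0 (N i)) = fun j => (j == i)%:Z.
    by apply/funext => j; exact: (chi_cell chiP).
  by apply: (combination_delta C23); [exact: enum_uniq|rewrite mem_enum].
apply: (supported_tens_idem LF idS C23 pY exY).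
apply/(eqC_C C23 YF)/(combination_in C23) => i.
have [Pi|nP] := boolP (P i); first by left; exact: chiY.
right; apply: (c_contr C23); last exact: (cell_tens_contractible LF idS nP).
exact: perfect_tens (idem_perfect (lf_module LF i)) (idem_perfect idS).
Qed.

(** The complex Y + shift X has vanishing invariants on [P], hence lies in [C], and [shift X] is
    cancelled. *)
Lemma chi_classify X Y : C X -> perfect Y ->
  (forall i, ~~ P i -> forall b, e_exact X (e i) b) ->
  (forall i, ~~ P i -> forall b, e_exact Y (e i) b) ->
  (forall i, P i -> chi i Y = chi i X) -> C Y.
Proof.
move=> CX pY exX exY chiXY; have pX := c_perfect C23 CX.
apply: (c_cancel C23 (c_shift C23 CX)); apply: chi_zero_in.
- exact: perfect_dsum pY (perfect_shift pX).
- move=> i nP b [z z'] [dz dz'].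
  have [y dy] := exY i nP b z dz.
  have [|y' dy'] := exX i nP (b - 1) z'.
    by apply/eqP; rewrite -oppr_eq0; apply/eqP.
  by exists (y, - y'); congr (_, _); rewrite //= linearN opprK.
move=> i Pi; rewrite chi_dsum ?chi_shift ?chiXY ?subrr //.
exact: (perfect_shift pX).
Qed.

End DenseSubcategories.

(** * The Euler-Poincare formula *)

Section Dimension.
Variable F : fieldType.
Implicit Types U V W : lmodType F.

Definition coordinates V (d : nat) : Prop :=
  exists (f : {linear V -> 'rV[F]_d}) (g : {linear 'rV[F]_d -> V}),
    cancel f g /\ cancel g f.

Lemma has_basisP V d : has_basis V d <-> coordinates V d.
Proof.
split=> [[b bP]|[f [g [fg gf]]]].
  have [c cP] := choice (fun v => let: ex_intro c (conj e _) := bP v in ex_intro _ c e).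
  have lg : linear (fun w : 'rV[F]_d => \sum_k w 0 k *: b k).
    move=> a x y; rewrite scaler_sumr -big_split /=; apply: eq_bigr => k _.
    by rewrite !mxE scalerDl scalerA.
  have cu v (c' : {ffun 'I_d -> F}) : v = \sum_k c' k *: b k -> c v = c'.
    by move=> e; have [c0 [e0 u0]] := bP v; rewrite -(u0 _ (cP v)) -(u0 _ e).
  have lf : linear (fun v : V => \row_k c v k).
    move=> a x y; apply/rowP => k; rewrite !mxE.
    have -> : c (a *: x + y) = [ffun k => a * c x k + c y k].
      apply: cu; rewrite {1}[x]cP {1}[y]cP scaler_sumr -big_split /=.
      by apply: eq_bigr => l _; rewrite ffunE scalerDl scalerA.
    by rewrite ffunE.
  exists (mklinear lf), (mklinear lg); split=> [v|w] /=.
    by rewrite [RHS]cP; apply: eq_bigr => k _; rewrite mxE.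
  apply/rowP => k; rewrite mxE.
  rewrite (cu _ [ffun k => w 0 k]) ?ffunE //.
  by apply: eq_bigr => l _; rewrite ffunE.
exists (fun k => g (delta_mx 0 k)) => v.
have gE w : g w = \sum_k w 0 k *: g (delta_mx 0 k).
  by rewrite {1}[w]row_sum_delta linear_sum; apply: eq_bigr => k _; rewrite linearZ.
exists [ffun k => f v 0 k]; split.
  by rewrite -[LHS]fg gE; apply: eq_bigr => k _; rewrite ffunE.
move=> c vE; apply/ffunP => k; rewrite ffunE.
have -> : v = g (\row_k c k).
  by rewrite gE vE; apply: eq_bigr => l _; rewrite mxE.
by rewrite gf mxE.
Qed.

Lemma coordinates_le V d d' : coordinates V d -> coordinates V d' -> (d <= d')%N.
Proof.
move=> [f [g [fg gf]]] [f' [g' [fg' gf']]].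
apply: (@mulmx1_min F _ _ (lin1_mx (linC f' g)) (lin1_mx (linC f g'))).
apply/row_matrixP => i; rewrite !rowE mulmxA mul_rV_lin1 mul_rV_lin1 /=.
by rewrite fg' gf mulmx1.
Qed.

Lemma dimensionE V d : coordinates V d -> dimension V = d.
Proof.
move=> Vd; apply: xget_unique; first exact/has_basisP.
by move=> d' /has_basisP Vd'; apply/eqP; rewrite eqn_leq !(coordinates_le (V := V)).
Qed.

Lemma coordinates_prod U V W a b (i : {linear U -> V}) (r : {linear V -> U})
    (p : {linear V -> W}) (s : {linear W -> V}) :
  (forall x, r (i x) = x) -> (forall x, p (s x) = x) ->
  (forall x, i (r x) + s (p x) = x) ->
  coordinates U a -> coordinates W b -> coordinates V (a + b).
Proof.
move=> ri ps e [f [g [fg gf]]] [f' [g' [fg' gf']]].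
have pi x : p (i x) = 0.
  have := congr1 p (e (i x)).
  by rewrite linearD ri ps => /(canRL (addrK _)); rewrite subrr => <-.
have rs x : r (s x) = 0.
  have := congr1 r (e (s x)).
  by rewrite linearD ri ps => /(canRL (addrK _)); rewrite subrr => ->.
have l1 : linear (fun v => row_mx (f (r v)) (f' (p v))).
  by move=> c x y; rewrite !linearP /= -add_row_mx -scale_row_mx.
have l2 : linear (fun w : 'rV[F]_(a + b) => i (g (lsubmx w)) + s (g' (rsubmx w))).
  by move=> c x y; rewrite !linearP /= scalerDr addrACA.
exists (mklinear l1), (mklinear l2); split=> x /=.
  by rewrite row_mxKl row_mxKr fg fg' e.
rewrite (_ : r _ = g (lsubmx x)); last by rewrite linearD ri rs addr0.
rewrite (_ : p _ = g' (rsubmx x)); last by rewrite linearD pi ps add0r.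
by rewrite gf gf' hsubmxK.
Qed.

(** A dual basis presents V as the image of an idempotent matrix E; its rank factorization satisfies
    [row_base E *m col_base E = 1%:M], which gives inverse coordinate maps. *)
Lemma coordinates_fproj V : fproj V -> exists d, coordinates V d.
Proof.
move=> [s sP]; pose D := size s; pose z := ((\0 : {linear V -> F^o}), 0 : V).
have lf : linear (fun v : V => \row_(k < D) ((nth z s k).1 v : F)).
  by move=> a x y; apply/rowP => k; rewrite !mxE linearP.
have lg : linear (fun w : 'rV[F]_D => \sum_k w 0 k *: (nth z s k).2).
  move=> a x y; rewrite scaler_sumr -big_split /=; apply: eq_bigr => k _.
  by rewrite !mxE scalerDl scalerA.
have [f [g fg]] : exists (f : {linear V -> 'rV[F]_D}) (g : {linear 'rV[F]_D -> V}),
    cancel f g.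
  exists (mklinear lf), (mklinear lg) => v /=.
  rewrite [RHS]sP (big_nth z) big_mkord; apply: eq_bigr => k _.
  by rewrite mxE.
pose E := lin1_mx (linC f g).
have mE w : w *m E = f (g w) by exact: mul_rV_lin1.
have Ef v : f v *m E = f v by rewrite mE fg.
have EE : E *m E = E.
  by apply/row_matrixP => k; rewrite row_mul !rowE !mE fg.
exists (\rank E), (linC (mulmxr (col_base E)) f), (linC g (mulmxr (row_base E))).
split=> [v|w] /=.
  by rewrite -mulmxA mulmx_base Ef fg.
have rc : row_base E *m col_base E = 1%:M.
  have H : col_base E *m (row_base E *m col_base E) *m row_base E =
      col_base E *m 1%:M *m row_base E.
    by rewrite mulmx1 mulmx_base mulmxA mulmx_base -mulmxA mulmx_base EE.
  exact: (row_full_inj (col_base_full E) (row_free_inj (row_base_free E) H)).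
rewrite -mE.
have Ec : E *m col_base E = col_base E.
  transitivity (col_base E *m row_base E *m col_base E); first by rewrite mulmx_base.
  by rewrite -mulmxA rc mulmx1.
by rewrite -mulmxA Ec -mulmxA rc mulmx1.
Qed.

End Dimension.

Section EulerPoincare.
Variables (F : fieldType) (T : complex F) (d : int -> nat).
Hypothesis Td : forall t, coordinates (T t) (d t).

Let f t : {linear T t -> 'rV[F]_(d t)} := projT1 (cid (Td t)).
Let g t : {linear 'rV[F]_(d t) -> T t} := projT1 (cid (projT2 (cid (Td t)))).
Let fg t : cancel (f t) (g t) := (projT2 (cid (projT2 (cid (Td t))))).1.
Let gf t : cancel (g t) (f t) := (projT2 (cid (projT2 (cid (Td t))))).2.

Let M t : 'M[F]_(d t, d (t - 1)) := lin1_mx (linC (f (t - 1)) (linC (cdiff T t) (g t))).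
Let inc t := mklinear (@incoming_linear F T t).
Let N t : 'M[F]_(d (t + 1), d t) := lin1_mx (linC (f t) (linC (inc t) (g (t + 1)))).

Definition diff_rank t := \rank (M t).

Let rankN t : \rank (N t) = diff_rank (t + 1).
Proof.
rewrite /diff_rank /M /N /inc.
(* Generalizing the target degree lets the cast in [incoming] be eliminated. *)
have G j (e : t + 1 - 1 = j) (h : {linear T (t + 1) -> T j}) :
    (forall x, h x = cast_obj e (cdiff T (t + 1) x)) ->
    \rank (lin1_mx (linC (f j) (linC h (g (t + 1))))) =
    \rank (lin1_mx (linC (f (t + 1 - 1)) (linC (cdiff T (t + 1)) (g (t + 1))))).
  case: j / e h => h hE; congr (\rank _).
  by apply/row_matrixP => k; rewrite !rowE !mul_rV_lin1 /= hE.
exact: (G t (addrK 1 t) (inc t)).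
Qed.

Let diff_inc t y : cdiff T t (incoming (t := t) y) = 0.
Proof.
have G j (e : t + 1 - 1 = j) : cdiff T j (cast_obj e (cdiff T (t + 1) y)) = 0.
  by case: j / e; exact: cdiffK.
exact: G.
Qed.

Let NM t : N t *m M t = 0.
Proof.
apply/row_matrixP => k; rewrite row_mul row0 rowE !mul_rV_lin1 /=.
by rewrite fg diff_inc linear0.
Qed.

(** In matrix form, homology is the row space of a complement [Q] of the boundaries [N t] in the
    cycles [K]. *)
Lemma homology_coordinates t : exists h,
  coordinates (homology T t) h /\ (h + diff_rank t + diff_rank (t + 1) = d t)%N.
Proof.
pose K := kermx (M t); pose Q := (K :\: N t)%MS; pose B := row_base Q.
have NK : (N t <= K)%MS by apply/sub_kermxP; exact: NM.
have QN : (Q :&: <<N t>>)%MS = 0.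
  apply/eqP; rewrite -submx0 -(capmx_diff K (N t)) capmxS ?genmxE //.
have QK : (Q <= K)%MS := diffmxSl _ _.
have BK : (B <= K)%MS by rewrite eq_row_base.
have fM x : f (t - 1) (cdiff T t x) = f t x *m M t.
  by rewrite mul_rV_lin1 /= fg.
have fN y : f t (incoming y) = f (t + 1) y *m N t.
  by rewrite mul_rV_lin1 /= fg.
exists (\rank Q); split; last first.
  rewrite -rankN -addnA [X in (_ + X)%N]addnC addnA.
  have := mxrank_cap_compl K (N t); rewrite (capmx_idPr NK) addnC => ->.
  rewrite mxrank_ker subnK //; exact: rank_leq_row.
(* Project along the boundaries onto [Q], then expand in its basis [B]. *)
pose c (z : Defs.cycle T t) : 'rV[F]_(\rank Q) :=
  f t (sval z) *m proj_mx Q <<N t>>%MS *m pinvmx B.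
have c_eq z z' : homologous z z' -> c z = c z'.
  move=> [y e]; apply/eqP; rewrite -subr_eq0 -!mulmxBl -linearB e fN.
  by rewrite proj_mx_0 ?mul0mx // genmxE submxMl.
have cP (z : Defs.cycle T t) : (f t (sval z) <= K)%MS.
  by apply/sub_kermxP; rewrite -fM (svalP z) linear0.
have lc : linear (fun q : homology T t => c (rep q)).
  have E z : c (rep (cls (z : homology_premodule T t))) = c z.
    by apply: c_eq; exact: (rep_cls (z : homology_premodule T t)).
  move=> a x y; rewrite -[x]repK -[y]repK -clsZ -clsD !E /c /=.
  by rewrite linearP !mulmxDl -!scalemxAl.
have cyc (w : 'rV[F]_(\rank Q)) : cdiff T t (g t (w *m B)) = 0.
  rewrite -[cdiff _ _ _]fg fM gf -[RHS](linear0 (g (t - 1))); congr (g _ _).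
  by apply/sub_kermxP/(submx_trans _ BK); exact: submxMl.
have lg : linear (fun w : 'rV[F]_(\rank Q) =>
    cls (Cycle (cyc w) : homology_premodule T t) : homology T t).
  move=> a x y; rewrite -clsZ -clsD; apply/clsP; apply: homologous_eq.
  by rewrite /= mulmxDl -scalemxAl linearP.
exists (mklinear lc), (mklinear lg); split=> [q|w] /=.
  rewrite -[RHS]repK; apply/clsP.
  set z : Defs.cycle T t := rep q.
  have zQN : (f t (sval z) <= Q + <<N t>>)%MS.
    apply: submx_trans (cP z) _; rewrite -(addsmx_diff_cap_eq K (N t)).
    by apply: addsmxS => //; rewrite genmxE capmxSr.
  have cB : c z *m B = f t (sval z) *m proj_mx Q <<N t>>%MS.
    by rewrite mulmxKpV // eq_row_base proj_mx_sub.
  have /submxP [y yE] : (f t (sval z) *m proj_mx <<N t>>%MS Q <= N t)%MS.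
    by apply: submx_trans (proj_mx_sub _ _ _) _; rewrite genmxE.
  apply: pm_sym; exists (g (t + 1) y) => /=.
  rewrite -[LHS]fg -[RHS]fg; congr (g t _); rewrite fN gf linearB gf cB -yE.
  by rewrite -{1}(add_proj_mx QN zQN) addrAC subrr add0r.
have -> : c (rep (cls (Cycle (cyc w) : homology_premodule T t))) = c (Cycle (cyc w)).
  by apply: c_eq; exact: (rep_cls (Cycle (cyc w) : homology_premodule T t)).
rewrite /c /= gf proj_mx_id //; first by rewrite mulmxKp ?row_base_free.
by rewrite (submx_trans (submxMl _ _)) // eq_row_base.
Qed.

End EulerPoincare.

Section IntegerSums.

Lemma fsbig_int (u : int -> int) (b : nat) :
  (forall t : int, (b < `|t|)%N -> u t = 0) ->
  \sum_(t \in [set: int]) u t = \sum_(0 <= k < (b + b).+1) u (k%:Z - b%:Z).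
Proof.
move=> ub; pose r := [seq k%:Z - b%:Z | k <- iota 0 (b + b).+1].
have ur : uniq r by rewrite map_inj_uniq ?iota_uniq // => i j; lia.
rewrite -(fsbig_widen [set` r]%classic) => [||t [_ /= /negP tr]] //.
  by rewrite -fsbig_seq // big_map /index_iota subn0.
apply: ub; rewrite ltnNge; apply: contra tr => tb; apply/mapP.
by exists (absz (t + b%:Z)%R); rewrite ?mem_iota; lia.
Qed.

End IntegerSums.

(** The homology in degree t has dimension d_t - r_t - r_(t+1), and the alternating sum of the ranks
    telescopes. *)
Lemma euler_charE (F : fieldType) (T : complex F) (d : int -> nat) (b : nat) :
  (forall t, coordinates (T t) (d t)) -> (forall t : int, (b < `|t|)%N -> d t = 0%N) ->
  euler_char T = \sum_(0 <= k < (b + b).+1) (-1) ^+ `|k%:Z - b%:Z|%N * (d (k%:Z - b%:Z))%:Z.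
Proof.
move=> Td db; pose r := diff_rank Td.
have hE t : (dimension (homology T t))%:Z = (d t)%:Z - (r t)%:Z - (r (t + 1))%:Z.
  have [h [Hh <-]] := homology_coordinates Td t.
  rewrite (dimensionE Hh) !PoszD; rewrite -/r; lia.
have h0 t : (b < `|t|)%N -> (d t)%:Z - (r t)%:Z - (r (t + 1))%:Z = 0.
  move=> bt; have [h [Hh e]] := homology_coordinates Td t.
  have := db t bt; rewrite -/r in e; lia.
rewrite /euler_char.
rewrite (fsbig_int (u := fun t => (-1) ^+ `|t|%N * (dimension (homology T t))%:Z) (b := b)); last first.
  by move=> t bt; rewrite hE h0 ?mulr0.
pose f k := (-1) ^+ `|k%:Z - b%:Z|%N * (r (k%:Z - b%:Z))%:Z : int.
transitivity (\sum_(0 <= k < (b + b).+1) ((-1) ^+ `|k%:Z - b%:Z|%N * (d (k%:Z - b%:Z))%:Z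
   + (f k.+1 - f k))).
  apply: eq_bigr => k _; rewrite hE /f.
  have -> : k.+1%:Z - b%:Z = k%:Z - b%:Z + 1 by lia.
  have := sign_pred int (k%:Z - b%:Z + 1); rewrite addrK => ->.
  by ring.
rewrite big_split /= telescope_sumr // /f.
(* The ends of the telescope are the ranks in degrees b + 1 and -b; they vanish because [d] does in
   degrees b + 1 and -b - 1. *)
have -> : r ((b + b).+1%:Z - b%:Z) = 0%N.
  have [h [_ e]] := homology_coordinates Td ((b + b).+1%:Z - b%:Z).
  have := db ((b + b).+1%:Z - b%:Z); rewrite -/r in e; lia.
have -> : r (0%:Z - b%:Z) = 0%N.
  have [h [_ e]] := homology_coordinates Td (0%:Z - b%:Z - 1).
  have := db (0%:Z - b%:Z - 1); rewrite -/r subrK in e *; lia.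
by rewrite !mulr0 subr0.
Qed.

Lemma tens_contractible_l (R A : comPzRingType) (phi : {rmorphism R -> A})
  (Z : complex R) (Y : complex A) :
  contractible Z -> contractible (tensor_complex phi Z Y).
Proof.
move=> [h hP].
have trh j k k' (w : Z j) : k = k' ->
    tr Z k k' (h k (tr Z j (k - 1) w)) = h k' (tr Z j (k' - 1) w).
  by move=> e; case: k' / e; rewrite trii.
have K n : {f : {linear tensor_complex phi Z Y (n - 1) -> tensor_complex phi Z Y n} |
    forall i j (x : Z i) (y : Y j), i + j = n - 1 ->
    f (tpt phi (n - 1) x y) = tpt phi n (h (i + 1) (tr Z i (i + 1 - 1) x)) y}.
  apply: (@tens_lift R A phi Z Y (n - 1) (tensor_complex phi Z Y n) (fun i j x y =>
    tpt phi n (h (i + 1) (tr Z i (i + 1 - 1) x)) y)).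
  - by move=> i j u u' v; rewrite !linearD tptDl.
  - by move=> i j u a v v'; rewrite tptDr tptZr.
  - by move=> i j a u v; rewrite !linearZ tptZl.
have KE m := svalP (K m).
exists (fun n => sval (K n)) => n.
apply: tens_ind => [|x y ex ey|i j x y ij].
- by rewrite !linear0 addr0.
- by rewrite !linearD addrACA ex ey.
have ij1 : i - 1 + j = n - 1 - 1 by rewrite addrAC ij.
have ij2 : i + (j - 1) = n - 1 - 1 by rewrite addrA ij.
rewrite (KE n _ _ x y ij) !tpt_diff [sval (K (n - 1)) _]linearD.
rewrite [sval (K (n - 1)) (_ *: _)]linearZZ.
rewrite (KE (n - 1) _ _ (cdiff Z i x) y ij1) (KE (n - 1) _ _ x (cdiff Y j y) ij2).
(* The homotopy raises the degree of the left factor by one, which flips the sign: the two terms in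
   d y cancel. *)
have sg : (-1) ^+ `|i|%N = - (-1) ^+ `|(i + 1)%R|%N :> A.
  by have := sign_pred A (i + 1); rewrite addrK.
rewrite sg scaleNr; apply: etrans (addDNB _ _ _) _.
have -> : h (i - 1 + 1) (tr Z (i - 1) (i - 1 + 1 - 1) (cdiff Z i x)) =
    tr Z (i + 1 - 1) (i - 1 + 1)
      (h (i + 1 - 1) (tr Z (i - 1) (i + 1 - 1 - 1) (cdiff Z i x))).
  by rewrite trh //; lia.
rewrite [tpt phi (n - 1) (tr Z (i + 1 - 1) (i - 1 + 1) _) y]tpt_trl; last by lia.
rewrite -tptDl -tr_diff hP tpt_trl //; lia.
Qed.

Section ResidueEuler.
Variables (R : comPzRingType) (K : fieldType) (phi : {rmorphism R -> K}).

Let k0 : complex K := in_degree0 K^o.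
Let T (X : complex R) : complex K := tensor_complex phi X k0.

Definition residue_euler (X : complex R) : int := euler_char (T X).

Let k0_perfect : perfect k0.
Proof.
apply: perfect_in_degree0; exists [:: ((idfun : {linear K^o -> K^o}), 1 : K^o)] => x.
by rewrite big_cons big_nil addr0 /= /GRing.scale /= mulr1.
Qed.

Lemma trivial_coordinates (V : lmodType K) : (forall v : V, v = 0) -> coordinates V 0.
Proof.
by move=> V0; exists \0, \0; split=> v; [rewrite [RHS]V0|rewrite [RHS]rV0].
Qed.

Lemma residue_coordinates X : perfect X -> exists (d : int -> nat) (b : nat),
  (forall t, coordinates (T X t) (d t)) /\
  forall t : int, (b < `|t|)%N -> d t = 0%N.
Proof.
move=> /perfectE [bX fX]; have /perfectE [bk fk] := k0_perfect.
have [d dP] : exists d : int -> nat, forall t, coordinates (T X t) (d t).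
  exists (fun t => projT1 (cid (coordinates_fproj (fproj_tens phi t bX fX fk)))) => t.
  by case: cid.
have [b bT] := bounded_tens phi bX bk.
exists d, b; split=> // t bt; apply/eqP; rewrite -leqn0.
apply: coordinates_le (dP t) _; apply: trivial_coordinates => v; exact: (bT t bt).
Qed.

Lemma residue_euler_ses A B D : ses A B D -> perfect B ->
  residue_euler B = residue_euler A + residue_euler D.
Proof.
move=> S pB; have pA := ses_perfect_sub S pB; have pD := ses_perfect_quo S pB.
have [dA [bA [HA zA]]] := residue_coordinates pA.
have [dD [bD [HD zD]]] := residue_coordinates pD.
have [i [p [r [s [ri ps e]]]]] := ses_tens_l phi k0 S.
have HB t : coordinates (T B t) (dA t + dD t).
  exact: (coordinates_prod (ri t) (ps t) (e t) (HA t) (HD t)).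
pose b := (bA + bD)%N.
have zA' t : (b < `|t|)%N -> dA t = 0%N.
  by move=> bt; apply: zA; apply: leq_ltn_trans bt; exact: leq_addr.
have zD' t : (b < `|t|)%N -> dD t = 0%N.
  by move=> bt; apply: zD; apply: leq_ltn_trans bt; exact: leq_addl.
have zB t : (b < `|t|)%N -> (dA t + dD t = 0)%N by move=> bt; rewrite zA' ?zD'.
rewrite /residue_euler (euler_charE HB zB) (euler_charE HA zA') (euler_charE HD zD').
by rewrite -big_split; apply: eq_bigr => k _; rewrite PoszD mulrDr.
Qed.

Lemma residue_euler_contractible X : contractible X -> residue_euler X = 0.
Proof.
move=> cX; have aT := contractible_acyclic (tens_contractible_l phi k0 cX).
have H t : dimension (homology (T X) t) = 0%N.
  apply: dimensionE; apply: trivial_coordinates => q; rewrite -[q]repK.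
  apply/clsP; set z : Defs.cycle (T X) t := rep q.
  have castE (j : int) (e : t + 1 - 1 = j) (x : T X (t + 1 - 1)) :
      cast_obj e x = tr (T X) _ j x by case: j / e; rewrite trii.
  have [|y dy] := aT (t + 1) (tr (T X) t (t + 1 - 1) (sval z)).
    by rewrite tr_diff (svalP z) linear0.
  exists y; rewrite /incoming castE dy tr_comp ?addrK // trii.
  exact: subr0.
rewrite /residue_euler /euler_char (fsbig_int (b := 0)) => [|t _]; last first.
  by rewrite H mulr0.
by apply: big1 => k _; rewrite H mulr0.
Qed.

Variables (e : R) (N : lmodType R) (nu : N) (lambda : {linear N -> R^o}).
Hypothesis idN : idem_module e nu lambda.

Let N0 := in_degree0 N.

Lemma residue_cell_trivial t : t <> 0 -> forall v : T N0 t, v = 0.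
Proof.
move=> t0; apply: tens_ind => [//|x y -> ->|i j x y ij]; first by rewrite addr0.
have [i0|i0] := pselect (i = 0); last by rewrite (in_degree0_zero x) ?tpt0l.
rewrite (in_degree0_zero y) ?tpt0r // => j0.
by apply: t0; rewrite -ij i0 j0.
Qed.

Lemma residue_euler_degree0 d : coordinates (T N0 0) d -> residue_euler N0 = d%:Z.
Proof.
move=> Hd.
pose dd (t : int) := if t == 0 then d else 0%N.
have H t : coordinates (T N0 t) (dd t).
  have [->|/eqP t0] := eqVneq t 0; first by rewrite /dd eqxx.
  rewrite /dd; case: eqP => // _; apply: trivial_coordinates.
  exact: residue_cell_trivial.
rewrite /residue_euler (euler_charE H (b := 0)) => [|t].
  by rewrite big_nat1 /= /dd eqxx mul1r.
by rewrite /dd; case: eqP => // ->.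
Qed.

Lemma residue_euler_out : phi e = 0 -> residue_euler N0 = 0.
Proof.
move=> e0; apply: (residue_euler_degree0 (d := 0)); apply: trivial_coordinates.
apply: tens_ind => [//|x y -> ->|i j x y ij]; first by rewrite addr0.
have -> : x = e *: x.
  move: x; rewrite /N0 /in_degree0 /=; case: (i == 0) => x; last by rewrite [LHS]rV0 [RHS]rV0.
  have [le lK] := idN.
  by rewrite -[x]lK scalerA mulrC -scalerA (idem_nu idN).
by rewrite tptZl e0 scale0r.
Qed.

Lemma residue_euler_in : phi e = 1 -> residue_euler N0 = 1.
Proof.
move=> e1; apply: (residue_euler_degree0 (d := 1)).
have [le lK] := idN.
have [f fE] : {f : {linear T N0 0 -> 'rV[K]_1} |
    forall i j (x : N0 i) (y : k0 j), i + j = 0 ->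
    f (tpt phi 0 x y) = const_mx (phi (lambda (tr N0 i 0 x)) * (tr k0 j 0 y : K))}.
  apply: (@tens_lift R K phi N0 k0 0 'rV[K]_1 (fun i j x y =>
    const_mx (phi (lambda (tr N0 i 0 x)) * (tr k0 j 0 y : K)))).
  - move=> i j u u' v; apply/rowP => l; rewrite !mxE !linearD rmorphD.
    exact: mulrDl.
  - move=> i j u a v v'; apply/rowP => l; rewrite !mxE !linearP /=.
    by rewrite mulrDr; congr (_ + _); exact: mulrCA.
  - move=> i j a u v; apply/rowP => l; rewrite !mxE !linearZ /= rmorphM.
    by rewrite -mulrA.
have lg : linear (fun w : 'rV[K]_1 => w 0 0 *: tpt phi 0 (nu : N0 0) (1 : k0 0)).
  by move=> a x y; rewrite !mxE scalerDl scalerA.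
exists f, (mklinear lg); split=> [q|w] /=.
  move: q; apply: tens_ind => [|x y ex ey|i j x y ij].
  - by rewrite linear0 mxE scale0r.
  - by rewrite linearD mxE scalerDl ex ey.
  rewrite fE // mxE.
  have [i0|i0] := pselect (i = 0); last first.
    by rewrite (in_degree0_zero x) // !tpt0l !linear0 rmorph0 mul0r scale0r.
  have j0 : j = 0 by move: ij; rewrite i0 add0r.
  subst i j; rewrite !trii.
  rewrite mulrC -scalerA -(@tptZl R K phi N0 k0 0 0 0 (lambda x) nu (1 : K)); have -> : lambda x *: nu = x by exact: lK.
  rewrite -(@tptZr R K phi N0 k0 0 0 0 y x (1 : K)).
  exact: (congr1 (fun v : k0 0 => @tpt R K phi N0 k0 0 0 0 x v) (mulr1 (y : K))).
rewrite linearZZ fE ?addr0 // !trii; apply/rowP => l.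
by rewrite !mxE le e1 !mulr1 (ord1 l).
Qed.

End ResidueEuler.

(** * Artinian local rings *)

Section Krull.
Variable A : comPzRingType.

Lemma krull (I : set A) : is_ideal I -> ~ I 1 ->
  exists m, is_maximal m /\ (I `<=` m)%classic.
Proof.
move=> iI nI.
pose P (K : set A) := K = set0 \/ [/\ is_ideal K, ~ K 1 & (I `<=` K)%classic].
have [|m [Pm mmax]] := @Zorn_bigcup A P.
  move=> F FP tF.
  have [[K [FK Kx]]|no] := pselect (exists K, F K /\ exists x, K x); last first.
    left; apply/seteqP; split=> // x [K FK Kx].
    by apply: no; exists K; split=> //; exists x.
  have ideal_in L : F L -> (exists x, L x) -> [/\ is_ideal L, ~ L 1 & (I `<=` L)%classic].
    by move=> /FP [-> [x []]|].
  right; have [iK nK IK] := ideal_in K FK Kx; split.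
  - split.
    + by exists K => //; case: iK.
    + move=> x y [L FL Lx] [L' FL' Ly].
      have [LL|LL] := tF L L' FL FL'.
        exists L' => //; have [|[_ D _] _ _] := ideal_in L' FL'; first by exists y.
        by apply: D => //; exact: LL.
      exists L => //; have [|[_ D _] _ _] := ideal_in L FL; first by exists x.
      by apply: D => //; exact: LL.
    + move=> r x [L FL Lx]; exists L => //.
      by have [|[_ _ M] _ _] := ideal_in L FL; [exists x|exact: M].
  - by move=> [L FL L1]; have [|_ nL _] := ideal_in L FL; [exists 1|].
  - by move=> x Ix; exists K => //; exact: IK.
have Imax : ~ (m `<` I)%classic.
  by move=> mI; apply: (mmax I mI); right; split=> // x.
case: Pm => [m0|[im nm Im]].
  case: Imax; rewrite m0; split; first by move=> x [].
  by case: iI => I0 _ _ /(_ 0 I0).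
exists m; split=> //; split=> // J iJ nJ mJ; apply/seteqP; split=> //.
apply: contrapT => nJm; apply: (mmax J); first by split.
by right; split=> // x /Im /mJ.
Qed.

Lemma local_unit (m : set A) x : local_with m -> ~ m x -> exists w, w * x = 1.
Proof.
move=> [_ mu] nmx; pose I : set A := fun y => exists r, y = r * x.
have iI : is_ideal I.
  split; first by exists 0; rewrite mul0r.
  - by move=> y z [r ->] [s ->]; exists (r + s); rewrite mulrDl.
  - by move=> r y [s ->]; exists (r * s); rewrite mulrA.
have [[w we]|nI1] := pselect (I 1); first by exists w.
have [m' [mm' Im']] := krull iI nI1; case: nmx; rewrite -(mu m' mm').
by apply: Im'; exists 1; rewrite mul1r.
Qed.

Lemma artinian_minimal (P : set A -> Prop) K0 : artinian A ->
  is_ideal K0 -> P K0 -> exists K, [/\ is_ideal K, P K &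
    forall K', is_ideal K' -> P K' -> (K' `<=` K)%classic -> K' = K].
Proof.
move=> artA iK0 PK0; apply: contrapT => no.
pose S := {K : set A | is_ideal K /\ P K}.
have step (s : S) : exists s' : S, (sval s' `<=` sval s)%classic /\ sval s' <> sval s.
  case: s => K [iK PK]; apply: contrapT => nK; apply: no; exists K; split=> //.
  move=> K' iK' PK' KK'; apply: contrapT => ne; apply: nK.
  by exists (exist _ K' (conj iK' PK')).
have [g gP] := choice step.
pose s0 : S := exist _ K0 (conj iK0 PK0).
have [N NP] := artA (fun k => sval (iter k g s0))
  (fun k => (svalP (iter k g s0)).1) (fun k => (gP (iter k g s0)).1).
exact: (gP (iter N g s0)).2 (NP N.+1 (leqnSn N)).
Qed.

Lemma pw_le (J : A -> Prop) k : is_ideal J -> forall x, pw J k.+1 x -> pw J k x.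
Proof.
move=> iJ x H; apply: H; first exact: pw_ideal.
by move=> a b _ pb; exact: pwM.
Qed.

(** J^(m + k) is contained in J^m J^k, expressed through the ideals that contain the products. *)
Lemma pw_add (J : A -> Prop) m k : forall L, is_ideal L ->
  (forall x y, pw J m x -> pw J k y -> L (x * y)) -> forall z, pw J (m + k) z -> L z.
Proof.
elim: m => [|m IHm] L iL HL z pz; first by rewrite -[z]mul1r; exact: HL.
apply: pz => // a b Ja pb; case: (iL) => L0 LD LM.
have iLa : is_ideal (fun y => L (a * y)).
  split; first by rewrite mulr0.
  - by move=> x y; rewrite mulrDr; exact: LD.
  - by move=> r x Lx; rewrite mulrCA; exact: LM.
apply: (IHm _ iLa _ b pb) => x y px py; rewrite mulrA; apply: HL => //.
exact: pwS.
Qed.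

(** If the stable power I is nonzero, a minimal ideal K with K I nonzero has the form k I, so k = k
    b with b in [m]; as 1 - b is a unit, k = 0. *)
Lemma artinian_local_nilpotent (m : set A) : artinian A -> local_with m ->
  exists k, forall x, pw m k x -> x = 0.
Proof.
move=> artA lm; have [[im nm _] _] := lm.
have [N NP] := artA (fun k => pw m k) (pw_ideal m) (fun k => @pw_le m k im).
(* One step beyond [N], so that [I] lies in [m] even when [N = 0]. *)
pose I := pw m N.+1.
have stable k : (N <= k)%N -> pw m k = I.
  by move=> Nk; rewrite (NP k Nk) -(NP N.+1).
exists N.+1 => x Ix; apply: contrapT => x0.
pose P (K : set A) := exists k a, [/\ K k, I a & k * a <> 0].
have [||K [iK [k [a [Kk Ia ka0]]] Kmin]] := @artinian_minimal P setT artA.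
  by split.
  by exists 1, x; rewrite mul1r.
pose K' : set A := fun y => exists b, I b /\ y = k * b.
have iI : is_ideal I by exact: pw_ideal.
have iK' : is_ideal K'.
  case: iI => I0 ID IM; split; first by exists 0; rewrite mulr0.
  - by move=> y z [b [Ib ->]] [c [Ic ->]]; exists (b + c); rewrite mulrDr; split=> //; exact: ID.
  - by move=> r y [b [Ib ->]]; exists (r * b); rewrite mulrCA; split=> //; exact: IM.
have PK' : P K'.
  apply: contrapT => nP; apply: ka0.
  have iL : is_ideal (fun y => k * y = 0).
    split; first by rewrite mulr0.
    - by move=> y z ey ez; rewrite mulrDr ey ez addr0.
    - by move=> r y ey; rewrite mulrCA ey mulr0.
  apply: (pw_add (m := N.+1) (k := N.+1) iL _ (z := a)).
    move=> b c Ib Ic; apply: contrapT => nz; apply: nP.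
    by exists (k * b), c; split; [exists b|exact: Ic|rewrite -mulrA].
  by rewrite stable // leqW // leq_addr.
have K'K : K' = K.
  apply: Kmin => // y [b [_ ->]]; rewrite mulrC; case: iK => _ _; exact.
have [b [Ib kE]] : K' k by rewrite K'K.
have mb : m b.
  by apply: Ib => // c d mc _; rewrite mulrC; case: im => _ _; exact.
have [|w wE] := local_unit (x := 1 - b) lm.
  move=> m1b; apply: nm; case: im => _ mD _.
  by rewrite -[1](subrK b); exact: mD.
apply: ka0; have -> : k = w * (k * (1 - b)) by rewrite mulrCA wE mulr1.
by rewrite mulrBr mulr1 -kE subrr mulr0 mul0r.
Qed.

End Krull.

Section FieldStructure.
Variable K : comNzRingType.
Hypothesis KV : forall x : K, x <> 0 -> exists y, y * x = 1.

Fact field_inv_exists : exists inv : K -> K,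
  (forall x, x != 0 -> inv x * x = 1) /\ inv 0 = 0.
Proof.
have H (x : K) : exists y, if x == 0 then y = 0 else y * x = 1.
  by case: eqP => [_|/KV []]; [exists 0|move=> y ey; exists y].
have [inv invP] := choice H; exists inv; split=> [x|].
  by have := invP x; case: eqP.
by have := invP 0; rewrite eqxx.
Qed.

Let inv := projT1 (cid field_inv_exists).
Let invV : forall x, x != 0 -> inv x * x = 1 := (projT2 (cid field_inv_exists)).1.
Let inv0 : inv 0 = 0 := (projT2 (cid field_inv_exists)).2.

Definition field_alias (_ : forall x : K, x <> 0 -> exists y, y * x = 1) : Type := K.
HB.instance Definition _ := GRing.ComNzRing.copy (field_alias KV) K.
HB.instance Definition _ :=
  GRing.ComNzRing_isField.Build (field_alias KV) invV inv0.

End FieldStructure.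

(** An equality of bundled rings, not just an isomorphism, lets complexes over [K] be read as
    complexes over a field; destructing [K] makes it hold by conversion. *)
Lemma field_structure (K : comNzRingType) :
  (forall x : K, x <> 0 -> exists y, y * x = 1) ->
  exists F : fieldType, (F : comNzRingType) = K.
Proof.
case: K => T [m1 m2 m3 m4 m5 m6 m7 m8 m9 m10 m11 m12] KV.
by exists (field_alias KV : fieldType).
Qed.

Definition lambda_char (R : comPzRingType) (K : comNzRingType)
    (phi : {rmorphism R -> K}) (X : complex R) : int :=
  euler_char (tensor_complex phi X (in_degree0 K^o)).

(** [K] is kept a variable so that its equality with a field can be eliminated; the residue rings
    are substituted later. *)
Lemma lambda_char_props (R : comPzRingType) (K : comNzRingType)
    (phi : {rmorphism R -> K}) :
  (forall x : K, x <> 0 -> exists y, y * x = 1) ->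
  [/\ forall A B D, ses A B D -> perfect B ->
        lambda_char phi B = lambda_char phi A + lambda_char phi D,
      forall X, contractible X -> lambda_char phi X = 0,
      forall (e : R) (N : lmodType R) (nu : N) (lam : {linear N -> R^o}), idem_module e nu lam ->
        phi e = 0 -> lambda_char phi (in_degree0 N) = 0 &
      forall (e : R) (N : lmodType R) (nu : N) (lam : {linear N -> R^o}), idem_module e nu lam ->
        phi e = 1 -> lambda_char phi (in_degree0 N) = 1].
Proof.
rewrite /lambda_char => /field_structure [F eF].
case: K / eF phi => phi'; split.
- exact: (@residue_euler_ses R F phi').
- exact: (@residue_euler_contractible R F phi').
- exact: (@residue_euler_out R F phi').
- exact: (@residue_euler_in R F phi').
Qed.

(** * Products of Artinian local rings *)

Section ProductRing.
Variables (R : comPzRingType) (n : nat) (R_ : 'I_n -> comNzRingType).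
Variables (p : forall i, Spec (R_ i)).
Hypotheses (artR_ : forall i, artinian (R_ i)) (locR_ : forall i, local_with (p i)).
Variable proj : forall i, {rmorphism R -> R_ i}.
Hypothesis prodR : is_product proj.

Lemma proj_inj r s : (forall i, proj i r = proj i s) -> r = s.
Proof.
move=> rs; have [t [_ tu]] := prodR (fun i => proj i r).
by rewrite -(tu r) ?(tu s).
Qed.

Lemma proj_lift i (x : R_ i) : exists r, proj i r = x.
Proof.
pose y j : R_ j := if i =P j is ReflectT ij then ecast k (R_ k) ij x else 0.
have [r [ry _]] := prodR y; exists r; rewrite ry /y.
by case: eqP => // ij; rewrite eq_axiomK.
Qed.

Fact component_exists : {e : 'I_n -> R |
  forall i j, proj j (e i) = (i == j)%:R}.
Proof.
have H i : exists e, forall j, proj j e = (i == j)%:R.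
  by have [e [eP _]] := prodR (fun j => (i == j)%:R); exists e.
by exists (fun i => sval (cid (H i))) => i; case: (cid (H i)).
Qed.

Definition component := sval component_exists.

Lemma proj_component i j : proj j (component i) = (i == j)%:R.
Proof. exact: (svalP component_exists). Qed.

Lemma component_orth i j : i != j -> component i * component j = 0.
Proof.
move=> ij; apply: proj_inj => k; rewrite rmorphM !proj_component rmorph0.
have [ik|ik] := eqVneq i k; last by rewrite mul0r.
by rewrite -ik eq_sym (negbTE ij) mulr0.
Qed.

Lemma component_idem i : component i * component i = component i.
Proof.
apply: proj_inj => k; rewrite rmorphM proj_component.
by case: (i == k); rewrite ?mul1r ?mul0r.
Qed.

Lemma component_sum : \sum_i component i = 1.
Proof.
apply: proj_inj => k; rewrite rmorph_sum rmorph1 (bigD1 k) //= proj_component eqxx.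
rewrite big1 ?addr0 // => i ik; rewrite proj_component (negbTE ik) //.
Qed.

Definition pJ i : R -> Prop := Defs.point proj p i.

Lemma pJE i r : pJ i r = p i (proj i r). Proof. by []. Qed.

Lemma pJ_ideal i : is_ideal (pJ i). Proof. exact: prime_ideal. Qed.

Lemma pJ_compl i : pJ i (1 - component i).
Proof.
rewrite pJE rmorphB rmorph1 proj_component eqxx subrr.
by case: (prime_ideal (p i)).
Qed.

Lemma pJ_unit i r : ~ pJ i r -> exists w, w * r * component i = component i.
Proof.
move=> nr; have [w0 wr] := local_unit (locR_ i) nr.
have [w wE] := proj_lift w0; exists w; apply: proj_inj => k.
rewrite !rmorphM proj_component; have [ik|ik] := eqVneq i k; last by rewrite mulr0.
by subst k; rewrite wE wr mulr1.
Qed.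

Lemma pJ_nil i : exists m, forall x, pw (pJ i) m x -> x * component i = 0.
Proof.
have [m mP] := artinian_local_nilpotent (@artR_ i) (locR_ i).
have pwproj k : forall x, pw (pJ i) k x -> pw (p i) k (proj i x).
  elim: k => [|k IHk] x px //.
  have [P0 PD PM] := pw_ideal (p i) k.+1.
  apply: (px (fun x => pw (p i) k.+1 (proj i x))).
    split; first by rewrite rmorph0.
    - by move=> y z; rewrite rmorphD; exact: PD.
    - by move=> r y; rewrite rmorphM; exact: PM.
  by move=> a b Ja /IHk pb; rewrite rmorphM; exact: pwS.
exists m => x /pwproj /mP x0; apply: proj_inj => k.
rewrite rmorphM rmorph0 proj_component.
have [ik|ik] := eqVneq i k; last by rewrite mulr0.
by subst k; rewrite x0 mul0r.
Qed.

Section Local.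
Variable i : 'I_n.
Let e := component i.
Let q := Defs.point proj p i.

Fact denom_inv_exists : exists w : denom q -> R, forall s, w s * dval s * e = e.
Proof.
have H (s : denom q) : exists w, w * dval s * e = e.
  by case: s => s ns; exact: pJ_unit.
by have [w wP] := choice H; exists w.
Qed.

Let w := projT1 (cid denom_inv_exists).
Let wP s : w s * dval s * e = e := projT2 (cid denom_inv_exists) s.

Let lam (x : Defs.frac q) : R := w x.2 * x.1 * e.

Let denom_cancel (s : denom q) x : dval s * x * e = 0 -> x * e = 0.
Proof.
move=> sx; rewrite -(wP s) mulrA [x * _]mulrC -mulrA.
by rewrite -[RHS](mulr0 (w s)) -sx; ring.
Qed.

Let lam_wd x y : frac_eq x y -> lam x = lam y.
Proof.
move=> [u exy]; apply/eqP; rewrite -subr_eq0 /lam -mulrBl; apply/eqP.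
apply: (denom_cancel (s := u)); apply: (denom_cancel (s := x.2)).
apply: (denom_cancel (s := y.2)).
have -> : dval y.2 * (dval x.2 * (dval u * (w x.2 * x.1 - w y.2 * y.1))) * e =
  dval u * (x.1 * dval y.2) * (w x.2 * dval x.2 * e) -
  dval u * (y.1 * dval x.2) * (w y.2 * dval y.2 * e) by ring.
by rewrite !wP exy subrr.
Qed.

(** A fraction b / s goes to [w s * b * e], where [w s] inverts s on the factor [i]. *)
Lemma localization_idem_exists : exists (nu : localization q)
  (lambda : {linear localization q -> R^o}), idem_module e nu lambda.
Proof.
have lamE x : lam (rep (cls (x : loc_premodule q))) = lam x.
  exact: (lam_wd (rep_cls (x : loc_premodule q))).
have l : linear (fun y : localization q => lam (rep y) : R^o).
  move=> a x y; rewrite -[x]repK -[y]repK -clsZ -clsD !lamE.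
  move: (rep x) (rep y) => [b s] [c t]; rewrite /lam /= /GRing.scale /=.
  apply/eqP; rewrite -subr_eq0; apply/eqP.
  set W := w _.
  have WE : W * (dval s * dval t) * e = e := wP (denom_prod s t).
  have -> : W * (a * b * dval t + c * dval s) * e -
      (a * (w s * b * e) + w t * c * e) =
    (W * (a * b * dval t + c * dval s) - (a * (w s * b) + w t * c)) * e by ring.
  apply: (denom_cancel (s := s)); apply: (denom_cancel (s := t)).
  have -> : dval t * (dval s * (W * (a * b * dval t + c * dval s) -
      (a * (w s * b) + w t * c))) * e =
    (a * b * dval t + c * dval s) * (W * (dval s * dval t) * e) -
    (a * b * dval t * (w s * dval s * e) + c * dval s * (w t * dval t * e)).
    by ring.
  by rewrite WE !wP; ring.
exists (cls ((1, denom1 q) : loc_premodule q)), (mklinear l); split.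
  rewrite /= lamE /lam /=; have := wP (denom1 q).
  by rewrite /dval /=.
move=> y; rewrite -[y]repK /= lamE -clsZ; apply/clsP.
case: (rep y) => b s; rewrite /lam /=.
have ne : ~ q e.
  move=> qe; have := @prime_proper R q; apply; case: (pJ_ideal i) => _ D _.
  by rewrite -[1](subrK e); apply: D => //; exact: pJ_compl.
exists (exist _ e ne) => /=; rewrite /dval /=.
rewrite -[sval s]/(dval s).
transitivity (b * (w s * dval s * e) * (e * 1)); first by ring.
have ee : e * e = e := component_idem i.
by rewrite wP !mulr1 -mulrA ee mulrC.
Qed.

End Local.

Fact localization_choice : exists (nu : forall i, localization (Defs.point proj p i))
  (lambda : forall i, {linear localization (Defs.point proj p i) -> R^o}),
  forall i, idem_module (component i) (nu i) (lambda i).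
Proof.
exists (fun i => projT1 (cid (localization_idem_exists i))).
exists (fun i => projT1 (cid (projT2 (cid (localization_idem_exists i))))) => i.
exact: (projT2 (cid (projT2 (cid (localization_idem_exists i))))).
Qed.

Lemma product_local_family (N : 'I_n -> lmodType R) (nu : forall i, N i)
    (lambda : forall i, {linear N i -> R^o}) :
  (forall i, idem_module (component i) (nu i) (lambda i)) ->
  local_family pJ component nu lambda.
Proof.
move=> idN; split=> //.
- exact: pJ_ideal.
- by move=> i; exact: prime_proper.
- exact: component_orth.
- exact: component_sum.
- exact: pJ_compl.
- exact: pJ_unit.
- exact: pJ_nil.
Qed.

Lemma Spec_ext (q q' : Spec R) : (forall x, q x <-> q' x) -> q = q'.
Proof.
case: q => S i1 n1 m1; case: q' => S' i2 n2 m2 /= SS'.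
have eS : S = S' by apply/funext => x; exact/propext.
by subst S'; congr PrimeIdeal; exact: Prop_irrelevance.
Qed.

Lemma component_out i : ~ pJ i (component i).
Proof.
move=> Je; apply: (@prime_proper R (Defs.point proj p i)).
case: (pJ_ideal i) => _ D _.
by rewrite -[1](subrK (component i)); apply: D => //; exact: pJ_compl.
Qed.

Lemma component_in i j : i != j -> pJ j (component i).
Proof.
move=> ij; rewrite pJE proj_component (negbTE ij).
by case: (prime_ideal (p j)).
Qed.

Lemma point_inj : injective (Defs.point proj p).
Proof.
move=> i j ij; apply/eqP; apply: contrapT => /negP ne.
by apply: (@component_out i); rewrite /pJ ij; exact: component_in.
Qed.

(** [q] misses some e_i, as these sum to 1. Elements outside p_i are invertible on that factor, so
    [q] lies in p_i; elements of p_i are nilpotent on it, so p_i lies in [q]. *)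
Lemma point_surj (q : Spec R) : exists i, q = Defs.point proj p i.
Proof.
have [q0 qD qM] := prime_ideal q.
have [i ni] : exists i, ~ q (component i).
  apply: contrapT => no; apply: (@prime_proper R q).
  rewrite -component_sum; apply: big_ind => // i _.
  by apply: contrapT => ni; apply: no; exists i.
exists i; apply: Spec_ext => r; split=> qr.
  apply: contrapT => /pJ_unit [w wE]; apply: ni.
  by rewrite -wE mulrC mulrA; apply: (qM _ _ qr).
have [m mP] := pJ_nil i.
have pwX k : pw (pJ i) k (r ^+ k).
  by elim: k => [|k IHk] //; rewrite exprS; exact: (pwS qr IHk).
have : q (r ^+ m * component i) by rewrite mP.
move=> /primeM [] // {mP}.
elim: m => [|m IHm]; first by move=> /(@prime_proper R q).
by rewrite exprS => /primeM [].
Qed.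

Lemma residue_map0 i r : residue_map proj p i r = 0 <-> pJ i r.
Proof.
rewrite /residue_map /= -(rmorph0 (residue_proj (p i))).
split=> [/eqP|pr].
  by rewrite -Quotient.idealrBE subr0 => /asboolP.
by apply/eqP; rewrite -Quotient.idealrBE subr0; exact/asboolP.
Qed.

Lemma residue_inverse i (x : residue_ring (p i)) : x <> 0 -> exists y, y * x = 1.
Proof.
have [r <-] : exists r, residue_map proj p i r = x.
  have [r rE] := proj_lift (repr x : R_ i); exists r.
  by rewrite /residue_map /= rE; exact: reprK.
move=> /residue_map0 /pJ_unit [w wE]; exists (residue_map proj p i w).
rewrite -rmorphM; apply/eqP; rewrite -subr_eq0 -(rmorph1 (residue_map proj p i)) -rmorphB.
apply/eqP/residue_map0.
have -> : w * r - 1 = (w * r - 1) * (1 - component i).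
  by rewrite mulrBr mulr1 mulrBl wE mul1r subrr subr0.
by case: (pJ_ideal i) => _ _ M; apply: M; exact: pJ_compl.
Qed.

Lemma Lambda_additive (N : 'I_n -> lmodType R) (nu : forall i, N i)
    (lambda : forall i, {linear N i -> R^o}) :
  (forall i, idem_module (component i) (nu i) (lambda i)) ->
  additive_invariant N (Lambda proj p).
Proof.
move=> idN; split=> [i|i X _|i j].
- by have [H _ _ _] := lambda_char_props (residue_map proj p i) (@residue_inverse i).
- by have [_ H _ _] := lambda_char_props (residue_map proj p i) (@residue_inverse i); exact: H.
have [_ _ H0 H1] := lambda_char_props (residue_map proj p i) (@residue_inverse i).
have [ij|ij] := eqVneq i j.
  subst j; apply: (H1 _ _ _ _ (idN i)).
  apply/eqP; rewrite -subr_eq0 -(rmorph1 (residue_map proj p i)) -rmorphB.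
  apply/eqP/residue_map0; rewrite -opprB -mulN1r.
  by case: (pJ_ideal i) => _ _ M; apply: M; exact: pJ_compl.
by apply: (H0 _ _ _ _ (idN j)); apply/residue_map0; apply: component_in; rewrite eq_sym.
Qed.

End ProductRing.

(** * Classification *)

Section ExactnessClosure.
Variables (R : comPzRingType) (e : R).
Implicit Types X Y : complex R.

Definition e_acyclic X : Prop := forall b, e_exact X e b.

Lemma e_acyclic_equiv X Y : homotopy_equiv X Y -> e_acyclic X -> e_acyclic Y.
Proof.
move=> [f [g [_ [k kP]]]] eX b z dz.
have [|x dx] := eX b (g _ z); first by rewrite cmap_diff dz linear0.
(* [f b x] bounds e f g z, and the homotopy [k] corrects this to e z. *)
exists (f b x - e *: k b z).
rewrite linearB linearZ cmap_diff dx linearZ /= -scalerBr.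
have := kP b z; rewrite /= dz linear0 addr0 => <-.
by rewrite subKr.
Qed.

Lemma e_acyclic_shift X : e_acyclic (shift X) <-> e_acyclic X.
Proof.
split=> eX b z dz.
  have E : forall c, e_exact X e (c - 1).
    move=> c y dy; have [|x dx] := eX c y; first by rewrite /= dy oppr0.
    by exists (- x); rewrite linearN.
  by move: (E (b + 1)); rewrite addrK => H; exact: H.
have [|y dy] := eX (b - 1) z; first by apply/eqP; rewrite -oppr_eq0; apply/eqP.
by exists (- y); rewrite /= linearN opprK.
Qed.

Lemma e_acyclic_dsum X Y : e_acyclic X -> e_acyclic Y -> e_acyclic (dsum X Y).
Proof.
move=> eX eY b [x y] [dx dy]; have [x' dx'] := eX b x dx.
by have [y' dy'] := eY b y dy; exists (x', y'); congr (_, _).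
Qed.

Lemma e_acyclic_cone X Y (f : chain_map X Y) : e * e = e ->
  e_acyclic X -> e_acyclic Y -> e_acyclic (cone f).
Proof.
move=> ee eX eY b [x y] [dx fxy].
have [|x' dx'] := eX (b - 1) x.
  by apply/eqP; rewrite -oppr_eq0; apply/eqP.
have [|y' dy'] := eY b (e *: y + f _ x').
  rewrite linearD linearZ cmap_diff dx' linearZ /= -scalerDr.
  have -> : cdiff Y (b - 1) y + f (b - 1 - 1) x = 0.
    by rewrite -[RHS]fxy; exact: addrC.
  by rewrite scaler0.
exists (- (e *: x'), y'); congr (_, _); rewrite /=.
  by rewrite linearN opprK linearZ /= dx' scalerA ee.
rewrite dy' linearN linearZ /= scalerDr scalerA ee.
exact: addNKC.
Qed.

End ExactnessClosure.

Lemma equiv_cone_contractible (R : comPzRingType) (X Y : complex R) :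
  perfect X -> perfect Y -> homotopy_equiv X Y ->
  exists f : chain_map X Y, contractible (cone f).
Proof.
move=> pX pY [f [g [[h hP] [k kP]]]]; exists f.
apply: acyclic_contractible; first exact: perfect_cone.
move=> b [x y] [dx fxy].
have {}dx : cdiff X (b - 1 - 1) x = 0.
  by apply/eqP; rewrite -oppr_eq0; apply/eqP.
have gfx : g _ (f _ x) = x + cdiff X (b - 1) (h (b - 1) x).
  have := hP (b - 1) x; rewrite dx linear0 addr0; exact: subr_eq_addr.
have dgy : cdiff X (b - 1) (g (b - 1) y) = - g (b - 1 - 1) (f (b - 1 - 1) x).
  by rewrite cmap_diff -linearN -(addr0_eq fxy).
(* [a] has boundary [- x]; what is left of [y] is the cycle [y'], homologous to f g y' by [k]. *)
pose a := g (b - 1) y + h (b - 1) x.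
have da : cdiff X (b - 1) a = - x.
  rewrite linearD dgy gfx; exact: addN_shift.
pose y' := y - f _ a.
have dy' : cdiff Y (b - 1) y' = 0.
  rewrite linearB cmap_diff da linearN opprK.
  by have := fxy; rewrite /= => e; rewrite -[RHS]e; exact: addrC.
exists (a + g _ y', - k b y'); congr (_, _); rewrite /=.
  by rewrite linearD da cmap_diff dy' linear0 addr0 opprK.
rewrite linearN linearD.
have := kP b y'; rewrite /= dy' linear0 addr0 => <-.
exact: cone_identity3.
Qed.

Lemma homotopy_equiv_refl (R : comPzRingType) (X : complex R) : homotopy_equiv X X.
Proof.
exists (chain_id X), (chain_id X).
by split; exists (fun=> \0) => i x; rewrite /= subrr linear0 addr0.
Qed.

Section Classification.
Variables (R : comPzRingType) (n : nat) (R_ : 'I_n -> comNzRingType).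
Variables (p : forall i, Spec (R_ i)).
Hypotheses (artR_ : forall i, artinian (R_ i)) (locR_ : forall i, local_with (p i)).
Variable proj : forall i, {rmorphism R -> R_ i}.
Hypothesis prodR : is_product proj.

Let pnt := Defs.point proj p.
Let e := component prodR.
Let N i := localization (pnt i).
Variables (nu : forall i, N i) (lambda : forall i, {linear N i -> R^o}).
Hypothesis idN : forall i, idem_module (e i) (nu i) (lambda i).

Let LF : local_family (pJ p proj) e nu lambda :=
  product_local_family artR_ locR_ idN.
Let chiP : additive_invariant N (Lambda proj p) :=
  Lambda_additive locR_ idN.
Let ee i : e i * e i = e i := component_idem prodR i.

Lemma supportedE S X : supported S X <->
  perfect X /\ forall i, pnt i \notin S -> e_acyclic (e i) X.
Proof.
split=> -[pX sX]; split=> //.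
  move=> i /negP nS; apply/(tens_idem_acyclic (idN i)); apply: contrapT => na.
  by apply: nS; apply/mem_set/sX.
move=> q qX; have [i qi] := point_surj artR_ locR_ prodR q.
apply: contrapT => nS; apply: qX; rewrite qi.
apply/(tens_idem_acyclic (idN i)); apply: sX.
by apply/negP => /set_mem; rewrite /pnt -qi.
Qed.

Lemma Lambda_equiv X Y i : perfect X -> perfect Y -> homotopy_equiv X Y ->
  Lambda proj p i X = Lambda proj p i Y.
Proof.
move=> pX pY XY; have [f cf] := equiv_cone_contractible pX pY XY.
have pC := perfect_cone f pX pY.
have := chi_ses chiP i (ses_cone f) pC.
rewrite (chi_contractible chiP i pC cf) (chi_shift chiP i pX).
by move/esym/subr0_eq.
Qed.

Lemma Lambda_cone X Y (f : chain_map X Y) i : perfect X -> perfect Y ->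
  Lambda proj p i (cone f) = Lambda proj p i Y - Lambda proj p i X.
Proof.
move=> pX pY; rewrite (chi_ses chiP i (ses_cone f)) ?(chi_shift chiP i pX) //.
exact: perfect_cone.
Qed.

Lemma perfect_shift_iff (X : complex R) : perfect X <-> perfect (shift X).
Proof.
split=> [|/perfectE [[b bX] fX]]; first exact: perfect_shift.
apply/perfectE; split=> [|i]; last by have := fX (i + 1); rewrite /= addrK.
exists b.+1 => i bi.
have: forall x : shift X (i + 1), x = 0 by apply: bX; lia.
by rewrite /= addrK.
Qed.

Lemma TSH_triangulated S (H : set (Zsum proj p S)) : subgroup H ->
  triangulated (TSH H).
Proof.
move=> [H0 HB]; have HN x : H x -> H (- x) by rewrite -sub0r; exact: HB.
have Lcone X Y (f : chain_map X Y) : perfect X -> perfect Y ->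
    LambdaS proj p S (cone f) = LambdaS proj p S Y - LambdaS proj p S X.
  by move=> pX pY; apply/ffunP => i; rewrite !ffunE Lambda_cone.
have Lshift X : perfect X -> LambdaS proj p S (shift X) = - LambdaS proj p S X.
  by move=> pX; apply/ffunP => i; rewrite !ffunE (chi_shift chiP).
split.
- by move=> X [[]].
- exists (zeroc R); split.
    apply/supportedE; split; first by apply: trivial_perfect => i x; exact: rV0.
    by move=> i _ b z _; exists 0; rewrite linear0 [RHS]rV0.
  suff -> : LambdaS proj p S (zeroc R) = 0 by [].
  apply/ffunP => i; rewrite !ffunE; apply: (chi_contractible chiP).
    by apply: trivial_perfect => j x; exact: rV0.
  by apply: trivial_contractible => j x; exact: rV0.
- move=> X Y [/supportedE [pX sX] HX] pY XY; split.
    apply/supportedE; split=> // i iS; exact: e_acyclic_equiv XY (sX i iS).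
  suff <- : LambdaS proj p S X = LambdaS proj p S Y by [].
  by apply/ffunP => i; rewrite !ffunE; exact: Lambda_equiv.
- move=> X; split=> -[/supportedE [pX sX] HX].
    split; last by rewrite Lshift //; exact: HN.
    apply/supportedE; split=> [|i iS]; first exact: (perfect_shift pX).
    exact/e_acyclic_shift/sX.
  have {}pX := (perfect_shift_iff X).2 pX; split.
    by apply/supportedE; split=> // i iS; exact/e_acyclic_shift/sX.
  by rewrite -[LambdaS _ _ _ _]opprK -Lshift //; exact: HN.
- move=> X Y f [/supportedE [pX sX] HX] [/supportedE [pY sY] HY]; split.
    apply/supportedE; split=> [|i iS]; first exact: perfect_cone.
    by apply: e_acyclic_cone => //; [exact: sX|exact: sY].
  by rewrite Lcone //; exact: HB.
Qed.

Lemma triangulated_classified (C : complex R -> Prop) : triangulated C ->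
  exists (S : set (Spec R)) (H : set (Zsum proj p S)),
    subgroup H /\ forall X, C X <-> TSH H X.
Proof.
move=> tC; have C23 := triangulated_closed23 tC.
(* By [thick_cell], every point at which some object of [C] is not acyclic belongs to this set. *)
pose S : set (Spec R) := [set q | exists i, q = pnt i /\
  thick_closure C (in_degree0 (N i))]%classic.
pose H : set (Zsum proj p S) := [set v | exists X, C X /\ LambdaS proj p S X = v]%classic.
have SP i : pnt i \in S -> thick_closure C (in_degree0 (N i)).
  by move=> /set_mem [j [/(point_inj prodR) -> ]].
have acS X i : C X -> pnt i \notin S -> e_acyclic (e i) X.
  move=> CX /negP nS b; apply: contrapT => nb; apply: nS; apply/mem_set.
  exists i; split=> //.
  exact: (thick_cell LF (thick_closure_thick C23) (thick_closure_sub C23 CX) nb).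
exists S, H; split.
  split.
    exists (zeroc R); split; first exact: c_zeroc.
    apply/ffunP => i; rewrite !ffunE; apply: (chi_contractible chiP).
      exact: perfect_zeroc C23.
    by apply: trivial_contractible => j x; exact: rV0.
  move=> _ _ [X [CX <-]] [Y [CY <-]]; exists (dsum X (shift Y)).
  have pX := c_perfect C23 CX; have pY := c_perfect C23 CY.
  split; first by apply: c_dsum => //; exact: c_shift.
  apply/ffunP => i; rewrite !ffunE (chi_dsum chiP) ?(chi_shift chiP) //.
  exact: perfect_shift.
move=> X; split=> [CX|[/supportedE [pX sX] [Y [CY YX]]]].
  split; last by exists X.
  by apply/supportedE; split=> [|i]; [exact: c_perfect CX|exact: acS].
apply: (chi_classify LF chiP (P := fun i => pnt i \in S) C23 SP CY pX).
- by move=> i; exact: acS.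
- exact: sX.
by move=> i iS; have /ffunP /(_ (exist _ i iS)) := YX; rewrite !ffunE.
Qed.

Lemma cell_acyclic i j : i != j -> e_acyclic (e j) (in_degree0 (N i)).
Proof.
move=> ij b z _; exists 0; rewrite linear0 -(cell_fixed LF z) scalerA.
by rewrite (component_orth prodR) ?scale0r // eq_sym.
Qed.

(** It suffices to tensor with cells: X (x) N_j is contractible for j other than i, and X (x) N_i
    agrees with X up to a contractible complex because X is exact on all other factors. *)
Lemma singleton_ideal q (C : complex R -> Prop) : triangulated C -> dense C (supported [set q]%classic) ->
  triangulated_ideal C.
Proof.
move=> tC [CS _]; split=> // X Y CX pY; have C23 := triangulated_closed23 tC.
have [i qi] := point_surj artR_ locR_ prodR q.
have /supportedE [pX sX] := CS X CX.
have idi : idem_module (\sum_(j | pred1 i j) e j) (nu i) (lambda i).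
  by rewrite big_pred1_eq; exact: idN.
have aX j : j != i -> e_acyclic (e j) X.
  move=> ji; apply: sX; apply/negP => /set_mem /=.
  by rewrite qi => /(point_inj prodR) /eqP; exact/negP.
suff [] : perfect Y /\ C (tens X Y) by [].
apply: (generation LF (closed23_tens_r C23 pX)) pY => j.
have pj := idem_perfect (idN j); split=> //.
have [->|ji] := eqVneq j i; last first.
  apply: (c_contr C23); first exact: perfect_tens.
  apply: acyclic_contractible; first exact: perfect_tens.
  by apply/(tens_idem_acyclic (idN j)) => b; exact: aX.
apply: (c_sub C23 (ses_beta (idN i) X) CX); apply: (c_contr C23).
  exact: ses_perfect_quo (ses_beta (idN i) X) pX.
by apply: (idem_part_equiv LF idi pX) => j' ji; exact: aX.
Qed.

Lemma two_points_not_ideal S i j : i != j -> pnt i \in S -> pnt j \in S ->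
  exists C, [/\ triangulated C, dense C (supported S) & ~ triangulated_ideal C].
Proof.
move=> ij iS jS.
pose si : {i | pnt i \in S} := exist _ i iS.
pose sj : {i | pnt i \in S} := exist _ j jS.
pose H : set (Zsum proj p S) := [set v : Zsum proj p S | v si = v sj]%classic.
have sH : subgroup H.
  split=> [|x y]; first by rewrite /H /= !ffunE.
  by rewrite /H /= !ffunE => -> ->.
have pc k := idem_perfect (idN k).
have sc k : pnt k \in S -> supported S (in_degree0 (N k)).
  move=> kS; apply/supportedE; split=> // l lS; apply: cell_acyclic.
  by apply: contraNneq lS => <-.
have sD X Y : supported S X -> supported S Y -> supported S (dsum X Y).
  move=> /supportedE [pX sX] /supportedE [pY sY]; apply/supportedE.
  split; first exact: perfect_dsum.
  by move=> k kS; apply: e_acyclic_dsum; [exact: sX|exact: sY].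
exists (TSH H); split; first exact: TSH_triangulated.
  (* The invariants of X + shift X vanish, so it lies in [TSH H]; this gives density. *)
  split=> [X []|X sX] //; exists (shift X), (dsum X (shift X)).
  have sX' : supported S (shift X).
    move/supportedE: (sX) => [pX aX]; apply/supportedE.
    by split=> [|k kS]; [exact: perfect_shift|exact/e_acyclic_shift/aX].
  split=> //; last exact: homotopy_equiv_refl.
  split; first exact: sD.
  have [pX _] := sX; have [pX' _] := sX'.
  have L0 k : Lambda proj p k (dsum X (shift X)) = 0.
    by rewrite (chi_dsum chiP k pX pX') (chi_shift chiP k pX) subrr.
  by rewrite /H /= !ffunE !L0.
move=> [_ idl].
have CX : TSH H (dsum (in_degree0 (N i)) (in_degree0 (N j))).
  split; first by apply: sD; exact: sc.
  rewrite /H /= !ffunE !(chi_dsum chiP) ?(chi_cell chiP) //= !eqxx.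
  by rewrite [j == i]eq_sym (negbTE ij).
have [_] := idl _ _ CX (pc i).
(* Tensoring with N_i kills N_j and fixes N_i up to contractible complexes, so the invariants at i
   and j become 1 and 0. *)
have chiT k : Lambda proj p k (tens (dsum (in_degree0 (N i)) (in_degree0 (N j)))
    (in_degree0 (N i))) = (k == i)%:Z.
  have pT X : perfect X -> perfect (tens X (in_degree0 (N i))).
    by move=> pX; exact: perfect_tens.
  rewrite (chi_ses chiP k (ses_tens_l _ (in_degree0 (N i)) (ses_dsum _ _))); last first.
    by apply: pT; exact: perfect_dsum.
  rewrite [X in _ + X](chi_contractible chiP); first last.
  - apply: acyclic_contractible; first exact: pT.
    by apply/(tens_idem_acyclic (idN i)) => b; apply: cell_acyclic; rewrite eq_sym.
  - exact: pT.
  have := chi_ses chiP k (ses_beta (idN i) (in_degree0 (N i))) (pc i).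
  rewrite (chi_cell chiP) [X in _ + X](chi_contractible chiP) => [->||] //.
    exact: ses_perfect_quo (ses_beta _ _) (pc i).
  apply: acyclic_contractible; first exact: ses_perfect_quo (ses_beta (idN i) _) (pc i).
  apply: (coker_beta_acyclic (idN i)) => b z _; exists 0; rewrite linear0.
  by rewrite scalerBl scale1r (cell_fixed LF) subrr.
rewrite /H /= !ffunE !chiT /= eqxx [j == i]eq_sym (negbTE ij) //.
Qed.

End Classification.

Local Open Scope classical_set_scope.

Theorem theorem4p19 (R : comPzRingType) (artR : artinian R)
    (n : nat) (R_ : 'I_n -> comNzRingType) (p : forall i, Spec (R_ i))
    (artR_ : forall i, artinian (R_ i))
    (locR_ : forall i, local_with (p i))
    (proj : forall i, {rmorphism R -> R_ i})
    (prodR : is_product proj) :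
  ((forall (S : set (Spec R)) (H : set (Zsum proj p S)),
      subgroup H -> triangulated (TSH H)) /\
   (forall C : complex R -> Prop, triangulated C ->
      exists (S : set (Spec R)) (H : set (Zsum proj p S)),
        subgroup H /\ forall X, C X <-> TSH H X)) /\
  (forall S : set (Spec R), S !=set0 ->
     ((forall C : complex R -> Prop, triangulated C -> dense C (supported S) ->
         triangulated_ideal C) <->
      exists q : Spec R, S = [set q])).
Proof.
have [nu [lambda idN]] := localization_choice locR_ prodR.
split; first split.
- by move=> S H; exact: (TSH_triangulated artR_ locR_ idN).
- by move=> C; exact: (triangulated_classified artR_ locR_ idN).
(* For empty [S] every dense subcategory consists of contractible complexes and is an ideal, so the
   point [q] has to come from the assumption on [S]. *)
move=> S [q Sq]; split=> [idl|[q' ->] C tC dC]; last first.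
  exact: (singleton_ideal artR_ locR_ idN tC dC).
exists q; apply/seteqP; split=> [q' Sq'|q' ->] //=.
have [i qi] := point_surj artR_ locR_ prodR q.
have [j qj] := point_surj artR_ locR_ prodR q'.
have [ij|ij] := eqVneq i j; first by rewrite qj -ij.
have [||C [tC dC nC]] := two_points_not_ideal artR_ locR_ idN (S := S) ij.
- by rewrite -qi; exact: mem_set.
- by rewrite -qj; exact: mem_set.
by case: nC; exact: idl.
Qed.
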